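(* Let $\varepsilon>0$ and let $G_1=(V_1,E_1)$, $G_2=(V_2,E_2)$ be connected straight-line embedded graphs, with $n_1=|V_1|$ and $m_2=|E_2|$. If $G_1$ is a tree, then the General Decision Algorithm (strong version, described in the context) decides whether $\vec{\delta}_{G}(G_1,G_2)\le\varepsilon$ in $O(n_1\cdot m_2^2)$ time and space.
   Context: A (straight-line) embedded graph is a finite undirected graph whose vertices are embedded as points in $\mathbb{R}^d$ and whose edges are the straight-line segments between their endpoints. Edges may cross; a crossing of two edges is not a vertex, and paths may change edges only at vertices. A graph mapping $s\colon G_1\to G_2$ maps each vertex $v\in V_1$ to a point $s(v)$ on an edge of $G_2$, and each edge $\{u,v\}\in E_1$ to a simple path from $s(u)$ to $s(v)$ in the embedding of $G_2$. The Fréchet distance of curves $f,g\colon[0,1]\to\mathbb{R}^d$ is $\delta_{F}(f,g)=\inf_{\sigma}\max_{t\in[0,1]}\|f(t)-g(\sigma(t))\|$, where $\sigma$ ranges over orientation-preserving homeomorphisms of $[0,1]$. The directed (strong) graph distance is $\vec{\delta}_{G}(G_1,G_2)=\inf_{s}\max_{e\in E_1}\delta_{F}(e,s(e))$, over all graph mappings $s$ from $G_1$ to $G_2$. An $\varepsilon$-placement of a vertex $v\in V_1$ is a maximal connected part of $G_2$ restricted to the $\varepsilon$-ball $B_\varepsilon(v)$ around $v$. An $\varepsilon$-placement of an edge $\{u,v\}\in E_1$ is a path $P$ in $G_2$ connecting an $\varepsilon$-placement $C_u$ of $u$ and an $\varepsilon$-placement $C_v$ of $v$ (from a point of $C_u$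 to a point of $C_v$) with $\delta_{F}(\{u,v\},P)\le\varepsilon$; then $C_u$ and $C_v$ are called reachable from each other. A vertex placement $C_v$ is valid if for every neighbor $u$ of $v$ in $G_1$ there is a (not deleted) $\varepsilon$-placement $C_u$ of $u$ reachable from $C_v$; otherwise it is invalid. General Decision Algorithm (strong version): (1) compute all $\varepsilon$-placements of all vertices of $G_1$; (2) for each edge $\{u,v\}\in E_1$ compute which placements of $u$ and $v$ are reachable from each other; (3) repeatedly delete invalid vertex placements until none is left; (4) decide whether there is a placement of the whole graph $G_1$; in the case of the claim, answer ''yes'' if and only if every vertex of $G_1$ has at least one remaining placement. Running times are counted with unit-cost real arithmetic, as is standard in computational geometry. *)

(* Defs.v *)
(* MathComp / MathComp-Analysis development. *)
From HB Require Import structures.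
From mathcomp Require Import all_boot all_order all_algebra.
From mathcomp Require Import all_classical all_reals all_analysis.
Set Implicit Arguments.
Unset Strict Implicit.
Unset Printing Implicit Defensive.
Import Order.TTheory GRing.Theory Num.Theory.
Import numFieldNormedType.Exports.
Local Open Scope classical_set_scope.
Local Open Scope ring_scope.

(** * Embedded graphs *)

(* A finite simple undirected graph with numbered vertices and edges, given by
   its edge list; the pair [ends e] is an arbitrary orientation of the edge [e].
   Edges may cross in R^d, and no general position is assumed. *)
Record embgraph (R : realType) (d : nat) := EmbGraph {
  nv : nat;
  ne : nat;
  ends : 'I_ne -> 'I_nv * 'I_nv;
  pos : 'I_nv -> 'rV[R]_d;
  ends_loopless : forall e, (ends e).1 != (ends e).2;
  ends_simple : forall e f,
    ends e = ends f \/ ends e = ((ends f).2, (ends f).1) -> e = f }.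

Definition adj (R : realType) d (G : embgraph R d) : rel 'I_(nv G) :=
  fun u v => [exists e, (ends (e : 'I_(ne G)) == (u, v)) || (ends e == (v, u))].
Arguments adj {R d} G.

Definition graph_connected (R : realType) d (G : embgraph R d) : Prop :=
  forall u v : 'I_(nv G), connect (adj G) u v.

Definition acyclic (R : realType) d (G : embgraph R d) : Prop :=
  forall c : seq 'I_(nv G), (2 < size c)%N -> ~ ucycle (adj G) c.

Definition is_tree (R : realType) d (G : embgraph R d) : Prop :=
  graph_connected G /\ acyclic G.

(** * Points, paths and distances *)

(* The norm [`| |] of the library on row vectors is the max norm. *)
Definition enorm (R : realType) d (x : 'rV[R]_d) : R :=
  Num.sqrt (\sum_i x 0 i ^+ 2).

(* A point of G is given in barycentric coordinates, one per vertex (the usual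
   geometric realization of G as a simplicial complex), so that distinct edges
   share at most an endpoint even where their images in R^d cross or overlap.
   [locate] sends such a point to its position in R^d. *)
Definition gpoint (R : realType) d (G : embgraph R d) := 'rV[R]_(nv G).

Definition edge_set (R : realType) d (G : embgraph R d) (e : 'I_(ne G)) :
    set (gpoint G) :=
  [set (1 - t) *: delta_mx 0 (ends e).1 + t *: delta_mx 0 (ends e).2
     | t in `[0, 1]].
Arguments edge_set {R d} G e.

Definition realization (R : realType) d (G : embgraph R d) : set (gpoint G) :=
  \bigcup_e edge_set G e.
Arguments realization {R d} G.

Definition locate (R : realType) d (G : embgraph R d) (x : gpoint G) :
    'rV[R]_d :=
  \sum_i x 0 i *: pos i.

Definition is_path (R : realType) d (G : embgraph R d) (P : R -> gpoint G) :
    Prop :=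
  {within `[0, 1], continuous (P : R -> 'rV[R]_(nv G))} /\
  (forall t : R, t \in `[0, 1] -> realization G (P t)).

(* The second alternative is the trivial path from a point to itself. *)
Definition is_simple_path (R : realType) d (G : embgraph R d)
    (P : R -> gpoint G) : Prop :=
  is_path P /\
  ({in `[0, 1] &, injective P} \/ (forall t : R, t \in `[0, 1] -> P t = P 0)).

Definition segment (R : realType) d (p q : 'rV[R]_d) (t : R) : 'rV[R]_d :=
  (1 - t) *: p + t *: q.

(* Continuity of the inverse follows from compactness of [0, 1]. *)
Definition orientation_homeo (R : realType) : set (R -> R) :=
  [set sigma : R -> R | [/\ set_bij `[0, 1] `[0, 1] sigma,
                   {within `[0, 1], continuous sigma} &
                   {in `[0, 1] &, {homo sigma : x y / x < y}}]].

Definition frechet (R : realType) d (f g : R -> 'rV[R]_d) : \bar R :=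
  ereal_inf [set ereal_sup [set (enorm (f t - g (sigma t)))%:E | t in `[0, 1]]
               | sigma in @orientation_homeo R].

Record graph_map (R : realType) d (G1 G2 : embgraph R d) := GraphMap {
  on_vertex : 'I_(nv G1) -> gpoint G2;
  on_edge : 'I_(ne G1) -> R -> gpoint G2;
  on_vertexP : forall v, realization G2 (on_vertex v);
  on_edgeP : forall e, [/\ is_simple_path (on_edge e),
                           on_edge e 0 = on_vertex (ends e).1 &
                           on_edge e 1 = on_vertex (ends e).2] }.

Definition edge_cost (R : realType) d (G1 G2 : embgraph R d)
    (e : 'I_(ne G1)) (P : R -> gpoint G2) : \bar R :=
  frechet (segment (pos (ends e).1) (pos (ends e).2)) (fun t => locate (P t)).

Definition graph_dist (R : realType) d (G1 G2 : embgraph R d) : \bar R :=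
  ereal_inf [set \big[maxe/-oo%E]_(e < ne G1) edge_cost e (on_edge s e)
               | s in [set: graph_map G1 G2]].

(** * The General Decision Algorithm, strong version *)

Definition in_ball (R : realType) d (G1 G2 : embgraph R d) (eps : R)
    (v : 'I_(nv G1)) : set (gpoint G2) :=
  [set x | realization G2 x /\ enorm (locate x - pos v) <= eps].
Arguments in_ball {R d G1} G2 eps v.

Definition placements (R : realType) d (G1 G2 : embgraph R d) (eps : R)
    (v : 'I_(nv G1)) : set (set (gpoint G2)) :=
  [set connected_component (in_ball G2 eps v : set 'rV[R]_(nv G2)) x
     | x in in_ball G2 eps v].
Arguments placements {R d G1} G2 eps v.

Definition reachable (R : realType) d (G1 G2 : embgraph R d) (eps : R)
    (u v : 'I_(nv G1)) (Cu Cv : set (gpoint G2)) : Prop :=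
  exists P : R -> gpoint G2,
    [/\ is_path P, Cu (P 0), Cv (P 1) &
        (frechet (segment (pos u) (pos v)) (fun t => locate (P t)) <= eps%:E)%E].

(* [A v] is the set of placements of [v] that have not been deleted. *)
Definition valid (R : realType) d (G1 G2 : embgraph R d) (eps : R)
    (A : 'I_(nv G1) -> set (set (gpoint G2)))
    (v : 'I_(nv G1)) (C : set (gpoint G2)) : Prop :=
  forall u, adj G1 u v -> exists2 Cu, A u Cu & reachable eps u v Cu C.

Definition deletion (R : realType) d (G1 G2 : embgraph R d) (eps : R)
    (A A' : 'I_(nv G1) -> set (set (gpoint G2))) : Prop :=
  exists v C, [/\ A v C, ~ valid eps A v C &
    A' = fun w => [set D | A w D /\ ~ (w = v /\ D = C)]].

(** * Real RAM *)

(* A program is structured code over a fixed finite set of arrays, each named by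
   a literal; there are arrays of integers and arrays of reals.  Indices are
   integers.  There is no conversion from reals to integers (no floor). *)
Inductive iexpr :=
  | INat of nat
  | IGet of nat & iexpr
  | IAdd of iexpr & iexpr
  | ISub of iexpr & iexpr
  | IMul of iexpr & iexpr.

Inductive rexpr :=
  | RNat of nat
  | RGet of nat & iexpr
  | RAdd of rexpr & rexpr
  | RSub of rexpr & rexpr
  | RMul of rexpr & rexpr
  | RDiv of rexpr & rexpr
  | RSqrt of rexpr.

Inductive bexpr :=
  | BILe of iexpr & iexpr
  | BRLe of rexpr & rexpr
  | BNot of bexpr
  | BAnd of bexpr & bexpr.

Inductive cmd :=
  | Skip
  | IStore of nat & iexpr & iexpr
  | RStore of nat & iexpr & rexpr
  | Seq of cmd & cmd
  | If of bexpr & cmd & cmd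
  | While of bexpr & cmd.

Record state (R : realType) := State {
  imem : nat -> nat -> nat;
  rmem : nat -> nat -> R }.

Definition iset (R : realType) (s : state R) (a k n : nat) : state R :=
  State (fun b j => if (b == a) && (j == k) then n else imem s b j) (rmem s).

Definition rset (R : realType) (s : state R) (a k : nat) (x : R) : state R :=
  State (imem s) (fun b j => if (b == a) && (j == k) then x else rmem s b j).

Definition lift2 (A B C : Type) (f : A -> B -> C) (x : option A) (y : option B) :
    option C :=
  obind (fun a => omap (f a) y) x.

(* The machine has space bound W: every integer it handles, and in particular
   every array index, must be smaller than W, otherwise it faults.  So each
   array has at most W cells, and integers have O(log W) bits. *)
Definition word (W n : nat) : option nat := if (n < W)%N then Some n else None.

Fixpoint ieval (R : realType) (W : nat) (s : state R) (e : iexpr) : option nat :=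
  match e with
  | INat n => word W n
  | IGet a i => obind (fun k => word W (imem s a k)) (ieval W s i)
  | IAdd x y => obind (word W) (lift2 addn (ieval W s x) (ieval W s y))
  | ISub x y => obind (word W) (lift2 subn (ieval W s x) (ieval W s y))
  | IMul x y => obind (word W) (lift2 muln (ieval W s x) (ieval W s y))
  end.

Fixpoint reval (R : realType) (W : nat) (s : state R) (e : rexpr) : option R :=
  match e with
  | RNat n => Some n%:R
  | RGet a i => omap (rmem s a) (ieval W s i)
  | RAdd x y => lift2 +%R (reval W s x) (reval W s y)
  | RSub x y => lift2 (fun a b => a - b) (reval W s x) (reval W s y)
  | RMul x y => lift2 *%R (reval W s x) (reval W s y)
  | RDiv x y => lift2 (fun a b => a / b) (reval W s x) (reval W s y)
  | RSqrt x => omap Num.sqrt (reval W s x)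
  end.

Fixpoint beval (R : realType) (W : nat) (s : state R) (b : bexpr) : option bool :=
  match b with
  | BILe x y => lift2 leq (ieval W s x) (ieval W s y)
  | BRLe x y => lift2 (fun a b : R => a <= b) (reval W s x) (reval W s y)
  | BNot b => omap negb (beval W s b)
  | BAnd b c => lift2 andb (beval W s b) (beval W s c)
  end.

Fixpoint icost (e : iexpr) : nat :=
  match e with
  | INat _ => 1
  | IGet _ i => (icost i).+1
  | IAdd x y | ISub x y | IMul x y => (icost x + icost y).+1%N
  end.

Fixpoint rcost (e : rexpr) : nat :=
  match e with
  | RNat _ => 1
  | RGet _ i => (icost i).+1
  | RAdd x y | RSub x y | RMul x y | RDiv x y => (rcost x + rcost y).+1%N
  | RSqrt x => (rcost x).+1
  end.

Fixpoint bcost (b : bexpr) : nat :=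
  match b with
  | BILe x y => (icost x + icost y).+1%N
  | BRLe x y => (rcost x + rcost y).+1%N
  | BNot b => (bcost b).+1
  | BAnd b c => (bcost b + bcost c).+1%N
  end.

(* [exec W c s tr t s']: started in [s] with space bound [W], [c] halts in [s']
   without fault after [t] unit-cost operations; [tr] lists the states reached
   after the successive stores. *)
Inductive exec (R : realType) (W : nat) :
    cmd -> state R -> seq (state R) -> nat -> state R -> Prop :=
  | ExecSkip s : exec W Skip s [::] 1 s
  | ExecIStore a i e s k n :
      ieval W s i = Some k -> ieval W s e = Some n ->
      exec W (IStore a i e) s [:: iset s a k n] (icost i + icost e).+1%N
        (iset s a k n)
  | ExecRStore a i e s k x :
      ieval W s i = Some k -> reval W s e = Some x ->
      exec W (RStore a i e) s [:: rset s a k x] (icost i + rcost e).+1%N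
        (rset s a k x)
  | ExecSeq c1 c2 s tr1 t1 s1 tr2 t2 s2 :
      exec W c1 s tr1 t1 s1 -> exec W c2 s1 tr2 t2 s2 ->
      exec W (Seq c1 c2) s (tr1 ++ tr2) (t1 + t2)%N s2
  | ExecIf b c1 c2 s r tr t s' :
      beval W s b = Some r -> exec W (if r then c1 else c2) s tr t s' ->
      exec W (If b c1 c2) s tr (bcost b + t)%N s'
  | ExecWhileStop b c s :
      beval W s b = Some false -> exec W (While b c) s [::] (bcost b) s
  | ExecWhileLoop b c s tr1 t1 s1 tr2 t2 s2 :
      beval W s b = Some true ->
      exec W c s tr1 t1 s1 -> exec W (While b c) s1 tr2 t2 s2 ->
      exec W (While b c) s (tr1 ++ tr2) (bcost b + t1 + t2)%N s2.

(** * Implementations of the algorithm *)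

Definition edge_list (R : realType) d (G : embgraph R d) : seq nat :=
  flatten [seq [:: val (ends e).1; val (ends e).2] | e <- enum 'I_(ne G)].

Definition coordinates (R : realType) d (G : embgraph R d) : seq R :=
  flatten [seq [seq pos v 0 k | k <- enum 'I_d] | v <- enum 'I_(nv G)].

(* All other memory cells are initially zero. *)
Definition input_state (R : realType) d (G1 G2 : embgraph R d) (eps : R) :
    state R :=
  State (fun a k =>
           match a with
           | 0 => nth 0%N [:: nv G1; ne G1; nv G2; ne G2] k
           | 1 => nth 0%N (edge_list G1) k
           | 2 => nth 0%N (edge_list G2) k
           | _ => 0%N
           end)
        (fun a k =>
           match a with
           | 0 => nth 0 [:: eps] k
           | 1 => nth 0 (coordinates G1) k
           | 2 => nth 0 (coordinates G2) k
           | _ => 0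
           end).

(* Integer arrays that hold the results of the four steps. *)
Definition count_array : nat := 3.
Definition label_array : nat := 4.
Definition reach_array : nat := 5.
Definition alive_array : nat := 6.
Definition answer_array : nat := 7.

(* [C v k], for [k < cnt v], numbers the placements of [v].  As the part of an
   edge of G2 in a ball is connected, an edge meets at most one placement of
   [v]; cell (v, j) of the label array holds k + 1 if edge j meets placement k
   of [v], and 0 if it meets none. *)
Definition stores_placements (R : realType) d (G1 G2 : embgraph R d) (eps : R)
    (cnt : 'I_(nv G1) -> nat) (C : 'I_(nv G1) -> nat -> set (gpoint G2))
    (s : state R) : Prop :=
  forall v : 'I_(nv G1),
  [/\ set_bij `I_(cnt v) (placements G2 eps v) (C v),
      imem s count_array v = cnt v,
      (forall (j : 'I_(ne G2)) k, (k < cnt v)%N ->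
         imem s label_array (v * ne G2 + j)%N = k.+1 <->
         C v k `&` edge_set G2 j !=set0) &
      (forall j : 'I_(ne G2),
         imem s label_array (v * ne G2 + j)%N = 0%N <->
         (forall k, (k < cnt v)%N -> C v k `&` edge_set G2 j = set0))].

Definition stores_reachability (R : realType) d (G1 G2 : embgraph R d) (eps : R)
    (cnt : 'I_(nv G1) -> nat) (C : 'I_(nv G1) -> nat -> set (gpoint G2))
    (s : state R) : Prop :=
  forall (e : 'I_(ne G1)) k l,
    (k < cnt (ends e).1)%N -> (l < cnt (ends e).2)%N ->
    imem s reach_array ((e * ne G2 + k) * ne G2 + l)%N =
    `[< reachable eps (ends e).1 (ends e).2 (C (ends e).1 k) (C (ends e).2 l) >]
      :> nat.

Definition remaining (R : realType) d (G1 G2 : embgraph R d)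
    (cnt : 'I_(nv G1) -> nat) (C : 'I_(nv G1) -> nat -> set (gpoint G2))
    (s : state R) (v : 'I_(nv G1)) : set (set (gpoint G2)) :=
  [set C v k | k in
     [set k | (k < cnt v)%N /\ imem s alive_array (v * ne G2 + k)%N = 1%N]].

Fixpoint chain (T : Type) (r : T -> T -> Prop) (x : T) (tr : seq T) : Prop :=
  match tr with
  | [::] => True
  | y :: tr' => r x y /\ chain r y tr'
  end.

Record gda_program := GdaProgram {
  place_step : cmd;
  reach_step : cmd;
  prune_step : cmd;
  answer_step : cmd }.

(* [gda_run W p G1 G2 eps t s]: within space bound [W] and in [t] operations,
   the program [p] carries out the four steps of the algorithm on the input
   (G1, G2, eps), and halts in state [s].  In the third step the placements are
   deleted one by one, each being invalid at the time of its deletion. *)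
Variant gda_run (R : realType) d (W : nat) (p : gda_program)
    (G1 G2 : embgraph R d) (eps : R) : nat -> state R -> Prop :=
  GdaRun cnt C tr1 t1 s1 tr2 t2 s2 tr3 t3 s3 tr4 t4 s4 of
    exec W (place_step p) (input_state G1 G2 eps) tr1 t1 s1
  & @stores_placements R d G1 G2 eps cnt C s1
  & exec W (reach_step p) s1 tr2 t2 s2
  & stores_placements eps cnt C s2
  & stores_reachability eps cnt C s2
  & (forall v, remaining cnt C s2 v = placements G2 eps v)
  & exec W (prune_step p) s2 tr3 t3 s3
  & chain (fun s s' => remaining cnt C s' = remaining cnt C s \/
             deletion eps (remaining cnt C s) (remaining cnt C s')) s2 tr3
  & (forall v D, remaining cnt C s3 v D -> valid eps (remaining cnt C s3) v D)
  & exec W (answer_step p) s3 tr4 t4 s4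
  & imem s4 answer_array 0 = `[< forall v, remaining cnt C s3 v !=set0 >] :> nat
  : gda_run W p G1 G2 eps (t1 + t2 + t3 + t4)%N s4.

Definition answers_yes (R : realType) (s : state R) : Prop :=
  imem s answer_array 0 = 1%N.

(* Main.v *)
Require Import Defs.
From mathcomp Require Import all_boot all_order all_algebra.
From mathcomp Require Import all_classical all_reals all_analysis.
From mathcomp Require Import zify ring lra.
Set Implicit Arguments.
Unset Strict Implicit.
Unset Printing Implicit Defensive.
Import Order.TTheory GRing.Theory Num.Theory.
Import numFieldNormedType.Exports.
Local Open Scope classical_set_scope.
Local Open Scope ring_scope.

(* Everything the algorithm needs is finite data.  Given an edge {u, v} of G1 and edges j, l of G2,
   a path from a point of j in the ball of u to a point of l in the ball of v at Fréchet distance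
   at most eps exists iff there is a certificate: a walk from j to l in G2 whose crossed vertices
   w_1, .., w_k are within eps of the points of {u, v} at times t_1 <= .. <= t_k.  From a certificate
   one gets a path by convexity of the norm, and a simple one when the certificate is shortest;
   conversely a path yields certificates for every eps' > eps, hence one for eps because only
   finitely many shortest walks matter.  Placements of a vertex are the classes of edges meeting its
   ball under sharing a vertex in the ball.  All certificates leaving one class are found by one
   search of G2 that processes the time windows of the vertices in the order of their left ends, so
   that each vertex is entered at its earliest possible time; this takes O(m2) steps per class.

   In a tree the parent edges of a breadth-first search are all the edges.  Hence deleting, bottom-up,
   the parent placements without support at the child and then, top-down, the child placements without
   support at the parent leaves only valid placements, and if some are left everywhere they can be
   chosen compatibly from the root downwards. *)

(** * Cost-bounded Hoare logic for the real RAM *)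

(** The two infima, over matchings and over graph mappings, are not assumed to be attained. Every
    passage from distances to finite data is therefore made for all larger radii: finitely many
    combinatorial types leave one type that serves all of them, and compactness of time gives the
    limit. Points between two crossings need no condition, because the squared distance is convex
    and closeness at both ends of a piece suffices; for the same reason each vertex of G2 has an
    interval of admissible times.

    The budget of O(m2^2) steps per vertex of G1 is generous except for the searches. Relabelling
    for components and sorting by counting are quadratic, but each is done once per vertex or edge
    of G1; only the searches, one for each placement at the first end of an edge, have to be linear.

    The requirement on deletions concerns every state of the third step, not only the last one. The
    Hoare triples therefore carry a relation between consecutive states. It is checked by hand at
    the one store that deletes, and follows from the syntactic write sets elsewhere. *)

Section Machine.
Context {R : realType}.
Implicit Types (s : state R) (W : nat).

(** Evaluation is split into total values and, in [isafe], [rsafe] and [bsafe], the absence of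
    faults, so that values can be rewritten without option types. *)
Fixpoint iev s e : nat :=
  match e with
  | INat n => n
  | IGet a i => imem s a (iev s i)
  | IAdd x y => iev s x + iev s y
  | ISub x y => iev s x - iev s y
  | IMul x y => iev s x * iev s y
  end.

Fixpoint isafe W s e : Prop :=
  match e with
  | INat n => (n < W)%N
  | IGet a i => isafe W s i /\ (imem s a (iev s i) < W)%N
  | IAdd x y => [/\ isafe W s x, isafe W s y & (iev s x + iev s y < W)%N]
  | ISub x y => isafe W s x /\ isafe W s y
  | IMul x y => [/\ isafe W s x, isafe W s y & (iev s x * iev s y < W)%N]
  end.

Fixpoint rev_ s e : R :=
  match e with
  | RNat n => n%:R
  | RGet a i => rmem s a (iev s i)
  | RAdd x y => rev_ s x + rev_ s y
  | RSub x y => rev_ s x - rev_ s y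
  | RMul x y => rev_ s x * rev_ s y
  | RDiv x y => rev_ s x / rev_ s y
  | RSqrt x => Num.sqrt (rev_ s x)
  end.

Fixpoint rsafe W s e : Prop :=
  match e with
  | RNat _ => True
  | RGet _ i => isafe W s i
  | RAdd x y | RSub x y | RMul x y | RDiv x y => rsafe W s x /\ rsafe W s y
  | RSqrt x => rsafe W s x
  end.

Fixpoint bev s b : bool :=
  match b with
  | BILe x y => (iev s x <= iev s y)%N
  | BRLe x y => rev_ s x <= rev_ s y
  | BNot b => ~~ bev s b
  | BAnd b c => bev s b && bev s c
  end.

Fixpoint bsafe W s b : Prop :=
  match b with
  | BILe x y => isafe W s x /\ isafe W s y
  | BRLe x y => rsafe W s x /\ rsafe W s y
  | BNot b => bsafe W s b
  | BAnd b c => bsafe W s b /\ bsafe W s c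
  end.

Lemma ieval_safe W s e : isafe W s e -> ieval W s e = Some (iev s e) /\ (iev s e < W)%N.
Proof.
elim: e => [n|a i IH|x IHx y IHy|x IHx y IHy|x IHx y IHy] /=.
- by rewrite /word => ->.
- by move=> [/IH [-> _] /= lt]; rewrite /word lt.
- by move=> [/IHx [-> _] /IHy [-> _] /= lt]; rewrite /word lt.
- move=> [/IHx [-> lx] /IHy [-> _] /=].
  have lt : (iev s x - iev s y < W)%N by rewrite (leq_ltn_trans _ lx) ?leq_subr.
  by rewrite /word lt.
- by move=> [/IHx [-> _] /IHy [-> _] /= lt]; rewrite /word lt.
Qed.

Lemma reval_safe W s e : rsafe W s e -> reval W s e = Some (rev_ s e).
Proof.
elim: e => [//|a i|x IHx y IHy|x IHx y IHy|x IHx y IHy|x IHx y IHy|x IHx] /=.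
- by move=> /ieval_safe[-> _].
- by move=> [/IHx -> /IHy ->].
- by move=> [/IHx -> /IHy ->].
- by move=> [/IHx -> /IHy ->].
- by move=> [/IHx -> /IHy ->].
- by move=> /IHx ->.
Qed.

Lemma beval_safe W s b : bsafe W s b -> beval W s b = Some (bev s b).
Proof.
elim: b => [x y|x y|b IH|b IHb c IHc] /=.
- by move=> [/ieval_safe[-> _] /ieval_safe[-> _]].
- by move=> [/reval_safe -> /reval_safe ->].
- by move=> /IH ->.
- by move=> [/IHb -> /IHc ->].
Qed.

Section Triple.
Context (W : nat) (G : state R -> state R -> Prop).

(* [T] bounds the cost and [G] relates the states before and after every single store. *)
Definition ht c s T (Q : state R -> Prop) : Prop :=
  exists tr t s', [/\ exec W c s tr t s', (t <= T)%N, Q s' & chain G s tr].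

Lemma exec_last c s tr t s' : exec W c s tr t s' -> last s tr = s'.
Proof.
elim=> //=.
- by move=> c1 c2 s1 tr1 t1 s2 tr2 t2 s3 _ l1 _ l2; rewrite last_cat l1.
- by move=> b c1 s1 tr1 t1 s2 tr2 t2 s3 _ _ l1 _ l2; rewrite last_cat l1.
Qed.

Lemma chain_cat (T : Type) (r : T -> T -> Prop) x (u1 u2 : seq T) :
  chain r x u1 -> chain r (last x u1) u2 -> chain r x (u1 ++ u2).
Proof. by elim: u1 x => [|y s1 IH] x //= [rxy /IH H] /H. Qed.

Lemma ht_weaken c s T T' (Q Q' : state R -> Prop) :
  ht c s T Q -> (T <= T')%N -> (forall s', Q s' -> Q' s') -> ht c s T' Q'.
Proof.
move=> [tr [t [s' [E lt q ch]]]] le QQ'; exists tr, t, s'; split=> //.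
  exact: leq_trans lt le.
exact: QQ'.
Qed.

Lemma ht_skip s (Q : state R -> Prop) : Q s -> ht Skip s 1 Q.
Proof. by move=> q; exists [::], 1%N, s; split => //; constructor. Qed.

Lemma ht_istore a i e s (Q : state R -> Prop) :
  isafe W s i -> isafe W s e ->
  (G s (iset s a (iev s i) (iev s e))) ->
  Q (iset s a (iev s i) (iev s e)) ->
  ht (IStore a i e) s (icost i + icost e).+1 Q.
Proof.
move=> /ieval_safe[ei _] /ieval_safe[ee _] g q.
by exists [:: iset s a (iev s i) (iev s e)], (icost i + icost e).+1%N,
  (iset s a (iev s i) (iev s e)); split=> //; exact: ExecIStore.
Qed.

Lemma ht_rstore a i e s (Q : state R -> Prop) :
  isafe W s i -> rsafe W s e ->
  (G s (rset s a (iev s i) (rev_ s e))) ->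
  Q (rset s a (iev s i) (rev_ s e)) ->
  ht (RStore a i e) s (icost i + rcost e).+1 Q.
Proof.
move=> /ieval_safe[ei _] /reval_safe ee g q.
by exists [:: rset s a (iev s i) (rev_ s e)], (icost i + rcost e).+1%N,
  (rset s a (iev s i) (rev_ s e)); split=> //; exact: ExecRStore.
Qed.

Lemma ht_seq c1 c2 s T1 T2 (Q : state R -> Prop) :
  ht c1 s T1 (fun s1 => ht c2 s1 T2 Q) -> ht (Seq c1 c2) s (T1 + T2) Q.
Proof.
move=> [tr1 [t1 [s1 [E1 l1 [tr2 [t2 [s2 [E2 l2 q ch2]]]] ch1]]]].
exists (tr1 ++ tr2), (t1 + t2)%N, s2; split=> //; [exact: ExecSeq E2| lia |].
by apply: chain_cat => //; rewrite (exec_last E1).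
Qed.

Lemma ht_if b c1 c2 s T (Q : state R -> Prop) :
  bsafe W s b ->
  (if bev s b then ht c1 s T Q else ht c2 s T Q) ->
  ht (If b c1 c2) s (bcost b + T) Q.
Proof.
move=> /beval_safe eb H.
have [tr [t [s' [E l q ch]]]] : ht (if bev s b then c1 else c2) s T Q by case: ifP H.
exists tr, (bcost b + t)%N, s'; split=> //; [exact: ExecIf E|lia].
Qed.

(** [m] is a variant: it decreases strictly with every pass and so bounds their number. The
    additional [bcost b] pays for the failing test at the end. *)
Lemma ht_while (I : nat -> state R -> Prop) b c s m T (Q : state R -> Prop) :
  (forall m s, I m s -> bsafe W s b) ->
  (forall m s, I m s -> bev s b = false -> Q s) ->
  (forall m s, I m s -> bev s b = true ->
     ht c s T (fun s' => exists2 m', (m' < m)%N & I m' s')) ->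
  I m s -> ht (While b c) s (m * (bcost b + T) + bcost b) Q.
Proof.
move=> safe stop step.
elim/ltn_ind: m s => m IH s Im.
case eb: (bev s b); last first.
  exists [::], (bcost b), s; split=> //; last exact: stop Im eb.
    by apply: ExecWhileStop; rewrite (beval_safe (safe _ _ Im)) eb.
  by rewrite leq_addl.
have [tr1 [t1 [s1 [E1 l1 [m' lm Im'] ch1]]]] := step _ _ Im eb.
have [tr2 [t2 [s2 [E2 l2 q ch2]]]] := IH m' lm s1 Im'.
exists (tr1 ++ tr2), (bcost b + t1 + t2)%N, s2; split=> //.
- by apply: ExecWhileLoop E2 => //; rewrite (beval_safe (safe _ _ Im)) eb.
- have : (m' * (bcost b + T) + (bcost b + T) <= m * (bcost b + T))%N.
    by rewrite addnC -mulSn leq_mul2r lm orbT.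
  lia.
- by apply: chain_cat => //; rewrite (exec_last E1).
Qed.

End Triple.

Fixpoint imods c : seq nat :=
  match c with
  | Skip | RStore _ _ _ => [::]
  | IStore a _ _ => [:: a]
  | Seq c1 c2 | If _ c1 c2 => imods c1 ++ imods c2
  | While _ c => imods c
  end.

Fixpoint rmods c : seq nat :=
  match c with
  | Skip | IStore _ _ _ => [::]
  | RStore a _ _ => [:: a]
  | Seq c1 c2 | If _ c1 c2 => rmods c1 ++ rmods c2
  | While _ c => rmods c
  end.

Definition same (im rm : seq nat) s s' : Prop :=
  (forall a, a \notin im -> imem s' a =1 imem s a) /\
  (forall a, a \notin rm -> rmem s' a =1 rmem s a).

Lemma same_trans im rm s1 s2 s3 : same im rm s1 s2 -> same im rm s2 s3 -> same im rm s1 s3.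
Proof.
move=> [i1 r1] [i2 r2]; split=> a na j.
  by rewrite i2 // i1.
by rewrite r2 // r1.
Qed.

Lemma same_sub im rm im' rm' s s' : {subset im <= im'} -> {subset rm <= rm'} ->
  same im rm s s' -> same im' rm' s s'.
Proof.
move=> si sr [i r]; split=> a na.
  by apply: i; apply: contra na => /si.
by apply: r; apply: contra na => /sr.
Qed.

Lemma same_iset a k n s : same [:: a] [::] s (iset s a k n).
Proof. by split=> // b; rewrite inE => /negbTE ba j /=; rewrite ba. Qed.

Lemma same_rset a k x s : same [::] [:: a] s (rset s a k x).
Proof. by split=> // b; rewrite inE => /negbTE ba j /=; rewrite ba. Qed.

Lemma chain_sub (r r' : state R -> state R -> Prop) x u :
  (forall y z, r y z -> r' y z) -> chain r x u -> chain r' x u.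
Proof. by move=> rr'; elim: u x => //= y u IH x [/rr' h /IH]. Qed.

(** The write sets are used twice: for the whole run, as a frame rule, and between consecutive
    stores, where [ht_guarantee] turns them into the relation [G]. *)
Lemma exec_frame W c s tr t s' : exec W c s tr t s' ->
  same (imods c) (rmods c) s s' /\ chain (same (imods c) (rmods c)) s tr.
Proof.
have subl (p q : seq nat) : {subset p <= p ++ q} by move=> x xp; rewrite mem_cat xp.
have subr (p q : seq nat) : {subset q <= p ++ q} by move=> x xp; rewrite mem_cat xp orbT.
elim=> //=.
- by move=> a i e s1 k n _ _; split; [|split=> //]; exact: same_iset.
- by move=> a i e s1 k n _ _; split; [|split=> //]; exact: same_rset.
- move=> c1 c2 s1 tr1 t1 s2 tr2 t2 s3 E1 [f1 h1] E2 [f2 h2].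
  have w1 y z : same (imods c1) (rmods c1) y z ->
      same (imods c1 ++ imods c2) (rmods c1 ++ rmods c2) y z by exact: same_sub.
  have w2 y z : same (imods c2) (rmods c2) y z ->
      same (imods c1 ++ imods c2) (rmods c1 ++ rmods c2) y z by exact: same_sub.
  split; first by apply: same_trans (w2 _ _ f2); exact: w1.
  by apply: chain_cat; [exact: chain_sub h1 | rewrite (exec_last E1); exact: chain_sub h2].
- move=> b c1 c2 s1 r tr1 t1 s2 _ _ [f h].
  have w y z : same (imods (if r then c1 else c2)) (rmods (if r then c1 else c2)) y z ->
      same (imods c1 ++ imods c2) (rmods c1 ++ rmods c2) y z by case: (r); exact: same_sub.
  by split; [exact: w | exact: chain_sub h].
- move=> b c0 s1 tr1 t1 s2 tr2 t2 s3 _ E1 [f1 h1] E2 [f2 h2]; split.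
    exact: same_trans f1 f2.
  by apply: chain_cat => //; rewrite (exec_last E1).
Qed.

Lemma ht_frame W G c s T (Q : state R -> Prop) : ht W G c s T Q ->
  ht W G c s T (fun s' => Q s' /\ same (imods c) (rmods c) s s').
Proof.
move=> [tr [t [s' [E l q ch]]]]; exists tr, t, s'; split=> //; split=> //.
by have [] := exec_frame E.
Qed.

(** Code that does not write the arrays on which [G] depends respects [G] at every store, and can be
    verified with the trivial relation. *)
Lemma ht_guarantee W (G : state R -> state R -> Prop) c s T (Q : state R -> Prop) :
  (forall s s', same (imods c) (rmods c) s s' -> G s s') ->
  ht W (fun _ _ => True) c s T Q -> ht W G c s T Q.
Proof.
move=> GG [tr [t [s' [E l q _]]]]; exists tr, t, s'; split=> //.
have [_] := exec_frame E.
by elim: tr s {E} => //= y tr IH x [/GG gx /IH].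
Qed.

Fixpoint iarrs e : seq nat :=
  match e with
  | INat _ => [::]
  | IGet a i => a :: iarrs i
  | IAdd x y | ISub x y | IMul x y => iarrs x ++ iarrs y
  end.

Lemma iev_frame W s s' e : {in iarrs e, forall a, imem s' a =1 imem s a} ->
  iev s' e = iev s e /\ (isafe W s e -> isafe W s' e).
Proof.
have catl (p q : seq nat) (P : nat -> Prop) : {in p ++ q, forall a, P a} -> {in p, forall a, P a}.
  by move=> H a ap; apply: H; rewrite mem_cat ap.
have catr (p q : seq nat) (P : nat -> Prop) : {in p ++ q, forall a, P a} -> {in q, forall a, P a}.
  by move=> H a ap; apply: H; rewrite mem_cat ap orbT.
elim: e => [n|a i IH|x IHx y IHy|x IHx y IHy|x IHx y IHy] //= H.
- have [->] : iev s' i = iev s i /\ (isafe W s i -> isafe W s' i).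
    by apply: IH => b bi; apply: H; rewrite inE bi orbT.
  have Ha := H a (mem_head _ _).
  by move=> sf; rewrite Ha; split=> // -[/sf ? ?].
- have [-> sx] := IHx (catl _ _ _ H); have [-> sy] := IHy (catr _ _ _ H).
  by split=> // -[/sx ? /sy ? ?]; split.
- have [-> sx] := IHx (catl _ _ _ H); have [-> sy] := IHy (catr _ _ _ H).
  by split=> // -[/sx ? /sy ?]; split.
- have [-> sx] := IHx (catl _ _ _ H); have [-> sy] := IHy (catr _ _ _ H).
  by split=> // -[/sx ? /sy ? ?]; split.
Qed.

Definition ivar x := IGet x (INat 0).
Definition iassign x e := IStore x (INat 0) e.
Definition for_ x n c :=
  Seq (iassign x (INat 0))
      (While (BNot (BILe n (ivar x))) (Seq c (iassign x (IAdd (ivar x) (INat 1))))).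
Definition forcost n := (2 * icost n + 17)%N.

(** The limit [n] is evaluated again before every pass; the syntactic side condition keeps its value
    [N] constant. [M] is positive even if [N] is 0, to pay for the first store and the last test. *)
Lemma ht_for W G (I : nat -> state R -> Prop) x n c s0 N M T (Q : state R -> Prop) :
  (x \notin imods c) && all (fun a => a \notin x :: imods c) (iarrs n) ->
  isafe W s0 n -> iev s0 n = N -> (0 < W)%N -> (N <= M)%N -> (0 < M)%N ->
  (forall s k, G s (iset s x 0 k)) ->
  (forall k s m, I k s -> I k (iset s x 0 m)) ->
  I 0%N s0 ->
  (forall k s, (k < N)%N -> I k s -> imem s x 0 = k ->
     same (imods (for_ x n c)) (rmods (for_ x n c)) s0 s ->
     ht W G c s T (I k.+1)) ->
  (forall s, I N s -> same (imods (for_ x n c)) (rmods (for_ x n c)) s0 s -> Q s) ->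
  ht W G (for_ x n c) s0 (M * (T + forcost n)) Q.
Proof.
move=> /andP[xc /allP nx] sn en W0 NM M0 Gx Ix I0 step fin.
have NW : (N < W)%N by rewrite -en; have [] := ieval_safe sn.
set mi := imods (for_ x n c) in step fin *.
set mr := rmods (for_ x n c) in step fin *.
have micE a : (a \in mi) = (a == x) || (a \in imods c).
  by rewrite /mi /= inE mem_cat inE; case: eqP => //=; rewrite orbF.
have mrE : mr = rmods c by rewrite /mr /= cats0.
have same0 s m : same mi mr s0 s -> same mi mr s0 (iset s x 0 m).
  move=> [h1 h2]; split=> a na j; last exact: h2.
  rewrite /= -h1 //; move: na; rewrite micE negb_or => /andP[/negbTE -> _] //.
have nval s : same mi mr s0 s -> iev s n = N /\ isafe W s n.
  move=> [h1 _]; have [-> sf] : iev s n = iev s0 n /\ (isafe W s0 n -> isafe W s n).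
    apply: iev_frame => a an; apply: h1; rewrite micE.
    by have := nx a an; rewrite inE.
  by rewrite en; split=> //; exact: sf.
apply: (@ht_weaken W G _ _ (3 + (N * (bcost (BNot (BILe n (ivar x))) + (T + 6))
   + bcost (BNot (BILe n (ivar x)))))%N _ Q); last by [].
  apply: ht_seq; apply: ht_istore => //=.
  (* The variant counts the passes that are left, so the loop counter is [N - m]. *)
  pose J m s := [/\ (m <= N)%N, I (N - m)%N s, imem s x 0 = (N - m)%N & same mi mr s0 s].
  apply: (@ht_while W G J).
  - move=> m s [mN Im xm sm] /=; have [_ sfn] := nval s sm; split=> //.
    by split; [exact: W0| rewrite xm; lia].
  - move=> m s [mN Im xm sm] /=; have [en' _] := nval s sm.
    move=> /negbFE; rewrite en' xm => h.
    by apply: fin => //; have <- : (N - m = N)%N by lia.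
  - move=> m s [mN Im xm sm] /=; have [en' _] := nval s sm.
    rewrite en' xm => h.
    apply: ht_seq.
    have H := step (N - m)%N s ltac:(lia) Im xm sm.
    apply: (ht_weaken (ht_frame H) (leqnn _)) => s1 [I1 f1].
    have x1 : imem s1 x 0 = (N - m)%N by have [->] := f1.
    have s1m : same mi mr s0 s1.
      apply: same_trans sm (same_sub _ _ f1) => a; first by rewrite micE => ->; rewrite orbT.
      by rewrite mrE.
    apply: ht_istore => //=.
      by split; [split=> //; rewrite x1; lia| lia| rewrite x1; lia].
    exists m.-1; first by lia.
    rewrite /J; split; [exact: leq_trans (leq_pred _) mN| | |exact: same0].
      have -> : (N - m.-1 = (N - m).+1)%N by lia.
      exact: Ix.
    by rewrite /= eqxx /= x1; lia.
  - rewrite /J subnn; split=> //; first exact: Ix.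
      by rewrite /= eqxx.
    by apply: same0; split.
rewrite /forcost /=.
have : (N * (T + 2 * icost n + 17) <= M * (T + 2 * icost n + 17))%N by rewrite leq_mul2r NM orbT.
have : (0 < M)%N -> (2 * icost n + 17 <= M * (2 * icost n + 17))%N by move=> ?; rewrite leq_pmull.
nia.
Qed.

(** An upper bound for loop-free code: both branches are added up, and [While] may get 0 because
    [wp] rejects it. *)
Fixpoint scost c : nat :=
  match c with
  | Skip => 1
  | IStore _ i e => (icost i + icost e).+1
  | RStore _ i e => (icost i + rcost e).+1
  | Seq c1 c2 => scost c1 + scost c2
  | If b c1 c2 => bcost b + (scost c1 + scost c2)
  | While _ _ => 0
  end%N.

Fixpoint wp W c (Q : state R -> Prop) s : Prop :=
  match c with
  | Skip => Q s
  | IStore a i e => [/\ isafe W s i, isafe W s e & Q (iset s a (iev s i) (iev s e))]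
  | RStore a i e => [/\ isafe W s i, rsafe W s e & Q (rset s a (iev s i) (rev_ s e))]
  | Seq c1 c2 => wp W c1 (wp W c2 Q) s
  | If b c1 c2 => bsafe W s b /\ (if bev s b then wp W c1 Q s else wp W c2 Q s)
  | While _ _ => False
  end.

Lemma wp_ht W c s (Q : state R -> Prop) : wp W c Q s -> ht W (fun _ _ => True) c s (scost c) Q.
Proof.
elim: c s Q => [|a i e|a i e|c1 IH1 c2 IH2|b c1 IH1 c2 IH2|] //= s Q.
- exact: ht_skip.
- by move=> [h1 h2 q]; apply: ht_istore.
- by move=> [h1 h2 q]; apply: ht_rstore.
- move=> /IH1 H; apply: ht_seq; apply: ht_weaken H (leqnn _) _ => s1; exact: IH2.
- move=> [sb H]; apply: ht_if => //; case: ifP H => _ H.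
    by apply: ht_weaken (IH1 _ _ H) _ _ => //; rewrite leq_addr.
  by apply: ht_weaken (IH2 _ _ H) _ _ => //; rewrite leq_addl.
Qed.

End Machine.

(** * Costs up to constants of the program text *)

Section CostRules.
Context {R : realType}.
Implicit Types (s : state R) (Q : state R -> Prop).

(** A loop counts as one run of its body, as the number of runs is tracked separately in [htk]. The
    other terms for [While] absorb the tests and the counter in [htk_while] and [htk_for]. *)
Fixpoint kcost c : nat :=
  match c with
  | Skip => 1
  | IStore _ i e => (icost i + icost e).+1
  | RStore _ i e => (icost i + rcost e).+1
  | Seq c1 c2 => kcost c1 + kcost c2
  | If b c1 c2 => bcost b + (kcost c1 + kcost c2)
  | While b c => 2 * bcost b + kcost c + 10
  end%N.

(* The cost is a constant of the program text times the bound [X] on the number of runs of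
   its innermost statements. *)
Definition htk W G c s X Q := ht W G c s (kcost c * X)%N Q.

Lemma htk_mono W G c s X X' Q : (X <= X')%N -> htk W G c s X Q -> htk W G c s X' Q.
Proof. by move=> XX H; apply: ht_weaken H _ _ => //; rewrite leq_mul2l XX orbT. Qed.

Lemma htk_post W G c s X Q Q' : htk W G c s X Q ->
  (forall s', Q s' -> same (imods c) (rmods c) s s' -> Q' s') -> htk W G c s X Q'.
Proof. by move=> /ht_frame H QQ; apply: ht_weaken H _ _ => // s' [q sm]; exact: QQ. Qed.

Lemma htk_seq W G c1 c2 s X Q1 Q : htk W G c1 s X Q1 ->
  (forall s1, Q1 s1 -> same (imods c1) (rmods c1) s s1 -> htk W G c2 s1 X Q) ->
  htk W G (Seq c1 c2) s X Q.
Proof.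
move=> /ht_frame H1 H2; rewrite /htk /= mulnDl; apply: ht_seq.
by apply: ht_weaken H1 _ _ => // s1 [q sm]; exact: H2.
Qed.

Lemma scost_le c : (scost c <= kcost c)%N.
Proof. by elim: c => //= [c1 h1 c2 h2|b c1 h1 c2 h2]; lia. Qed.

Lemma ht_htk W G c s Q : ht W G c s (scost c) Q -> htk W G c s 1 Q.
Proof. by move=> H; apply: ht_weaken H _ _ => //; rewrite muln1; exact: scost_le. Qed.

Lemma htk_wp W c s X Q : (0 < X)%N -> wp W c Q s -> htk W (fun _ _ => True) c s X Q.
Proof.
move=> X0 /wp_ht H; apply: ht_weaken H _ _ => //.
by apply: leq_trans (scost_le c) _; rewrite leq_pmulr.
Qed.

Lemma htk_if W G b c1 c2 s X Q : (0 < X)%N -> bsafe W s b ->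
  (if bev s b then htk W G c1 s X Q else htk W G c2 s X Q) -> htk W G (If b c1 c2) s X Q.
Proof.
move=> X0 sb H; apply: (@ht_weaken _ _ _ _ _ (bcost b + (kcost c1 + kcost c2) * X)%N _ Q) => //.
  apply: ht_if => //; case: ifP H => _ H; apply: ht_weaken H _ _ => //; rewrite mulnDl; lia.
have : (bcost b <= bcost b * X)%N by rewrite leq_pmulr.
by rewrite /= !mulnDl; lia.
Qed.

Lemma htk_for W G (I : nat -> state R -> Prop) x n c s0 N M X Y Q :
  (x \notin imods c) && all (fun a => a \notin x :: imods c) (iarrs n) ->
  isafe W s0 n -> iev s0 n = N -> (0 < W)%N -> (N <= M)%N -> (0 < M)%N -> (0 < X)%N -> (M * X <= Y)%N ->
  (forall s k, G s (iset s x 0 k)) ->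
  (forall k s m, I k s -> I k (iset s x 0 m)) ->
  I 0%N s0 ->
  (forall k s, (k < N)%N -> I k s -> imem s x 0 = k ->
     same (imods (for_ x n c)) (rmods (for_ x n c)) s0 s -> htk W G c s X (I k.+1)) ->
  (forall s, I N s -> same (imods (for_ x n c)) (rmods (for_ x n c)) s0 s -> Q s) ->
  htk W G (for_ x n c) s0 Y Q.
Proof.
move=> fr sn en W0 NM M0 X0 MXY Gx Ix I0 step fin; apply: htk_mono MXY _.
have H := @ht_for R W G I x n c s0 N M (kcost c * X)%N Q fr sn en W0 NM M0 Gx Ix I0 step fin.
apply: ht_weaken H _ _ => //; rewrite /forcost /=.
rewrite mulnCA leq_mul2l; apply/orP; right.
have : (2 * icost n + 17 <= (2 * icost n + 17) * X)%N by rewrite leq_pmulr.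
nia.
Qed.

(** The strict inequality [m < X'] leaves one unit for the last test. *)
Lemma htk_while W G (I : nat -> state R -> Prop) b c s m X X' Q :
  (0 < X)%N -> (m < X')%N ->
  (forall m s, I m s -> bsafe W s b) ->
  (forall m s, I m s -> bev s b = false -> Q s) ->
  (forall m s, I m s -> bev s b = true -> htk W G c s X (fun s' => exists2 m', (m' < m)%N & I m' s')) ->
  I m s -> htk W G (While b c) s (X' * X) Q.
Proof.
move=> X0 mX safe stop step Im.
have H := ht_while safe stop step Im.
apply: ht_weaken H _ _ => //=.
have : (bcost b <= bcost b * X)%N by rewrite leq_pmulr.
have : (m.+1 * ((bcost b + kcost c) * X) <= X' * ((bcost b + kcost c) * X))%N by rewrite leq_mul2r mX orbT.
rewrite mulSn !mulnDl !mulnDr; nia.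
Qed.

Lemma htk_guarantee W (G : state R -> state R -> Prop) c s X Q :
  (forall s s', same (imods c) (rmods c) s s' -> G s s') ->
  htk W (fun _ _ => True) c s X Q -> htk W G c s X Q.
Proof. exact: ht_guarantee. Qed.

Lemma htk_assign W (G : state R -> state R -> Prop) x e n c s X Q :
  (0 < X)%N -> (0 < W)%N -> isafe W s e -> iev s e = n -> G s (iset s x 0 n) ->
  htk W G c (iset s x 0 n) X Q -> htk W G (Seq (iassign x e) c) s X Q.
Proof.
move=> X0 W0 se <- g H; apply: (htk_seq (Q1 := fun s' => s' = iset s x 0 (iev s e))).
  by apply: (htk_mono X0); apply: ht_htk; apply: ht_istore.
by move=> _ -> _.
Qed.

End CostRules.

(** * Fréchet distance to a segment *)

Section Norm.
Context {R : realType} {d : nat}.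
Implicit Types (x y p q : 'rV[R]_d) (e t : R).

(** Squared norms keep all conditions polynomial and make convexity a coordinatewise identity. *)
Definition nsq x : R := \sum_i x 0 i ^+ 2.

Lemma nsq_ge0 x : 0 <= nsq x.
Proof. by apply: sumr_ge0 => i _; exact: sqr_ge0. Qed.

Lemma enorm_le x e : 0 <= e -> (enorm x <= e) = (nsq x <= e ^+ 2).
Proof.
move=> e0; rewrite /enorm -/(nsq x).
rewrite -(ler_sqr (x := Num.sqrt _)) ?nnegrE ?sqrtr_ge0 // sqr_sqrtr //; exact: nsq_ge0.
Qed.

Lemma nsq_conv x y t : 0 <= t <= 1 ->
  nsq ((1 - t) *: x + t *: y) <= (1 - t) * nsq x + t * nsq y.
Proof.
move=> /andP[t0 t1]; rewrite /nsq !mulr_sumr -big_split; apply: ler_sum => i _ /=.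
rewrite !mxE; set a := x 0 i; set b := y 0 i.
have : 0 <= t * (1 - t) * (a - b) ^+ 2.
  by rewrite mulr_ge0 ?sqr_ge0 // mulr_ge0 // subr_ge0.
by rewrite -subr_ge0; set u := (X in _ -> 0 <= X); have -> : u = t * (1 - t) * (a - b) ^+ 2
  by rewrite /u; ring.
Qed.

Lemma nsqD_le x y : nsq (x + y) <= 2 * nsq x + 2 * nsq y.
Proof.
rewrite /nsq !mulr_sumr -big_split; apply: ler_sum => i _ /=.
rewrite !mxE; set a := x 0 i; set b := y 0 i.
rewrite -subr_ge0.
have -> : 2 * a ^+ 2 + 2 * b ^+ 2 - (a + b) ^+ 2 = (a - b) ^+ 2 by ring.
exact: sqr_ge0.
Qed.

Lemma nsqZ e x : nsq (e *: x) = e ^+ 2 * nsq x.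
Proof. by rewrite /nsq mulr_sumr; apply: eq_bigr => i _; rewrite mxE exprMn. Qed.

Lemma nsqN x : nsq (- x) = nsq x.
Proof. by rewrite -scaleN1r nsqZ sqrrN expr1n mul1r. Qed.

Lemma nsq_conv_le x y t e : 0 <= t <= 1 -> nsq x <= e -> nsq y <= e ->
  nsq ((1 - t) *: x + t *: y) <= e.
Proof.
move=> t01 xe ye; apply: le_trans (nsq_conv _ _ t01) _.
have /andP[t0 t1] := t01.
have -> : e = (1 - t) * e + t * e by ring.
by apply: lerD; apply: ler_wpM2l; rewrite ?subr_ge0.
Qed.

(** A matching that attains the infimum need not exist, hence the quantification over larger bounds
    [e']. *)
Lemma frechetP (f g : R -> 'rV[R]_d) e : 0 <= e ->
  (frechet f g <= e%:E)%E <->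
  forall e', e < e' -> exists2 s, orientation_homeo s &
    forall t, 0 <= t <= 1 -> nsq (f t - g (s t)) <= e' ^+ 2.
Proof.
move=> e0; split=> [fe e' ee'|H].
- have e'0 : 0 <= e' by rewrite (le_trans e0) // ltW.
  have : (frechet f g < e'%:E)%E by rewrite (le_lt_trans fe) // lte_fin.
  move=> /ereal_inf_lt[_ [s sh <-] lt]; exists s => // t t01.
  rewrite -enorm_le // -lee_fin; apply: le_trans (ltW lt).
  by apply: ereal_sup_ubound; exists t => //=; rewrite in_itv.
- apply/lee_addgt0Pr => r r0; rewrite -EFinD.
  have [s sh Hs] := H (e + r) ltac:(lra).
  apply: (@le_trans _ _ (ereal_sup [set (enorm (f t - g (s t)))%:E | t in `[0, 1]])).
    by apply: ereal_inf_lbound; exists s.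
  apply: ge_ereal_sup => _ [t t01 <-]; rewrite lee_fin enorm_le; last lra.
  by apply: Hs; move: t01; rewrite /= in_itv.
Qed.

(* Perturbing the matching [phi] to the strictly increasing (1 - l) phi + l id costs
   little, by convexity of the squared norm. *)
Lemma frechet_matching p q (g : R -> 'rV[R]_d) (phi : R -> R) e : 0 < e ->
  continuous phi -> phi 0 = 0 -> phi 1 = 1 ->
  (forall s t, 0 <= s -> s <= t -> t <= 1 -> phi s <= phi t) ->
  (forall s, 0 <= s <= 1 -> nsq (segment p q (phi s) - g s) <= e ^+ 2) ->
  (frechet (segment p q) g <= e%:E)%E.
Proof.
move=> e0 cphi phi0 phi1 phim Hg.
apply/frechetP; [exact: ltW | move=> e' ee'].
(* [M] bounds the squared distance under the identity matching, whose times differ from [phi] by at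
   most 1. *)
pose M := 2 * nsq (q - p) + 2 * e ^+ 2.
have n0 := nsq_ge0 (q - p).
have e20 : 0 < e ^+ 2 by rewrite exprn_gt0.
have M0 : 0 < M by rewrite /M; lra.
have phi01 s : 0 <= s <= 1 -> 0 <= phi s <= 1.
  by move=> /andP[s0 s1]; rewrite -{1}phi0 -phi1 !phim.
have HM s : 0 <= s <= 1 -> nsq (segment p q s - g s) <= M.
  move=> s01; have /andP[a0 a1] := phi01 s s01; have /andP[s0 s1] := s01.
  have -> : segment p q s - g s = (s - phi s) *: (q - p) + (segment p q (phi s) - g s).
    by rewrite /segment; apply/rowP => i; rewrite !mxE; ring.
  apply: le_trans (nsqD_le _ _) _; rewrite /M; apply: lerD; last first.
    by rewrite ler_pM2l //; exact: Hg.
  rewrite nsqZ ler_pM2l // ler_piMl //.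
  have : 0 <= (1 - (s - phi s)) * (1 + (s - phi s)) by apply: mulr_ge0; lra.
  by rewrite expr2; lra.
pose D := e' ^+ 2 - e ^+ 2.
have D0 : 0 < D.
  by rewrite /D subr_sqr mulr_gt0 //; lra.
(* This choice gives [0 < l < 1] and [l * M <= D], where [D] is the slack between the two squared
   bounds. *)
pose l := D / (M + D).
have MD0 : 0 < M + D by lra.
have l0 : 0 < l by rewrite divr_gt0.
have l1 : l < 1 by rewrite ltr_pdivrMr //; lra.
have lM : l * M <= D.
  have -> : l * M = D * (M / (M + D)) by rewrite /l; field; lra.
  by rewrite ler_piMr ?(ltW D0) // ler_pdivrMr //; lra.
pose psi (s : R) : R := (1 - l) * phi s + l * s.
have psi0 : psi 0 = 0 by rewrite /psi phi0; ring.
have psi1 : psi 1 = 1 by rewrite /psi phi1; ring.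
have psim s t : 0 <= s -> s < t -> t <= 1 -> psi s < psi t.
  move=> s0 st t1; rewrite /psi; apply: ler_ltD.
    by apply: ler_wpM2l; [lra | apply: phim => //; exact: ltW].
  by rewrite ltr_pM2l.
have cpsi : continuous psi.
  move=> x; apply: cvgD; first by apply: cvgMr; exact: cphi.
  by apply: cvgMr; exact: cvg_id.
have psi_sur t : 0 <= t <= 1 -> exists2 s, 0 <= s <= 1 & psi s = t.
  move=> t01; have [||s s01 <-] := @IVT R psi 0 1 t ler01.
  - exact: continuous_subspaceT.
  - by rewrite psi0 psi1 min_l ?max_r.
  by exists s => //; rewrite in_itv in s01.
(* [psi] reparametrizes the segment, whereas [frechet] reparametrizes [g]; the homeomorphism is
   therefore the inverse of [psi], with default value 0 where no preimage exists. *)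
pose s (t : R) : R := xget 0 [set s | 0 <= s <= 1 /\ psi s = t].
have sP t : 0 <= t <= 1 -> 0 <= s t <= 1 /\ psi (s t) = t.
  move=> t01; have [x x01 px] := psi_sur t t01.
  by rewrite /s; case: xgetP => [y -> []//|/(_ x) []].
have s_lt (x y : R) : 0 <= x <= 1 -> 0 <= y <= 1 -> x < y -> s x < s y.
  move=> x01 y01 xy; have [sx px] := sP x x01; have [sy py] := sP y y01.
  rewrite ltNge; apply/negP; rewrite le_eqVlt => /orP[/eqP E|lt].
    by move: xy; rewrite -px -py E ltxx.
  have := psim (s y) (s x); rewrite px py => /(_ _ lt); case/andP: sx => _ -> /=.
  by case/andP: sy => -> _ /(_ isT isT) lt'; move: (lt_trans xy lt'); rewrite ltxx.
have psi_inj (x y : R) : 0 <= x <= 1 -> 0 <= y <= 1 -> psi x = psi y -> x = y.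
  move=> /andP[x0 x1] /andP[y0 y1] E; case: (ltgtP x y) => // lt.
    by have := psim x y x0 lt y1; rewrite E ltxx.
  by have := psim y x y0 lt x1; rewrite E ltxx.
have psi01 (x : R) : 0 <= x <= 1 -> 0 <= psi x <= 1.
  move=> x01; have /andP[x0 x1] := phi01 _ x01; have /andP[y0 y1] := x01.
  by rewrite /psi; apply/andP; split; nra.
have spsi (x : R) : 0 <= x <= 1 -> s (psi x) = x.
  move=> x01; have [s01 E] := sP _ (psi01 x x01).
  exact: psi_inj.
have s0 : s 0 = 0 by rewrite -{1}psi0 spsi // lexx ler01.
have s1 : s 1 = 1 by rewrite -{1}psi1 spsi // lexx ler01.
have s_sur : set_surj `[0, 1] `[0, 1] s.
  move=> x /=; rewrite in_itv /= => x01; exists (psi x); last exact: spsi.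
  by rewrite /= in_itv /= psi01.
exists s.
  split.
  - split.
    + by move=> x /=; rewrite !in_itv /= => /sP[].
    + move=> x y; rewrite !inE /= !in_itv /= => x01 y01 E.
      by have [_ <-] := sP x x01; have [_ <-] := sP y y01; rewrite E.
    + exact: s_sur.
  - apply: segment_inc_surj_continuous; last by rewrite s0 s1.
    move=> x y; rewrite !in_itv /= => x01 y01; apply/idP/idP => [h|].
      by rewrite leNgt; apply/negP => /(s_lt _ _ y01 x01); rewrite ltNge h.
    by rewrite le_eqVlt => /predU1P[->//|/(s_lt _ _ x01 y01)/ltW].
  - by move=> x y; rewrite !in_itv /=; exact: s_lt.
move=> t t01; have [st01 E] := sP t t01.
rewrite -{1}E /psi.
have -> : segment p q ((1 - l) * phi (s t) + l * s t) - g (s t) =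
    (1 - l) *: (segment p q (phi (s t)) - g (s t)) + l *: (segment p q (s t) - g (s t)).
  by rewrite /segment; apply/rowP => i; rewrite !mxE; ring.
apply: le_trans (nsq_conv _ _ _) _; first by apply/andP; split; lra.
have h1 := Hg _ st01; have h2 := HM _ st01.
have h3 : (1 - l) * nsq (segment p q (phi (s t)) - g (s t)) <= e ^+ 2.
  by have := nsq_ge0 (segment p q (phi (s t)) - g (s t)); nra.
have h4 : l * nsq (segment p q (s t) - g (s t)) <= l * M by rewrite ler_pM2l.
apply: le_trans (lerD h3 h4) _.
by have := lM; rewrite /D; lra.
Qed.

End Norm.

(** * Certificates of edge placements *)

Section EdgeGeometry.
Context {R : realType} {d : nat}.
Implicit Type G : embgraph R d.

Definition inc G (e : 'I_(ne G)) (w : 'I_(nv G)) := (w == (ends e).1) || (w == (ends e).2).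
Definition vtx G (w : 'I_(nv G)) : 'rV[R]_(nv G) := delta_mx 0 w.

Lemma vtxE G (w i : 'I_(nv G)) : vtx w 0 i = (i == w)%:R.
Proof. by rewrite mxE eqxx. Qed.

Lemma edge_setP G (e : 'I_(ne G)) (x : 'rV[R]_(nv G)) :
  edge_set G e x <->
  [/\ forall i, 0 <= x 0 i, x 0 (ends e).1 + x 0 (ends e).2 = 1 &
      forall i, ~~ inc e i -> x 0 i = 0].
Proof.
have ab := ends_loopless e.
split.
  case=> t; rewrite /= in_itv /= => /andP[t0 t1] <-; split.
  - move=> i; rewrite !mxE; apply: addr_ge0; apply: mulr_ge0;
      rewrite ?subr_ge0 // mulr_ge0 //; exact: ler0n.
  - by rewrite !mxE !eqxx (negbTE ab) [_.2 == _.1]eq_sym (negbTE ab) /=; ring.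
  - by move=> i /norP[/negbTE i1 /negbTE i2]; rewrite !mxE i1 i2 !andbF !mulr0 addr0.
move=> [x0 x1 xn]; exists (x 0 (ends e).2).
  rewrite /= in_itv /= x0 -x1 lerDr x0 //.
have -> : 1 - x 0 (ends e).2 = x 0 (ends e).1 by rewrite -x1 addrK.
apply/rowP => i; rewrite !mxE !eqxx /=.
case: (eqVneq i (ends e).1) => [->|i1].
  by rewrite (negbTE ab) /= mulr0n mulr1n; ring.
case: (eqVneq i (ends e).2) => [->|i2]; first by rewrite /= mulr0n mulr1n; ring.
by rewrite (xn i) ?/inc ?negb_or ?i1 ?i2 //= !mulr0 addr0.
Qed.

Lemma vtx_edge G (e : 'I_(ne G)) w : edge_set G e (vtx w) <-> inc e w.
Proof.
have ab := ends_loopless e.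
rewrite edge_setP; split.
  move=> [_ + _]; rewrite !vtxE /inc (eq_sym w) (eq_sym w).
  case: ((ends e).1 == w) => //; case: ((ends e).2 == w) => //.
  by move=> /esym/eqP; rewrite addr0 oner_eq0.
move=> /orP[] /eqP ->; split.
- by move=> i; rewrite vtxE; exact: ler0n.
- by rewrite !vtxE eqxx eq_sym (negbTE ab) addr0.
- by move=> i /norP[/negbTE i1 _]; rewrite vtxE i1.
- by move=> i; rewrite vtxE; exact: ler0n.
- by rewrite !vtxE eqxx (negbTE ab) add0r.
- by move=> i /norP[_ /negbTE i1]; rewrite vtxE i1.
Qed.

Lemma edge_set_segment G (e : 'I_(ne G)) (x y : 'rV[R]_(nv G)) s : 0 <= s <= 1 ->
  edge_set G e x -> edge_set G e y -> edge_set G e (segment x y s).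
Proof.
move=> /andP[s0 s1] /edge_setP[x0 x1 xn] /edge_setP[y0 y1 yn]; apply/edge_setP; split.
- by move=> i; rewrite !mxE addr_ge0 // mulr_ge0 // subr_ge0.
- rewrite !mxE; set a := x 0 _ in x1 *; set b := x 0 _ in x1 *.
  set a' := y 0 _ in y1 *; set b' := y 0 _ in y1 *.
  have -> : (1 - s) * a + s * a' + ((1 - s) * b + s * b') = (1 - s) * (a + b) + s * (a' + b') by ring.
  by rewrite x1 y1; ring.
- by move=> i ni; rewrite !mxE xn // yn //; ring.
Qed.

Lemma edge_coord_le1 G (e : 'I_(ne G)) (x : 'rV[R]_(nv G)) w : edge_set G e x -> x 0 w <= 1.
Proof.
move=> /edge_setP[x0 x1 xn]; case: (boolP (inc e w)) => [/orP[]/eqP->|/xn ->//].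
  by rewrite -x1 lerDl.
by rewrite -x1 lerDr.
Qed.

Lemma edge_coord_inc G (e : 'I_(ne G)) (x : 'rV[R]_(nv G)) w :
  edge_set G e x -> 0 < x 0 w -> inc e w.
Proof. by move=> /edge_setP[_ _ xn] xw; apply: contraT => /xn E; rewrite E ltxx in xw. Qed.

Lemma edge_coord1 G (e : 'I_(ne G)) (x : 'rV[R]_(nv G)) w :
  edge_set G e x -> x 0 w = 1 -> x = vtx w.
Proof.
move=> ex xw; have iw : inc e w by apply: (edge_coord_inc ex); rewrite xw.
have ab := ends_loopless e.
move: ex => /edge_setP[x0 x1 xn].
apply/rowP => i; rewrite vtxE; case: (eqVneq i w) => [->//|iw'].
case: (boolP (inc e i)) => [ii|/xn//].
by move: iw ii x1 iw' xw => /orP[]/eqP-> /orP[]/eqP->; rewrite ?eqxx //= => h _ h'; lra.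
Qed.

(** If neither coordinate of [x] on [e] vanished, both ends of [e] would lie on [f], and simplicity
    of the graph would give [e = f]. Crossings in R^d play no part, since points are given by
    barycentric coordinates. *)
Lemma edge_meet G (e f : 'I_(ne G)) (x : 'rV[R]_(nv G)) : e != f ->
  edge_set G e x -> edge_set G f x -> exists w, [/\ x = vtx w, inc e w & inc f w].
Proof.
move=> ef ex fx; have ab := ends_loopless e.
have /edge_setP[x0 x1 xn] := ex.
suff [w [xw ew]] : exists w, x 0 w = 1 /\ inc e w.
  exists w; split=> //; first exact: edge_coord1 ex xw.
  by apply: (edge_coord_inc fx); rewrite xw.
have [h1|h1] := eqVneq (x 0 (ends e).1) 0.
  by exists (ends e).2; rewrite -x1 h1 add0r /inc eqxx orbT.
have [h2|h2] := eqVneq (x 0 (ends e).2) 0.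
  by exists (ends e).1; rewrite -x1 h2 addr0 /inc eqxx.
have f1 : inc f (ends e).1 by apply: (edge_coord_inc fx); rewrite lt_neqAle eq_sym h1 x0.
have f2 : inc f (ends e).2 by apply: (edge_coord_inc fx); rewrite lt_neqAle eq_sym h2 x0.
case/negP: ef; apply/eqP/ends_simple.
move: f1 f2 ab; rewrite /inc; case: (ends e) => a b; case: (ends f) => a' b' /=.
move=> /orP[]/eqP-> /orP[]/eqP->; rewrite ?eqxx //; [by left| by right].
Qed.

(** A vertex is an extreme point of its edge, because the coordinate of [w] is at most 1 there. *)
Lemma segment_vtx G (e : 'I_(ne G)) (x y : 'rV[R]_(nv G)) s w : 0 <= s <= 1 ->
  edge_set G e x -> edge_set G e y -> segment x y s = vtx w -> vtx w = x \/ vtx w = y.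
Proof.
move=> /andP[s0 s1] ex ey E; have := congr1 (fun z : 'rV_(nv G) => z 0 w) E.
rewrite vtxE eqxx !mxE mulr1n => {}E.
have x1 := edge_coord_le1 w ex; have y1 := edge_coord_le1 w ey.
have [xw|xw] := eqVneq (x 0 w) 1; first by left; rewrite (edge_coord1 ex xw).
right; rewrite (edge_coord1 (w := w) ey) //.
have xl : x 0 w < 1 by rewrite lt_neqAle xw.
apply/eqP; rewrite eq_le y1 leNgt; apply/negP => yl.
have [s0'|s0'] := eqVneq s 0; first by move: E; rewrite s0'; lra.
have : s * y 0 w < s by rewrite gtr_pMr // lt_neqAle eq_sym s0'.
have : (1 - s) * x 0 w <= 1 - s by rewrite ler_piMr // subr_ge0.
lra.
Qed.

Lemma locate_segment G (x y : 'rV[R]_(nv G)) s :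
  locate (segment x y s : gpoint G) = segment (locate (x : gpoint G)) (locate (y : gpoint G)) s.
Proof.
rewrite /locate /segment !scaler_sumr -big_split; apply: eq_bigr => i _ /=.
by rewrite !mxE [LHS]scalerDl -!scalerA.
Qed.

Lemma locate_vtx G (w : 'I_(nv G)) : locate (vtx w : gpoint G) = pos w.
Proof.
rewrite /locate (bigD1 w) //= vtxE eqxx scale1r big1 ?addr0 // => i iw.
by rewrite vtxE (negbTE iw) scale0r.
Qed.

Lemma segment0 n (x y : 'rV[R]_n) : segment x y 0 = x.
Proof. by rewrite /segment subr0 scale1r scale0r addr0. Qed.

Lemma segment1 n (x y : 'rV[R]_n) : segment x y 1 = y.
Proof. by rewrite /segment subrr scale1r scale0r add0r. Qed.

Lemma segment_inj n (x y : 'rV[R]_n) s t : x != y -> segment x y s = segment x y t -> s = t.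
Proof.
move=> xy /eqP; rewrite -subr_eq0.
have -> : segment x y s - segment x y t = (s - t) *: (y - x).
  by apply/rowP => i; rewrite !mxE; ring.
by rewrite scaler_eq0 !subr_eq0 eq_sym [y == x]eq_sym (negbTE xy) orbF => /eqP.
Qed.

Lemma cont_segment n (x y : 'rV[R]_n) : continuous (segment x y : R -> 'rV[R]_n).
Proof.
move=> t; apply: cvgD.
  by apply: cvgZr_tmp; apply: cvgB; [exact: cvg_cst|exact: cvg_id].
by apply: cvgZr_tmp; exact: cvg_id.
Qed.

End EdgeGeometry.

Lemma not_uniq_map (T : Type) (U : eqType) (f : T -> U) (s : seq T) : ~~ uniq (map f s) ->
  exists s1 a s2 b s3, s = s1 ++ a :: s2 ++ b :: s3 /\ f a = f b.
Proof.
elim: s => //= x s IH; rewrite negb_and negbK => /orP[|/IH[s1 [a [s2 [b [s3 [-> fab]]]]]]].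
  elim: s {IH} => //= y s IH; rewrite inE => /predU1P[E|/IH].
    by exists [::], x, [::], y, s.
  case=> s1 [a [s2 [b [s3 [E fab]]]]].
  case: s1 E => [|z s1] /= [].
    by move=> -> ->; exists [::], a, (y :: s2), b, s3.
  by move=> -> ->; exists (z :: y :: s1), a, s2, b, s3.
by exists (x :: s1), a, s2, b, s3.
Qed.

Lemma in_map_split (T : Type) (U : eqType) (f : T -> U) (s : seq T) u : u \in map f s ->
  exists s1 a s2, s = s1 ++ a :: s2 /\ f a = u.
Proof.
elim: s => //= x s IH; rewrite inE => /predU1P[->|/IH[s1 [a [s2 [-> fa]]]]].
  by exists [::], x, s.
by exists (x :: s1), a, s2.
Qed.

(** * Walks with monotone crossing times *)

Section Traversal.
Context {R : realType} {d : nat} {G : embgraph R d} (p q : 'rV[R]_d).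
Local Notation E := 'I_(ne G).
Local Notation V := 'I_(nv G).
Local Notation pt := 'rV[R]_(nv G).
Implicit Types (eps t s : R) (K : seq (V * E)) (j l m : E) (w : V).

Definition fclose eps t (x : 'rV[R]_d) := nsq (segment p q t - x) <= eps ^+ 2.

(** A pair [(w, m)] of [K] is a crossing: the walk leaves its current edge through [w] and continues
    on [m]. Only crossings carry times; [t] and [t'] bound them from below and above. *)
Fixpoint trav eps K j t l t' : Prop :=
  match K with
  | [::] => j = l /\ t <= t'
  | (w, m) :: K' =>
    [/\ inc j w, inc m w &
        exists s, [/\ t <= s, fclose eps s (pos w) & trav eps K' m s l t']]
  end.

Lemma trav_le eps K j t l t' : trav eps K j t l t' -> t <= t'.
Proof.
elim: K j t => [|[w m] K IH] j t /=; first by case.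
by move=> [_ _ [s [ts _ /IH]]]; exact: le_trans.
Qed.

Lemma trav_weaken eps eps' K j t t2 l t' t2' : 0 <= eps -> eps <= eps' -> t2 <= t -> t' <= t2' ->
  trav eps K j t l t' -> trav eps' K j t2 l t2'.
Proof.
move=> e0 ee + tt'; elim: K j t t2 => [|[w m] K IH] j t t2 le1 /=.
  by move=> [-> h]; split=> //; apply: le_trans le1 (le_trans h tt').
move=> [jw mw [s [ts cl tr]]]; split=> //; exists s; split.
- exact: le_trans ts.
- by apply: le_trans cl _; rewrite ler_pXn2r ?nnegrE // (le_trans e0).
- exact: IH tr.
Qed.

Lemma trav_cat eps K1 K2 j t l t' : trav eps (K1 ++ K2) j t l t' <->
  exists m s, trav eps K1 j t m s /\ trav eps K2 m s l t'.
Proof.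
elim: K1 j t => [|[w m] K1 IH] j t /=.
  split=> [tr|[m [s [[<- ts]]]]]; first by exists j, t.
  elim: K2 t s ts j => [|[w m'] K2 IH] t s ts j /=.
    by move=> [-> st']; split=> //; exact: le_trans st'.
  move=> [? ? [s' [ss' ? ?]]]; split=> //; exists s'; split=> //; exact: le_trans ss'.
split.
  move=> [jw mw [s [ts cl /IH[m' [s' [tr1 tr2]]]]]].
  by exists m', s'; split=> //; split=> //; exists s.
move=> [m' [s' [[jw mw [s [ts cl tr1]]] tr2]]]; split=> //; exists s; split=> //.
by apply/IH; exists m', s'.
Qed.

(** Closeness at times 0 and 1 is not included; it is a condition on the end points, expressed by
    [inside] and [hits] for the end edges. *)
Definition cert eps j l := exists K, trav eps K j 0 l 1.

Lemma cont_min2 : continuous (fun r : R => Order.min 1 (2 * r)).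
Proof.
move=> r; apply: (@continuous_min R R (fun=> 1) (fun r => 2 * r)); first exact: cvg_cst.
by apply: cvgMr; exact: cvg_id.
Qed.

Lemma cont_max2 : continuous (fun r : R => Order.max 0 (2 * r - 1)).
Proof.
move=> r; apply: (@continuous_max R R (fun=> 0) (fun r => 2 * r - 1)); first exact: cvg_cst.
by apply: cvgB; [apply: cvgMr; exact: cvg_id| exact: cvg_cst].
Qed.

Lemma segment_close eps t t' (x y : pt) r : 0 <= r <= 1 ->
  fclose eps t (locate (x : gpoint G)) -> fclose eps t' (locate (y : gpoint G)) ->
  fclose eps (t + r * (t' - t)) (locate (segment x y r : gpoint G)).
Proof.
move=> r01 ct ct'; rewrite /fclose locate_segment.
have -> : segment p q (t + r * (t' - t)) - segment (locate (x : gpoint G)) (locate (y : gpoint G)) r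
  = (1 - r) *: (segment p q t - locate (x : gpoint G)) + r *: (segment p q t' - locate (y : gpoint G)).
  by apply/rowP => i; rewrite !mxE; ring.
exact: nsq_conv_le.
Qed.

Definition piece (x y : pt) : set pt := [set segment x y r | r in `[0, 1]].

(* The pieces of the polyline x, w_1, .., w_k, y. *)
Fixpoint pieces (x : pt) K (y : pt) : set pt :=
  match K with
  | [::] => piece x y
  | (w, m) :: K' => piece x (vtx w) `|` pieces (vtx w) K' y
  end.

Definition pts K : seq pt := [seq vtx km.1 | km <- K].

Lemma piece_sub j (x y : pt) z : edge_set G j x -> edge_set G j y -> piece x y z ->
  edge_set G j z /\ forall w, z = vtx w -> z = x \/ z = y.
Proof.
move=> jx jy [r]; rewrite /= in_itv /= => r01 <-; split.
  exact: edge_set_segment.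
move=> w E; rewrite E; exact: segment_vtx r01 jx jy E.
Qed.

(** A polyline contains no vertices besides its end points and crossings. With [edge_meet] this
    separates its pieces on different edges. *)
Lemma pieces_sub eps K j t l t' (x y : pt) z : trav eps K j t l t' ->
  edge_set G j x -> edge_set G l y -> pieces x K y z ->
  exists m, [/\ m \in j :: map snd K, edge_set G m z &
     forall w, z = vtx w -> z \in x :: pts K ++ [:: y]].
Proof.
elim: K j t x => [|[w m] K IH] j t x /=.
  move=> [<- _] jx ly /(piece_sub jx ly)[jz H]; exists j; split=> //; first by rewrite mem_head.
  by move=> w /H[->|->]; rewrite !inE eqxx ?orbT.
move=> [jw mw [s [ts cl tr]]] jx ly [|].
  move=> /(piece_sub jx (iffRL (vtx_edge j w) jw))[jz H]; exists j; split=> //.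
    by rewrite mem_head.
  by move=> w' /H[->|->]; rewrite !inE eqxx ?orbT.
move=> /(IH _ _ _ tr (iffRL (vtx_edge m w) mw) ly)[m' [m'K m'z H]]; exists m'; split=> //.
  by rewrite inE m'K orbT.
by move=> w' /H h; rewrite inE h orbT.
Qed.

(** The point [P r] is matched with the time [phi r], which may stand still. Continuity is required
    on the whole line, which simplifies concatenation. *)
Record trajectory eps (x y : pt) t (U : set pt) (P : R -> pt) (phi : R -> R) : Prop := {
  traj_cont : continuous P;
  traj_inj : {in `[0, 1] &, injective P};
  traj0 : P 0 = x;
  traj1 : P 1 = y;
  traj_phi_cont : continuous phi;
  traj_phi_mono : forall r s, 0 <= r -> r <= s -> s <= 1 -> phi r <= phi s;
  traj_phi0 : phi 0 = t;
  traj_phi1 : phi 1 = 1;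
  traj_close : forall r, 0 <= r <= 1 -> fclose eps (phi r) (locate (P r : gpoint G));
  traj_sub : forall r, 0 <= r <= 1 -> U (P r) }.

Lemma trajectory_of_trav eps K j t l (x y : pt) : trav eps K j t l 1 ->
  edge_set G j x -> edge_set G l y ->
  fclose eps t (locate (x : gpoint G)) -> fclose eps 1 (locate (y : gpoint G)) ->
  uniq (j :: map snd K) -> uniq (x :: pts K ++ [:: y]) ->
  exists P phi, trajectory eps x y t (pieces x K y) P phi.
Proof.
elim: K j t x => [|[w m] K IH] j t x /=.
  move=> [<- t1] jx jy cx cy _; rewrite inE andbT => xy.
  exists (segment x y), (fun r => t + r * (1 - t)); split.
  - exact: cont_segment.
  - by move=> r s _ _; exact: segment_inj.
  - exact: segment0.
  - exact: segment1.
  - move=> r; apply: cvgD; first exact: cvg_cst.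
    by apply: cvgMl; exact: cvg_id.
  - by move=> r s _ rs _; rewrite lerD2l ler_wpM2r // subr_ge0.
  - by rewrite mul0r addr0.
  - by rewrite mul1r addrC subrK.
  - by move=> r r01; exact: segment_close.
  - by move=> r r01; exists r => //=; rewrite in_itv.
move=> [jw mw [s [ts cs tr]]] jx ly cx cy /andP[jK uK] /andP[xK uP].
have wj : edge_set G j (vtx w) by apply/vtx_edge.
have wm : edge_set G m (vtx w) by apply/vtx_edge.
have cw : fclose eps s (locate (vtx w : gpoint G)) by rewrite locate_vtx.
have [P [phi [Pc Pi P0 P1 phc phm ph0 ph1 Pcl PU]]] := IH m s (vtx w) tr wm ly cw cy uK uP.
have xw : x != vtx w by move: xK; rewrite inE negb_or => /andP[].
(* Concatenation in one formula: one of the first two terms of [P'] is always equal to [vtx w], so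
   [P'] is continuous as a sum of continuous maps. [phi'] is built in the same way. *)
pose a r : R := Order.min 1 (2 * r); pose b r : R := Order.max 0 (2 * r - 1).
have abE r : (r <= 1 / 2 -> a r = 2 * r /\ b r = 0) /\ (1 / 2 <= r -> a r = 1 /\ b r = 2 * r - 1).
  split=> h; split; rewrite /a /b.
  - by rewrite min_r //; lra.
  - by rewrite max_l //; lra.
  - by rewrite min_l //; lra.
  - by rewrite max_r //; lra.
pose P' r := segment x (vtx w) (a r) + P (b r) - vtx w.
pose phi' r := t + a r * (s - t) + phi (b r) - s.
have Pl r : r <= 1 / 2 -> P' r = segment x (vtx w) (2 * r).
  by move=> h; rewrite /P'; have [-> ->] := (abE r).1 h; rewrite P0 addrK.
have Pr r : 1 / 2 <= r -> P' r = P (2 * r - 1).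
  by move=> h; rewrite /P'; have [-> ->] := (abE r).2 h; rewrite segment1 addrC addKr.
have phl r : r <= 1 / 2 -> phi' r = t + 2 * r * (s - t).
  by move=> h; rewrite /phi'; have [-> ->] := (abE r).1 h; rewrite ph0 addrK.
have phr r : 1 / 2 <= r -> phi' r = phi (2 * r - 1).
  by move=> h; rewrite /phi'; have [-> ->] := (abE r).2 h; ring.
have half : (0 : R) <= 1 / 2 by lra.
(* The first piece meets the rest only at [w]: a common point lies on two different edges, hence is
   a vertex, and it is not [x] because [x] does not occur again among the break points. *)
have mix r r' : 0 <= r -> r <= 1 / 2 -> 1 / 2 <= r' -> r' <= 1 -> P' r = P' r' -> r = r'.
  move=> r0 rh rh' r1'; rewrite Pl // Pr // => E.
  have pz : piece x (vtx w) (P (2 * r' - 1)).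
    by exists (2 * r) => //=; rewrite in_itv /=; apply/andP; split; lra.
  have [jz vz] := piece_sub jx wj pz.
  have Uz := PU (2 * r' - 1) ltac:(apply/andP; split; lra).
  have [m' [m'K m'z Hz]] := pieces_sub tr wm ly Uz.
  have jm' : j != m' by apply: contraNneq jK => ->.
  have [w' [zw' _ _]] := edge_meet jm' jz m'z.
  have {}Hz := Hz w' zw'.
  have Pw : P (2 * r' - 1) = vtx w.
    by have [Ex|//] := vz w' zw'; move: Hz xK; rewrite Ex /= => ->.
  have r'E : 2 * r' - 1 = 0.
    apply: Pi; rewrite ?in_itv /= ?lexx ?ler01 //; last by rewrite Pw P0.
    by apply/andP; split; lra.
  have : 2 * r = 1.
    by apply: (segment_inj xw); rewrite segment1 E Pw.
  lra.
exists P', phi'; split.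
- move=> r; apply: cvgB; last exact: cvg_cst.
  apply: cvgD.
    apply: (@cvg_comp _ _ _ a (segment x (vtx w))); first exact: cont_min2.
    exact: cont_segment.
  by apply: (@cvg_comp _ _ _ b P); [exact: cont_max2 | exact: Pc].
- move=> r r'; rewrite !in_itv /= => /andP[r0 r1] /andP[r0' r1'] E.
  have [rh|rh] := leP r (1 / 2); have [rh'|rh'] := leP r' (1 / 2).
  + move: E; rewrite !Pl // => /(segment_inj xw); lra.
  + by apply: mix => //; exact: ltW.
  + by apply/esym; apply: mix => //; exact: ltW.
  + move: E; rewrite !Pr ?ltW // => /Pi; rewrite !in_itv /= => H.
    have := H ltac:(apply/andP; split; lra) ltac:(apply/andP; split; lra); lra.
- by rewrite Pl // mulr0 segment0.
- by rewrite Pr ?P1 //; [have -> : 2 * 1 - 1 = 1 :> R by ring | lra].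
- move=> r; apply: cvgB; last exact: cvg_cst.
  apply: cvgD; last by apply: (@cvg_comp _ _ _ b phi); [exact: cont_max2 | exact: phc].
  apply: cvgD; first exact: cvg_cst.
  by apply: cvgMl; exact: cont_min2.
- move=> r r' r0 rr' r1'.
  have [rh|rh] := leP r (1 / 2); have [rh'|rh'] := leP r' (1 / 2).
  + by rewrite !phl // lerD2l ler_wpM2r ?subr_ge0 // ler_wpM2l.
  + rewrite phl // phr; last exact: ltW.
    apply: (@le_trans _ _ s).
      by rewrite -lerBrDl ler_piMl ?subr_ge0 //; lra.
    by rewrite -ph0; apply: phm; lra.
  + by move: (lt_le_trans rh rr') rh'; rewrite ltNge => /negbTE ->.
  + by rewrite (phr _ (ltW rh)) (phr _ (ltW rh')); apply: phm; lra.
- by rewrite phl // mulr0 mul0r addr0.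
- by rewrite phr ?ph1 //; [have -> : 2 * 1 - 1 = 1 :> R by ring | lra].
- move=> r /andP[r0 r1]; have [rh|rh] := leP r (1 / 2).
    by rewrite Pl // phl //; apply: segment_close => //; apply/andP; split; lra.
  by rewrite (Pr _ (ltW rh)) (phr _ (ltW rh)); apply: Pcl; apply/andP; split; lra.
- move=> r /andP[r0 r1]; have [rh|rh] := leP r (1 / 2).
    by left; rewrite Pl //; exists (2 * r) => //=; rewrite in_itv /=; apply/andP; split; lra.
  by right; rewrite (Pr _ (ltW rh)); apply: PU; apply/andP; split; lra.
Qed.

End Traversal.

(** * From certificates to paths *)

Section PathOfCert.
Context {R : realType} {d : nat} {G : embgraph R d} (p q : 'rV[R]_d).
Local Notation E := 'I_(ne G).
Local Notation V := 'I_(nv G).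
Local Notation pt := 'rV[R]_(nv G).
Implicit Types (eps t s : R) (K : seq (V * E)) (j l m : E) (w : V).

(* Two visits of the same edge or vertex, or a visit of an edge that contains an end point,
   allow a shortcut. *)
Lemma trav_shorten eps K j l (x y : pt) : 0 <= eps -> x != y -> trav p q eps K j 0 l 1 ->
  edge_set G j x -> edge_set G l y ->
  exists K' j' l', [/\ trav p q eps K' j' 0 l' 1, edge_set G j' x, edge_set G l' y,
    uniq (j' :: map snd K') & uniq (x :: pts K' ++ [:: y])].
Proof.
move=> e0 xy; have [n] := ubnP (size K); elim: n K j l => // n IH K j l sK tr jx ly.
have [U1|N1] := boolP (uniq (j :: map snd K)); last first.
  move: N1; rewrite /= negb_and negbK => /orP[/in_map_split|/not_uniq_map].
    move=> [K1 [[w m] [K2 [EK /= mj]]]]; move: tr; rewrite EK => /trav_cat[m0 [s0 [tr1 /=]]].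
    move=> [_ _ [s [ts _ tr]]]; apply: (IH K2 j l) => //.
      by move: sK; rewrite EK size_cat /=; lia.
    rewrite -mj; apply: trav_weaken tr => //.
    by apply: le_trans ts; exact: trav_le tr1.
  move=> [K1 [[w m] [K2 [[w' m'] [K3 [EK /= mm]]]]]].
  move: tr; rewrite EK => /trav_cat[m0 [s0 [tr1 [iw im [s [ts cl]]]]]].
  move=> /trav_cat[m1 [s1 [tr2 [_ _ [s' [ts' _ tr3]]]]]].
  apply: (IH (K1 ++ (w, m) :: K3) j l) => //.
    by move: sK; rewrite EK !size_cat /= size_cat /=; lia.
  apply/trav_cat; exists m0, s0; split=> //; split=> //; exists s; split=> //.
  rewrite mm; apply: trav_weaken tr3 => //.
  by apply: le_trans ts'; exact: trav_le tr2.
have [U2|N2] := boolP (uniq (x :: pts K ++ [:: y])); first by exists K, j, l.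
move: N2; rewrite /= mem_cat inE (negbTE xy) orbF negb_and negbK cats1 rcons_uniq negb_and negbK.
move=> /or3P[/in_map_split|/in_map_split|/not_uniq_map].
- move=> [K1 [[w m] [K2 [EK /= wx]]]].
  move: tr; rewrite EK => /trav_cat[m0 [s0 [tr1 [_ im [s [ts _ tr]]]]]].
  apply: (IH K2 m l) => //.
  + by move: sK; rewrite EK size_cat /=; lia.
  + apply: trav_weaken tr => //; apply: le_trans ts; exact: trav_le tr1.
  + by rewrite -wx; apply/vtx_edge.
- move=> [K1 [[w m] [K2 [EK /= wy]]]].
  move: tr; rewrite EK => /trav_cat[m0 [s0 [tr1 [im _ [s [ts _ tr]]]]]].
  apply: (IH K1 j m0) => //.
  + by move: sK; rewrite EK size_cat /=; lia.
  + apply: trav_weaken tr1 => //; apply: le_trans ts _; exact: trav_le tr.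
  + by rewrite -wy; apply/vtx_edge.
- move=> [K1 [[w m] [K2 [[w' m'] [K3 [EK /= ww]]]]]].
  move: tr; rewrite EK => /trav_cat[m0 [s0 [tr1 [iw im [s [ts cl]]]]]].
  move=> /trav_cat[m1 [s1 [tr2 [_ im' [s' [ts' _ tr3]]]]]].
  have {}ww : w = w'.
    by apply/eqP; have := congr1 (fun z : pt => z 0 w) ww; rewrite !vtxE eqxx; case: (w == w') => //= /eqP; rewrite mulr1n mulr0n oner_eq0.
  apply: (IH (K1 ++ (w, m') :: K3) j l) => //.
    by move: sK; rewrite EK !size_cat /= size_cat /=; lia.
  apply/trav_cat; exists m0, s0; split=> //; split=> //; first by rewrite ww.
  exists s; split=> //.
  by apply: trav_weaken tr3 => //; apply: le_trans ts'; exact: trav_le tr2.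
Qed.

(** The end points may be any close points of the two edges; this later permits a single image point
    for each vertex of G1. Equal end points are treated apart, by the trivial path, since the ends
    of an injective path differ. *)
Lemma path_of_cert eps j l (x y : pt) : 0 < eps -> cert p q eps j l ->
  edge_set G j x -> edge_set G l y ->
  nsq (locate (x : gpoint G) - p) <= eps ^+ 2 -> nsq (locate (y : gpoint G) - q) <= eps ^+ 2 ->
  exists P : R -> gpoint G, [/\ is_simple_path P, P 0 = x, P 1 = y &
    (frechet (segment p q) (fun t => locate (P t)) <= eps%:E)%E].
Proof.
move=> e0 [K0 tr0] jx0 ly0 cx cy.
have cx' : fclose p q eps 0 (locate (x : gpoint G)) by rewrite /fclose segment0 -nsqN opprB.
have cy' : fclose p q eps 1 (locate (y : gpoint G)) by rewrite /fclose segment1 -nsqN opprB.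
have [xy|xy] := eqVneq x y.
  exists (fun=> x); split=> //.
    split; last by right.
    split; last by move=> t _; exists j.
    by apply: continuous_subspaceT => t; exact: cvg_cst.
  apply: (@frechet_matching _ _ _ _ _ id) => //.
    by move=> t; exact: cvg_id.
  move=> s s01; have := segment_close s01 cx' (_ : fclose p q eps 1 (locate (x : gpoint G))).
  rewrite {1}xy => /(_ cy'); rewrite add0r subr0 mulr1 /fclose.
  by have -> : segment x x s = x by rewrite /segment -scalerDl subrK scale1r.
have [K [j' [l' [tr jx ly u1 u2]]]] := trav_shorten (ltW e0) xy tr0 jx0 ly0.
have [P [phi T]] := trajectory_of_trav tr jx ly cx' cy' u1 u2.
exists P; split; [|exact: traj0 T|exact: traj1 T|].
  split; last by left; exact: traj_inj T.
  split; first by apply: continuous_subspaceT; exact: traj_cont T.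
  move=> t; rewrite in_itv /= => t01.
  by have [m [_ mz _]] := pieces_sub tr jx ly (traj_sub T t01); exists m.
apply: (frechet_matching e0 (traj_phi_cont T) (traj_phi0 T) (traj_phi1 T)).
  exact: traj_phi_mono T.
by move=> s s01; exact: traj_close T _ s01.
Qed.

End PathOfCert.

(** * From paths to certificates *)

Section CertOfPath.
Context {R : realType} {d : nat} {G : embgraph R d} (p q : 'rV[R]_d).
Local Notation E := 'I_(ne G).
Local Notation V := 'I_(nv G).
Local Notation pt := 'rV[R]_(nv G).
Implicit Types (eps t s : R) (K : seq (V * E)) (j l m : E) (w : V).

Lemma cont_nsq n : continuous (nsq : 'rV[R]_n -> R).
Proof.
move=> x; refine (@cvg_big _ _ _ _ _ add_continuous _ (nbhs x) _
  (fun i (y : 'rV[R]_n) => y 0 i ^+ 2) (fun i => x 0 i ^+ 2) _ _) => i _.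
have h : (fun y : 'rV[R]_n => y 0 i) y @[y --> x] --> x 0 i by exact: coord_continuous.
by rewrite expr2; under eq_fun do rewrite expr2; apply: cvgM.
Qed.

Lemma cont_seg_nsq c : continuous (fun t => nsq (segment p q t - c)).
Proof.
move=> t; apply: (@cvg_comp _ _ _ (fun t => segment p q t - c) (@nsq R d)); last exact: cont_nsq.
by apply: cvgB; [exact: cont_segment | exact: cvg_cst].
Qed.

(** Compactness of [[a, b]]: a cluster point of chosen witnesses as the slack tends to 0. The slack
    [e'] of a nearby witness is only known to be at most [e]. *)
Lemma cluster_point (a b : R) (P : R -> R -> Prop) :
  (forall e, 0 < e -> exists s, a <= s <= b /\ P e s) ->
  exists s0, a <= s0 <= b /\ forall e, 0 < e -> exists e' s,
    [/\ 0 < e' <= e, `|s - s0| <= e & P e' s].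
Proof.
move=> H.
have /choice[f fP] : forall e, exists s, 0 < e -> a <= s <= b /\ P e s.
  move=> e; have [e0|e0] := ltP 0 e; last by exists 0.
  by have [s Hs] := H e e0; exists s.
have [|s0 [s0ab cl]] := @segment_compact R a b (f @ 0^'+) _.
  by exists 1 => //= x /= _ x0; rewrite in_itv /=; exact: (fP x x0).1.
exists s0; split; first by move: s0ab; rewrite /= in_itv.
move=> e e0.
have [||s [[e' e'e <-] bs]] := cl (f @` `]0, e]) (ball s0 e).
- exists e => //= x /=; rewrite sub0r normrN => xe x0; exists x => //=.
  by rewrite in_itv /= x0 /=; move: xe; rewrite gtr0_norm // => /ltW.
- exact: nbhsx_ballx.
exists e', (f e'); move: e'e; rewrite /= in_itv /= => /andP[e'0 e'e]; split.
- by rewrite e'0.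
- by move: bs; rewrite /ball /= distrC => /ltW.
- exact: (fP e' e'0).2.
Qed.

Lemma fclose_closed eps s0 c : 0 <= eps ->
  (forall e, 0 < e -> exists e' s, [/\ 0 < e' <= e, `|s - s0| <= e & fclose p q (eps + e') s c]) ->
  fclose p q eps s0 c.
Proof.
move=> eps0 H; rewrite /fclose leNgt; apply/negP => lt.
pose h t := nsq (segment p q t - c); pose eta := (h s0 - eps ^+ 2) / 2.
have eta0 : 0 < eta by rewrite /eta /h; lra.
have /cvgrPdist_lt/(_ _ eta0)[r /= r0 Hr] := @cont_seg_nsq c s0.
pose M := 2 * eps + 1.
have M0 : 0 < M by rewrite /M; lra.
(* The bound [r / 2] controls the change of [h], while 1 and [eta / M] control the growth of the
   squared radius, which is [e' * (2 * eps + e')]. *)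
have [e' [s [/andP[e'0 e'e] ss Hs]]] := H (Order.min (r / 2) (Order.min 1 (eta / M)))
  ltac:(by rewrite !lt_min ltr01 divr_gt0 // divr_gt0).
move: ss e'e; rewrite !le_min => /and3P[sr s1 sM] /and3P[er e1 eM].
have /= := Hr s; rewrite -normrN opprB => /(_ (le_lt_trans sr _)) => /(_ ltac:(lra)).
rewrite -/(h s) -/(h s0) ltr_norml => /andP[_ h1].
have h2 : (eps + e') ^+ 2 <= eps ^+ 2 + eta.
  have -> : (eps + e') ^+ 2 = eps ^+ 2 + e' * (2 * eps + e') by ring.
  rewrite lerD2l; apply: (@le_trans _ _ (e' * M)); first by rewrite ler_pM2l // /M; lra.
  by rewrite -ler_pdivlMr.
have : h s <= eps ^+ 2 + eta by exact: le_trans Hs h2.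
move: h1; rewrite /eta; lra.
Qed.

(** The start time is relaxed together with the radius: crossing times that converge to [s0] may lie
    slightly before it, and this is the hypothesis available at the next crossing. *)
Lemma trav_closed eps K j t l t' : 0 <= eps ->
  (forall e, 0 < e -> trav p q (eps + e) K j (t - e) l t') -> trav p q eps K j t l t'.
Proof.
move=> eps0; elim: K j t => [|[w m] K IH] j t /= H.
  split; first by have [] := H 1 ltr01.
  by apply/ler_addgt0Pr => e e0; rewrite -lerBlDr; have [] := H e e0.
have [jw mw _] := H 1 ltr01; split=> //.
pose P e s := [/\ t - e <= s, fclose p q (eps + e) s (pos w) & trav p q (eps + e) K m s l t'].
have [|s0 [_ Hs0]] := @cluster_point (t - 1) t' P.
  (* A slack of at most 1 keeps the crossing times in the compact interval from [t - 1] to [t']. *)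
  move=> e e0; pose e1 := Order.min e 1.
  have e10 : 0 < e1 by rewrite lt_min e0 ltr01.
  have [e1e e11] : e1 <= e /\ e1 <= 1 by rewrite !ge_min !lexx orbT.
  have [_ _ [s [ts cl tr]]] := H e1 e10.
  exists s; split; first by rewrite (trav_le tr) andbT; apply: le_trans ts; lra.
  split; first by apply: le_trans ts; lra.
    by apply: le_trans cl _; rewrite ler_pXn2r ?nnegrE //; lra.
  apply: trav_weaken tr => //; lra.
exists s0; split.
- apply/ler_addgt0Pr => e e0.
  have [e' [s [/andP[e'0 e'e] ss [ts _ _]]]] := Hs0 (e / 2) ltac:(lra).
  move: ss; rewrite ler_norml => /andP[_]; lra.
- by apply: fclose_closed => // e e0; have [e' [s [h1 h2 [_ h3 _]]]] := Hs0 e e0; exists e', s.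
- apply: IH => e e0; have [e' [s [/andP[e'0 e'e] ss [_ _ tr]]]] := Hs0 e e0.
  move: ss; rewrite ler_norml => /andP[h1 _].
  apply: trav_weaken tr => //; lra.
Qed.

(** Otherwise each [x] fails from some threshold downwards, and at the minimum of the finitely many
    thresholds all of them fail. *)
Lemma finite_pigeonhole (T : finType) (P : R -> T -> Prop) :
  (forall e, 0 < e -> exists x, P e x) ->
  (forall e e' x, 0 < e -> e <= e' -> P e x -> P e' x) ->
  exists x, forall e, 0 < e -> P e x.
Proof.
move=> H mono; apply: contrapT => /forallNP N.
suff [e e0 He] : exists2 e, 0 < e & forall x, x \in enum T -> ~ P e x.
  by have [x Px] := H e e0; apply: (He x) => //; rewrite mem_enum.
elim: (enum T) => [|x u [e e0 He]]; first by exists 1.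
have [e' e'0 Pe'] : exists2 e', 0 < e' & ~ P e' x.
  apply: contrapT => h; apply: (N x) => e1 e10; apply: contrapT => h'.
  by apply: h; exists e1.
exists (Order.min e e'); first by rewrite lt_min e0.
have m0 : 0 < Order.min e e' by rewrite lt_min e0.
move=> y; rewrite inE => /predU1P[->|yu] Py.
  by apply: Pe'; apply: mono Py => //; rewrite ge_min lexx orbT.
by apply: (He y yu); apply: mono Py => //; rewrite ge_min lexx.
Qed.

(** Distinct edges bound the length of the walk, which leaves finitely many crossing sequences for
    [cert_closed]. *)
Lemma trav_uniq eps K j l t t' : 0 <= eps -> trav p q eps K j t l t' ->
  exists2 K', trav p q eps K' j t l t' & uniq (j :: map snd K').
Proof.
move=> e0; have [n] := ubnP (size K); elim: n K => // n IH K sK tr.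
have [U1|N1] := boolP (uniq (j :: map snd K)); first by exists K.
move: N1; rewrite /= negb_and negbK => /orP[/in_map_split|/not_uniq_map].
  move=> [K1 [[w m] [K2 [EK /= mj]]]]; move: tr; rewrite EK => /trav_cat[m0 [s0 [tr1 /=]]].
  move=> [_ _ [s [ts _ tr]]]; apply: (IH K2) => //.
    by move: sK; rewrite EK size_cat /=; lia.
  rewrite -mj; apply: trav_weaken tr => //.
  by apply: le_trans ts; exact: trav_le tr1.
move=> [K1 [[w m] [K2 [[w' m'] [K3 [EK /= mm]]]]]].
move: tr; rewrite EK => /trav_cat[m0 [s0 [tr1 [iw im [s [ts cl]]]]]].
move=> /trav_cat[m1 [s1 [tr2 [_ _ [s' [ts' _ tr3]]]]]].
apply: (IH (K1 ++ (w, m) :: K3)) => //.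
  by move: sK; rewrite EK !size_cat /= size_cat /=; lia.
apply/trav_cat; exists m0, s0; split=> //; split=> //; exists s; split=> //.
rewrite mm; apply: trav_weaken tr3 => //.
by apply: le_trans ts'; exact: trav_le tr2.
Qed.

(** Finiteness yields one crossing sequence for all slacks; only then can its times converge. *)
Lemma cert_closed eps j l : 0 <= eps ->
  (forall e, 0 < e -> cert p q (eps + e) j l) -> cert p q eps j l.
Proof.
move=> eps0 H.
have [e e0|e e' K e0 ee' tr|K HK] := @finite_pigeonhole {bseq (ne G) of (V * E)}
    (fun e (K : {bseq (ne G) of (V * E)}) => trav p q (eps + e) K j 0 l 1).
- have [K tr] := H e e0.
  have ee : 0 <= eps + e by lra.
  have [K' tr' u] := trav_uniq ee tr.
  have sK : (size K' <= ne G)%N.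
    have /= := uniq_leq_size (s2 := enum 'I_(ne G)) u (fun x _ => mem_enum (mem 'I_(ne G)) x).
    by rewrite size_enum_ord size_map; exact: ltnW.
  by exists (Bseq sK).
- apply: trav_weaken tr => //; lra.
- exists K; apply: trav_closed => // e e0; apply: trav_weaken (HK e e0) => //; lra.
Qed.

(** A retraction onto [0, 1], which extends maps that are continuous within the interval to the
    line. *)
Definition clamp t := Order.max 0 (Order.min 1 t).

Lemma clampE t : 0 <= t <= 1 -> clamp t = t.
Proof. by move=> /andP[t0 t1]; rewrite /clamp min_r // max_r. Qed.

Lemma clamp01 t : 0 <= clamp t <= 1.
Proof. by rewrite /clamp le_max lexx /= ge_max ler01 ge_min lexx. Qed.

Lemma cont_clamp : continuous clamp.
Proof.
move=> r; apply: (@continuous_max R R (fun=> 0) (fun r => Order.min 1 r)); first exact: cvg_cst.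
apply: (@continuous_min R R (fun=> 1) id); first exact: cvg_cst.
exact: cvg_id.
Qed.

Lemma within_clamp (T : topologicalType) (f : R -> T) :
  {within `[0, 1], continuous f} -> continuous (fun t => f (clamp t)).
Proof.
move=> /subspace_continuousP H t B.
have c01 : `[0, 1]%classic (clamp t) by rewrite /= in_itv /= clamp01.
move=> /(H _ c01) hB.
have h : nbhs t [set x | `[0, 1]%classic (clamp x) -> B (f (clamp x))] := @cont_clamp t _ hB.
apply: filterS h => x; apply.
by rewrite /= in_itv /= clamp01.
Qed.

Lemma edge_other j w : inc j w -> exists z,
  [/\ z != w, forall m, inc m w -> inc m z -> m = j &
      forall x : pt, edge_set G j x -> x 0 w + x 0 z = 1].
Proof.
have ab := ends_loopless j.
have two (a b : V) m : a != b -> inc m a -> inc m b -> ends m = (a, b) \/ ends m = (b, a).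
  rewrite /inc; case: (ends m) => a' b' /= ab' /orP[]/eqP Ea /orP[]/eqP Eb; move: ab';
    rewrite Ea Eb ?eqxx //; [by left|by right].
move=> /orP[]/eqP ->.
  exists (ends j).2; split; first by rewrite eq_sym.
    move=> m m1 m2; apply: ends_simple.
    by have [->|->] := two _ _ _ ab m1 m2; [left; case: (ends j)| right].
  by move=> x /edge_setP[_ + _].
exists (ends j).1; split=> //.
  move=> m m1 m2; apply: ends_simple.
  by have [->|->] := two _ _ _ ab m2 m1; [left; case: (ends j)| right].
by move=> x /edge_setP[_ + _]; rewrite addrC.
Qed.

(** Continuous induction on time. Locally the path stays in the star of some vertex [w], where it
    can change edges only by passing through [w]. *)
Lemma cert_of_matched eps (Q : R -> pt) j l : 0 <= eps ->
  continuous Q -> (forall t, 0 <= t <= 1 -> realization G (Q t)) ->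
  (forall t, 0 <= t <= 1 -> fclose p q eps t (locate (Q t : gpoint G))) ->
  edge_set G j (Q 0) -> edge_set G l (Q 1) -> cert p q eps j l.
Proof.
move=> eps0 cQ rQ clQ jQ lQ.
(* All edges through [Q t] are included, so the property does not depend on a choice of edge when
   [Q t] is a vertex. *)
pose good t := forall m, edge_set G m (Q t) -> exists K, trav p q eps K j 0 m t.
suff /(_ _ lQ)[K tr] : good 1 by exists K.
have good0 : good 0.
  move=> m mQ; have [->|mj] := eqVneq m j; first by exists [::].
  have [w [Qw mw jw]] := edge_meet mj mQ jQ.
  exists [:: (w, m)]; split=> //; exists 0; split=> //.
  by rewrite -locate_vtx -Qw; apply: clQ; rewrite lexx ler01.
have step s0 : 0 <= s0 <= 1 -> exists2 r, 0 < r &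
    forall s t, `|s - s0| < r -> `|t - s0| < r -> 0 <= s -> s <= t -> t <= 1 -> good s -> good t.
  move=> s01; have [m0 _ /edge_setP[x0 x1 _]] := rQ s0 s01.
  have [w w0] : exists w, 0 < Q s0 0 w.
    have [h|h] := ltP 0 (Q s0 0 (ends m0).1); first by exists (ends m0).1.
    exists (ends m0).2; lra.
  have cw z : continuous (fun t => Q t 0 z).
    move=> t; apply: (@cvg_comp _ _ _ Q (fun x : pt => x 0 z)); first exact: cQ.
    exact: coord_continuous.
  have /cvgrPdist_lt/(_ _ w0)[r /= r0 Hr] := cw w s0.
  exists r => // s t sr tr s_ge0 st t1 gs m mQ.
  have Hw x : `|x - s0| < r -> 0 < Q x 0 w.
    move=> xr; have /= := Hr x; rewrite -normrN opprB => /(_ xr); rewrite ltr_norml => /andP[_]; lra.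
  have Hmid x : s <= x <= t -> `|x - s0| < r.
    move: sr tr; rewrite !ltr_norml => /andP[a1 a2] /andP[b1 b2] /andP[c1 c2]; apply/andP; split; lra.
  have s01' : 0 <= s <= 1 by rewrite s_ge0 (le_trans st).
  have [l0 _ l0Q] := rQ s s01'.
  have [K trK] := gs _ l0Q.
  have l0w := edge_coord_inc l0Q (Hw s sr).
  have mw := edge_coord_inc mQ (Hw t tr).
  have [El|lm] := eqVneq m l0.
    by exists K; rewrite El; apply: trav_weaken trK.
  have [z [zw uz sum1]] := edge_other l0w.
  have Qtz : Q t 0 z = 0.
    have /edge_setP[_ _ ->//] := mQ; apply: contra_neqN lm => mz; exact: uz.
  (* On [l0], [h] is the coordinate of [z]; on the other edges at [w] it is the coordinate of [w]
     minus 1. Hence it changes sign between [s] and [t], and between them it vanishes only at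
     [w]. *)
  pose h x := 2 * Q x 0 z + Q x 0 w - 1.
  have hs : 0 <= h s.
    have := sum1 _ l0Q; have /edge_setP[/(_ z) + _ _] := l0Q; rewrite /h; lra.
  have ht : h t <= 0 by have := edge_coord_le1 w mQ; rewrite /h Qtz; lra.
  have ch : {within `[s, t], continuous h}.
    apply: continuous_subspaceT => x; apply: cvgB; last exact: cvg_cst.
    by apply: cvgD; [apply: cvgMr|]; exact: cw.
  have [|c] := IVT st ch (v := 0).
    by rewrite ge_min le_max hs ht orbT.
  rewrite in_itv /= => cst hc.
  have c01 : 0 <= c <= 1 by move: cst => /andP[c1 c2]; apply/andP; split; lra.
  have [m1 _ m1Q] := rQ c c01.
  have m1w := edge_coord_inc m1Q (Hw c (Hmid c cst)).
  have Qc : Q c = vtx w.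
    apply: (edge_coord1 m1Q).
    have [m1z|m1z] := boolP (inc m1 z).
      have Em := uz _ m1w m1z; rewrite Em in m1Q.
      have := sum1 _ m1Q; move: hc; rewrite /h; lra.
    by have /edge_setP[_ _ /(_ z m1z)] := m1Q; move: hc; rewrite /h; lra.
  move: cst => /andP[sc ct].
  exists (K ++ [:: (w, m)]); apply/trav_cat; exists l0, s; split=> //.
  split=> //; exists c; split=> //.
  by rewrite -locate_vtx -Qc; apply: clQ.
(* Near its supremum [S] extends to the right by [r / 2]; this is impossible unless time 1 is
   already within that distance, where [good] carries over to it. *)
pose S := [set t | 0 <= t <= 1 /\ good t].
have S0 : S 0 by split; rewrite ?lexx ?ler01.
have hS : has_sup S by split; [exists 0 | exists 1 => t [/andP[]]].
have s0_ge0 : 0 <= sup S by apply: sup_upper_bound.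
have s0_le1 : sup S <= 1 by apply: sup_le_ub; [exists 0 | move=> t [/andP[]]].
have [|r r0 Hr] := step (sup S); first by rewrite s0_ge0.
have [s [/andP[s_ge0 s1] gs] sr] := sup_adherent r0 hS.
have ss : s <= sup S by apply: sup_upper_bound => //; split=> //; rewrite s_ge0.
have half : 0 < r / 2 by lra.
have [le1|gt1] := leP 1 (sup S + r / 2).
  apply: (Hr s 1) => //; first by rewrite ltr_norml; apply/andP; split; lra.
  by rewrite ltr_norml; apply/andP; split; lra.
have St : S (sup S + r / 2).
  split; first by apply/andP; split; lra.
  apply: (Hr s) => //; [| |lra|lra]; rewrite ltr_norml; apply/andP; split; lra.
have := sup_upper_bound hS St; lra.
Qed.

Lemma homeo_ends (sg : R -> R) : orientation_homeo sg ->
  [/\ forall t, 0 <= t <= 1 -> 0 <= sg t <= 1, sg 0 = 0 & sg 1 = 1].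
Proof.
move=> [[sf si ss] sc sm].
have sg01 t : 0 <= t <= 1 -> 0 <= sg t <= 1.
  by move=> t01; have := sf t; rewrite /= !in_itv /=; apply.
have o01 : ((0 : R) <= 0) && ((0 : R) <= 1) by rewrite lexx ler01.
have i01 : ((0 : R) <= 1) && ((1 : R) <= 1) by rewrite lexx ler01.
split=> //.
  have [|t + t0] := ss 0; first by rewrite /= in_itv.
  rewrite /= in_itv /= => t01; have [Et|tn0] := eqVneq t 0; first by rewrite -{1}Et.
  have := sm 0 t; rewrite !in_itv /= t0 => /(_ o01 t01).
  have /andP[t_ge0 _] := t01; rewrite lt_neqAle eq_sym tn0 t_ge0 => /(_ isT).
  by have /andP[/le_gtF ->] := sg01 0 o01.
have [|t + t1] := ss 1; first by rewrite /= in_itv.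
rewrite /= in_itv /= => t01; have [Et|tn1] := eqVneq t 1; first by rewrite -{1}Et.
have := sm t 1; rewrite !in_itv /= t1 => /(_ t01 i01).
have /andP[_ t_le1] := t01; rewrite lt_neqAle tn1 t_le1 => /(_ isT).
by have /andP[_ /le_gtF ->] := sg01 1 i01.
Qed.

(** Composition with a near-optimal homeomorphism reduces to the identity matching, for each larger
    radius; [cert_closed] removes the slack. *)
Lemma cert_of_path eps (P : R -> gpoint G) j l : 0 <= eps -> is_path P ->
  (frechet (segment p q) (fun t => locate (P t)) <= eps%:E)%E ->
  edge_set G j (P 0) -> edge_set G l (P 1) -> cert p q eps j l.
Proof.
move=> eps0 [Pc Pr] /frechetP-/(_ eps0) F jP lP.
apply: cert_closed => // e e0.
have [sg sgh H] := F (eps + e) ltac:(lra).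
have [_ sc _] := sgh; have [sg01 sg0 sg1] := homeo_ends sgh.
pose Q t : pt := P (clamp (sg (clamp t))).
have QE t : 0 <= t <= 1 -> Q t = P (sg t).
  by move=> t01; rewrite /Q (clampE t01) clampE // sg01.
apply: (@cert_of_matched _ Q) => //; first lra.
- move=> t; apply: (@cvg_comp _ _ _ (fun t => sg (clamp t)) (fun t => P (clamp t) : pt)).
    exact: within_clamp sc t.
  exact: within_clamp Pc _.
- by move=> t t01; rewrite QE //; apply: Pr; rewrite in_itv /= sg01.
- by move=> t t01; rewrite QE //; exact: H.
- by rewrite QE ?lexx ?ler01 // sg0.
- by rewrite QE ?lexx ?ler01 // sg1.
Qed.

End CertOfPath.

(** * Placements as classes of edges *)

Section Components.
Context {R : realType} {d : nat} (G : embgraph R d) (c : 'rV[R]_d) (eps : R).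
Local Notation E := 'I_(ne G).
Local Notation V := 'I_(nv G).
Local Notation pt := 'rV[R]_(nv G).
Implicit Types (j l m : E) (w : V) (x y z : pt).

Definition inside x := nsq (locate (x : gpoint G) - c) <= eps ^+ 2.
Definition ball_part : set pt := [set x | realization G x /\ inside x].
Definition hits j := exists2 x, edge_set G j x & inside x.
Definition linked : rel E := fun j l =>
  [exists w, [&& inc j w, inc l w & nsq (pos w - c) <= eps ^+ 2]].

Lemma linkedP j l : reflect (exists w, [/\ inc j w, inc l w & nsq (pos w - c) <= eps ^+ 2]) (linked j l).
Proof. by apply: (iffP existsP) => -[w] => [/and3P[]|[? ? ?]]; exists w => //; apply/and3P. Qed.

Lemma linked_sym : symmetric linked.
Proof. by move=> j l; apply/linkedP/linkedP => -[w [? ? ?]]; exists w. Qed.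

Lemma inside_segment x y s : 0 <= s <= 1 -> inside x -> inside y -> inside (segment x y s).
Proof.
move=> s01 ix iy; rewrite /inside locate_segment.
have -> : segment (locate (x : gpoint G)) (locate (y : gpoint G)) s - c =
  (1 - s) *: (locate (x : gpoint G) - c) + s *: (locate (y : gpoint G) - c).
  by rewrite /segment; apply/rowP => i; rewrite !mxE; ring.
exact: nsq_conv_le.
Qed.

Lemma inside_vtx w : inside (vtx w) = (nsq (pos w - c) <= eps ^+ 2).
Proof. by rewrite /inside locate_vtx. Qed.

Lemma same_edge_component j x y : edge_set G j x -> edge_set G j y -> inside x -> inside y ->
  connected_component ball_part x y.
Proof.
move=> jx jy ix iy.
have S1 : connected [set segment x y s | s in `[0, 1]].
  apply: connected_continuous_connected; first exact: segment_connected.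
  by apply: continuous_subspaceT; exact: cont_segment.
have h1 : [set segment x y s | s in `[0, 1]] x.
  by exists 0; rewrite ?segment0 //= in_itv /= lexx ler01.
have h2 : [set segment x y s | s in `[0, 1]] `<=` ball_part.
  move=> z [s]; rewrite /= in_itv /= => s01 <-; split; last exact: inside_segment.
  by exists j => //; exact: edge_set_segment.
apply: (connected_component_max h1 h2 S1).
by exists 1; rewrite ?segment1 //= in_itv /= lexx ler01.
Qed.

Lemma cont_locate : continuous (fun x : pt => locate (x : gpoint G)).
Proof.
move=> x; refine (@cvg_big _ _ _ _ _ add_continuous _ (nbhs x) _
  (fun i (y : pt) => y 0 i *: pos i) (fun i => x 0 i *: pos i) _ _) => i _.
have h : (fun y : pt => y 0 i) y @[y --> x] --> x 0 i by exact: coord_continuous.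
exact: cvgZr_tmp.
Qed.

Lemma closed_inside : closed [set x | inside x].
Proof.
have h : continuous (fun x : pt => nsq (locate (x : gpoint G) - c)).
  move=> x.
  have h1 : (fun y : pt => locate (y : gpoint G) - c) y @[y --> x] --> locate (x : gpoint G) - c.
    by refine (@cvgB _ _ _ (nbhs x) _ _ _ _ _ (@cont_locate x) (cvg_cst _)).
  refine (@cvg_comp _ _ _ (fun y : pt => locate (y : gpoint G) - c) (@nsq R d) _ _ _ h1 _).
  exact: cont_nsq.
apply: (@closed_comp _ _ _ [set y | y <= eps ^+ 2]); last exact: closed_le.
by move=> x _; exact: h.
Qed.

Lemma closed_edge j : closed (edge_set G j : set pt).
Proof.
apply: compact_closed; first exact: norm_hausdorff.
apply: continuous_compact; last exact: segment_compact.
by apply: continuous_subspaceT => t; exact: (@cont_segment R (nv G) (vtx (ends j).1) (vtx (ends j).2)).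
Qed.

(** The part of the ball on edges connected to [j] and the part on the other edges are finite unions
    of closed sets, and disjoint by [edge_meet]. Thus no component meets both. *)
Lemma component_connect j l x y : edge_set G j x -> edge_set G l y -> inside x -> inside y ->
  connected_component ball_part x y <-> connect linked j l.
Proof.
move=> jx ly ix iy; split; last first.
  move=> /connectP[u]; elim: u j x jx ix => [|m u IH] j x jx ix /=.
    by move=> _ El; move: ly; rewrite El => jy; exact: same_edge_component jx jy ix iy.
  move=> /andP[/linkedP[w [jw mw cw]] pu] El.
  have iw : inside (vtx w) by rewrite inside_vtx.
  apply: connected_component_trans (same_edge_component jx (iffRL (vtx_edge _ _) jw) ix iw) _.
  exact: IH (iffRL (vtx_edge _ _) mw) iw pu El.
move=> xy.
pose part (b : bool) : set pt :=
  [set z | inside z] `&` \bigcup_(m in [set m | connect linked j m = b]) edge_set G m.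
have cpart b : closed (part b).
  apply: closedI; first exact: closed_inside.
  by apply: closed_bigcup => [|m _]; [exact: finite_finset | exact: closed_edge].
have meetc m m' z : edge_set G m z -> edge_set G m' z -> inside z -> connect linked m m'.
  move=> mz m'z iz; have [<-//|mm'] := eqVneq m m'.
  have [w [zw mw m'w]] := edge_meet mm' mz m'z.
  by apply: connect1; apply/linkedP; exists w; split; rewrite -?inside_vtx -?zw.
pose A := connected_component ball_part x.
have AB : A `<=` ball_part by exact: connected_component_sub.
have Ax : A x by apply: connected_component_refl; split=> //; exists j.
have px : part true x by split=> //; exists j => //=; rewrite connect0.
have : A `&` part true = A.
  apply: (@component_connected _ ball_part x).
  - by exists x.
  - exists (~` part false); first exact: closed_openC.
    apply/seteqP; split=> z [Az pz]; split=> //.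
      case: pz => iz [m jm mz] [_ [m' jm' m'z]]; move: jm jm' => /= jm.
      by rewrite (connect_trans jm (meetc _ _ _ mz m'z iz)).
    have [[m _ mz] iz] := AB z Az.
    case jm: (connect linked j m); first by split=> //; exists m.
    by exfalso; apply: pz; split=> //; exists m.
  - by exists (part true).
move=> /seteqP[_ /(_ y xy)[_ [_ [m /= jm my]]]].
exact: connect_trans jm (meetc _ _ _ my ly iy).
Qed.

(* Label 0 marks the edges outside the ball, label k + 1 those of the k-th component. *)
Record labelling (lab : E -> nat) (cnt : nat) : Prop := {
  lab_hits : forall j, (0 < lab j)%N <-> hits j;
  lab_le : forall j, (lab j <= cnt)%N;
  lab_onto : forall k, (k < cnt)%N -> exists j, lab j = k.+1;
  lab_linked : forall j l, hits j -> hits l -> lab j = lab l <-> connect linked j l }.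

Definition class_set (lab : E -> nat) k : set pt :=
  [set x | inside x /\ exists2 j, edge_set G j x & lab j = k.+1].

Lemma class_component lab cnt j x : labelling lab cnt -> edge_set G j x -> inside x ->
  connected_component ball_part x = class_set lab (lab j).-1.
Proof.
move=> L jx ix; have hj : hits j by exists x.
have j0 : (0 < lab j)%N by apply/(lab_hits L).
apply/seteqP; split=> y.
  move=> xy; have [[l _ ly] iy] := connected_component_sub xy.
  split=> //; exists l => //; rewrite prednK //; apply/esym/(lab_linked L) => //; first by exists y.
  by apply/(component_connect jx ly ix iy).
move=> [iy [l ly]]; rewrite prednK // => El.
apply/(component_connect jx ly ix iy)/(lab_linked L) => //; by exists y.
Qed.

Lemma class_meets lab cnt k j : labelling lab cnt ->
  lab j = k.+1 <-> class_set lab k `&` edge_set G j !=set0.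
Proof.
move=> L; split=> [jk|[x [[ix [l lx lk]] jx]]].
  have [x jx ix] : hits j by apply/(lab_hits L); rewrite jk.
  by exists x; split=> //; split=> //; exists j.
rewrite -lk; apply/(lab_linked L); [by exists x|by exists x|].
apply/(component_connect jx lx ix ix); apply: connected_component_refl.
by split=> //; exists j.
Qed.

Lemma class_bij lab cnt : labelling lab cnt ->
  set_bij `I_cnt [set connected_component ball_part x | x in ball_part] (class_set lab).
Proof.
move=> L; split.
- move=> k kc; have [j jk] := lab_onto L kc.
  have [x jx ix] : hits j by apply/(lab_hits L); rewrite jk.
  by exists x; [split=> //; exists j | rewrite (class_component L jx ix) jk].
- move=> k l; rewrite !inE => kc lc E; have [j jk] := lab_onto L kc.
  have /(class_meets k j L) := jk; rewrite E => /(class_meets l j L).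
  by rewrite jk => -[].
- move=> _ [x [[j _ jx] ix] <-]; exists (lab j).-1; last by rewrite (class_component L jx ix).
  have j0 : (0 < lab j)%N by apply/(lab_hits L); exists x.
  by rewrite /= prednK //; exact: lab_le L j.
Qed.

(** Each class contains an edge. Therefore the stride [ne G] suffices in arrays indexed by
    placements. *)
Lemma cnt_le lab cnt : labelling lab cnt -> (cnt <= ne G)%N.
Proof.
move=> L; rewrite -{1}(card_ord cnt) -[ne G]card_ord.
have /choice[f fP] : forall k : 'I_cnt, exists j, lab j = k.+1.
  by move=> k; exact: (lab_onto L (ltn_ord k)).
apply: (leq_card f) => k l E; apply: val_inj.
by have := fP k; rewrite E fP => -[].
Qed.

End Components.

(** * Reversal, change of end edges and limits of certificates *)

Section CertExtra.
Context {R : realType} {d : nat} {G : embgraph R d}.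
Local Notation E := 'I_(ne G).
Implicit Types (p q c : 'rV[R]_d) (eps t : R) (j l : E).

Lemma segment_rev n (p q : 'rV[R]_n) t : segment q p (1 - t) = segment p q t.
Proof. by rewrite /segment subKr addrC. Qed.

Lemma trav_rev p q eps K j t l t' : trav p q eps K j t l t' ->
  exists K', trav q p eps K' l (1 - t') j (1 - t).
Proof.
elim: K j t => [|[w m] K IH] j t /=.
  by move=> [-> tt']; exists [::]; split=> //; rewrite lerD2l lerN2.
move=> [jw mw [s [ts cl /IH[K' tr]]]].
exists (K' ++ [:: (w, j)]); apply/trav_cat; exists m, (1 - s); split=> //.
split=> //; exists (1 - s); split=> //; first by rewrite /fclose segment_rev.
by split=> //; rewrite lerD2l lerN2.
Qed.

Lemma cert_rev p q eps j l : cert p q eps j l -> cert q p eps l j.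
Proof. by move=> [K /trav_rev]; rewrite subr0 subrr. Qed.

(** Moving inside a placement takes no time: the additional crossings happen at time 0, when the
    moving point is the centre of the ball. Hence certificates depend only on the classes of their
    end edges. *)
Lemma cert_linked_l p q eps j0 j l : 0 <= eps -> connect (linked p eps) j0 j ->
  cert p q eps j l -> cert p q eps j0 l.
Proof.
move=> e0 /connectP[u]; elim: u j0 => [|m u IH] j0 /=; first by move=> _ <-.
move=> /andP[/linkedP[w [jw mw cw]] pu] Ej /(IH _ pu Ej)[K tr].
exists ((w, m) :: K); split=> //; exists 0; split=> //.
by rewrite /fclose segment0 -nsqN opprB.
Qed.

Lemma cert_linked_r p q eps j l0 l : 0 <= eps -> connect (linked q eps) l l0 ->
  cert p q eps j l -> cert p q eps j l0.
Proof.
move=> e0 ll /cert_rev tr; apply: cert_rev; apply: cert_linked_l tr => //.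
by rewrite (sym_connect_sym (linked_sym _ _)).
Qed.

Lemma cert_weaken p q eps eps' j l : 0 <= eps -> eps <= eps' -> cert p q eps j l -> cert p q eps' j l.
Proof. by move=> e0 ee [K tr]; exists K; exact: trav_weaken tr. Qed.

(** This is the condition for a time window with the two graphs exchanged, so that one program
    fragment, [window], computes both. *)
Lemma hitsP c eps j : hits c eps j <->
  exists2 t, 0 <= t <= 1 & fclose (pos (ends j).1) (pos (ends j).2) eps t c.
Proof.
split=> [[x [t]]|[t t01 cl]].
  rewrite /= in_itv /= => t01 <- ix; exists t => //; move: ix.
  rewrite -/(vtx (ends j).1) -/(vtx (ends j).2) -/(segment (vtx _) (vtx _) t).
  by rewrite /inside locate_segment !locate_vtx.
exists (segment (vtx (ends j).1) (vtx (ends j).2) t); first by exists t => //=; rewrite in_itv.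
by rewrite /inside locate_segment !locate_vtx.
Qed.

Lemma hits_weaken c eps eps' j : 0 <= eps -> eps <= eps' -> hits c eps j -> hits c eps' j.
Proof.
move=> e0 ee [x jx ix]; exists x => //; apply: le_trans ix _.
by rewrite ler_pXn2r ?nnegrE // (le_trans e0).
Qed.

Lemma hits_closed c eps j : 0 <= eps -> (forall e, 0 < e -> hits c (eps + e) j) -> hits c eps j.
Proof.
move=> e0 H.
have [e e_gt0|t [t01 Ht]] := @cluster_point R 0 1
    (fun e t => fclose (pos (ends j).1) (pos (ends j).2) (eps + e) t c).
  by have /hitsP[t t01 cl] := H e e_gt0; exists t.
by apply/hitsP; exists t => //; exact: fclose_closed.
Qed.

End CertExtra.

(** * The graph distance through assignments of edges *)

Section Distance.
Context {R : realType} {d : nat} (G1 G2 : embgraph R d) (eps : R).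
Context (eps0 : 0 < eps).
Implicit Types (u v : 'I_(nv G1)).

(* An assignment of an edge of G2 to every vertex of G1 from which a graph mapping of cost
   at most [eps] can be built. *)
Definition feasible eps (js : 'I_(nv G1) -> 'I_(ne G2)) : Prop :=
  (forall v, hits (pos v) eps (js v)) /\
  (forall e, cert (pos (ends e).1) (pos (ends e).2) eps (js (ends e).1) (js (ends e).2)).

(** One point is chosen on the edge of each vertex; [path_of_cert] then joins these points, whatever
    they are, so the paths at a vertex fit together. *)
Lemma dist_of_feasible js : feasible eps js -> (graph_dist G1 G2 <= eps%:E)%E.
Proof.
move=> [H1 H2].
have /choice[x xP] : forall v, exists x, edge_set G2 (js v) x /\ inside (G := G2) (pos v) eps x.
  by move=> v; have [x jx ix] := H1 v; exists x.
have /choice[P PP] : forall e, exists P : R -> gpoint G2,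
    [/\ is_simple_path P, P 0 = x (ends e).1, P 1 = x (ends e).2 &
    (edge_cost e P <= eps%:E)%E].
  move=> e; apply: (path_of_cert eps0 (H2 e)).
  - exact: (xP _).1. - exact: (xP _).1. - exact: (xP _).2. - exact: (xP _).2.
have vP v : realization G2 (x v) by exists (js v) => //; exact: (xP v).1.
have eP e : [/\ is_simple_path (P e), P e 0 = x (ends e).1 & P e 1 = x (ends e).2].
  by have [] := PP e.
apply: (@le_trans _ _ (\big[maxe/-oo%E]_(e < ne G1) edge_cost e (P e))).
  by apply: ereal_inf_lbound; exists (GraphMap vP eP).
elim/big_ind: _ => [|a b ha hb|e _]; first exact: leNye.
  by rewrite ge_max ha.
by have [] := PP e.
Qed.

(** Every slack has its own near-optimal mapping, but there are only finitely many assignments of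
    edges, so one serves all slacks; closedness of both conditions finishes. *)
Lemma feasible_of_dist : (0 < ne G1)%N -> graph_connected G1 ->
  (graph_dist G1 G2 <= eps%:E)%E -> exists js, feasible eps js.
Proof.
move=> m1 conn D.
have [e e0|e e' js e_gt0 ee' [h1 h2]|js H] := @finite_pigeonhole R
   {ffun 'I_(nv G1) -> 'I_(ne G2)} (fun (e : R) (js : {ffun 'I_(nv G1) -> 'I_(ne G2)}) => feasible (eps + e) js).
(* Half of the slack is spent on a near-optimal mapping, the other half on a near-optimal matching
   of an edge. *)
- have ee1 : 0 <= eps + e / 2 by rewrite ltW // addr_gt0 // divr_gt0.
  have ee3 : eps + e / 2 < eps + e by rewrite ltrD2l ltr_pdivrMr // ltr_pMr // ltr1n.
  have ee2 := ltW ee3.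
  have : (graph_dist G1 G2 < (eps + e / 2)%:E)%E by apply: le_lt_trans D _; rewrite lte_fin ltrDl divr_gt0.
  move=> /ereal_inf_lt[_ [s _ <-] lt].
  have cost f : (edge_cost f (on_edge s f) <= (eps + e / 2)%:E)%E.
    apply: le_trans (ltW lt); rewrite (bigD1 f) //= le_max lexx //.
  have /choice[g gP] : forall v, exists j, edge_set G2 j (on_vertex s v).
    by move=> v; have [j _ jx] := on_vertexP s v; exists j.
  exists (finfun g); split=> [v|f]; last first.
    rewrite !ffunE; have [[sp _] f0 f1] := on_edgeP s f.
    apply: (@cert_weaken _ _ _ _ _ (eps + e / 2)) => //.
    apply: (cert_of_path _ sp (cost f)); rewrite ?f0 ?f1 //; exact: gP.
  rewrite ffunE; exists (on_vertex s v); first exact: gP.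
  (* That the image of [v] is close to [v] is read off at an end of an incident edge of G1. *)
  have [f fv] : exists f, v = (ends f).1 \/ v = (ends f).2.
    have [u vu] : exists u, u != v.
      pose f0 := Ordinal m1; have ab := ends_loopless f0.
      have [E|E] := eqVneq (ends f0).1 v; last by exists (ends f0).1.
      by exists (ends f0).2; rewrite eq_sym -E.
    have /connectP[[|w p] /=] := conn v u; first by move=> _ E; rewrite E eqxx in vu.
    move=> /andP[/existsP[f /orP[]/eqP E] _] _; exists f; rewrite E; [by left|by right].
  have [_ f0 f1] := on_edgeP s f.
  have /frechetP := cost f; move=> /(_ ee1 (eps + e) ee3)[sg sgh Hsg].
  have [_ s0 s1] := homeo_ends sgh; rewrite /inside -nsqN opprB.
  case: fv => ->.
    by have := Hsg 0; rewrite s0 f0 segment0 lexx ler01; apply.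
  by have := Hsg 1; rewrite s1 f1 segment1 lexx ler01; apply.
- have ee1 : 0 <= eps + e by rewrite ltW // addr_gt0.
  have ee2 : eps + e <= eps + e' by rewrite lerD2l.
  by split=> [v|f]; [apply: hits_weaken (h1 v)|apply: cert_weaken (h2 f)].
- exists js; split=> [v|f].
    by apply: hits_closed => [|e e0]; [exact: ltW|have [] := H e e0].
  by apply: cert_closed => [|e e0]; [exact: ltW|have [] := H e e0].
Qed.

Lemma in_ballE v : in_ball G2 eps v = ball_part (pos v) eps :> set 'rV[R]_(nv G2).
Proof.
apply/seteqP; split=> x [rx ix]; split=> //.
  by move: ix; rewrite enorm_le // ltW.
by rewrite enorm_le // ltW.
Qed.

Lemma reachableP (labu labv : 'I_(ne G2) -> nat) cu cv u v k l :
  labelling (pos u) eps labu cu -> labelling (pos v) eps labv cv ->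
  reachable eps u v (class_set (G := G2) (pos u) eps labu k) (class_set (G := G2) (pos v) eps labv l) <->
  exists i j, [/\ labu i = k.+1, labv j = l.+1 & cert (pos u) (pos v) eps i j].
Proof.
move=> Lu Lv; split.
  move=> [P [Pp [_ [i iP ik]] [_ [j jP jl]] F]]; exists i, j; split=> //.
  by apply: (cert_of_path _ Pp F) => //; exact: ltW.
move=> [i [j [ik jl ce]]].
have [x ix hx] : hits (pos u) eps i by apply/(lab_hits Lu); rewrite ik.
have [y jy hy] : hits (pos v) eps j by apply/(lab_hits Lv); rewrite jl.
have [P [[Pp _] P0 P1 F]] := path_of_cert eps0 ce ix jy hx hy.
exists P; split=> //.
  by rewrite P0; split=> //; exists i.
by rewrite P1; split=> //; exists j.
Qed.

(** Certificates can be reversed in time; searching each edge of G1 in one direction is enough. *)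
Lemma reachable_sym labu labv cu cv u v k l :
  labelling (pos u) eps labu cu -> labelling (pos v) eps labv cv ->
  reachable eps u v (class_set (G := G2) (pos u) eps labu k) (class_set (G := G2) (pos v) eps labv l) ->
  reachable eps v u (class_set (G := G2) (pos v) eps labv l) (class_set (G := G2) (pos u) eps labu k).
Proof.
move=> Lu Lv /(reachableP _ _ Lu Lv)[i [j [ik jl ce]]].
by apply/(reachableP _ _ Lv Lu); exists j, i; split=> //; exact: cert_rev.
Qed.

End Distance.

(** * Time-ordered graph search *)

Section SearchTheory.
Context {R : realType}.
Implicit Types (Q re pe pa f : nat -> nat).

Definition upd (T : Type) (f : nat -> T) k v : nat -> T := fun j => if j == k then v else f j.

Lemma updE T (f : nat -> T) k v : upd f k v k = v. Proof. by rewrite /upd eqxx. Qed.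
Lemma updN T (f : nat -> T) k v j : j != k -> upd f k v j = f j.
Proof. by rewrite /upd => /negbTE ->. Qed.

(* [h] points into linked list [nx]; pointers are shifted by one, 0 being the null pointer. *)
Fixpoint llist (nx : nat -> nat) (h : nat) (l : seq nat) : Prop :=
  match l with
  | [::] => h = 0%N
  | x :: l' => h = x.+1 /\ llist nx (nx x) l'
  end.

Lemma llist_nil nx l : llist nx 0 l -> l = [::].
Proof. by case: l => //= x l []. Qed.

Lemma llist_cons nx h l : llist nx h.+1 l -> exists l', l = h :: l' /\ llist nx (nx h) l'.
Proof. by case: l => //= x l [[<-] H]; exists l. Qed.

Context (n : nat) (L : nat -> seq nat) (nx hd tg : nat -> nat) (lo hi : nat -> R)
  (src : nat -> Prop) (ord : nat -> nat) (rooted : Prop).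

(* [VR z t]: some walk from a source reaches [z] at time [t], being at each of its vertices
   at a time of that vertex's window. *)
Inductive VR : nat -> R -> Prop :=
  | VR_src z t : (z < n)%N -> src z -> lo z <= t <= hi z -> VR z t
  | VR_step y z t t' h : VR y t -> h \in L y -> tg h = z -> t <= t' -> lo z <= t' <= hi z -> VR z t'.

(** The ways in which a half-edge from [y] to [z] is settled: [z] was reached no later than it can
    be through [y]; its window closes before [D y]; or it is marked and its window opens after
    [D y]. *)
Definition hfin Q qe pe (D : nat -> R) y z : Prop :=
  (z \in mkseq Q qe /\ (D z <= D y \/ D z <= lo z)) \/ hi z < D y \/ ((0 < pe z)%N /\ D y < lo z).

(** [Lc] holds the unscanned half-edges of the current vertex, starting at [cur]. Queue entries
    below [qs] have been taken out, those below [qe] are reached; [re], [pe], [pa] and [D] are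
    reached flags, marks, parent half-edges and arrival times, and [i] is the next position in the
    order by window openings. By [s_act] all waiting entries arrived at the current time [tau].
    [s_tree] is the additional content when the search builds a rooted tree. *)
Record sinv cur qs qe i Q re pe pa (D : nat -> R) (tau : R) (Lc : seq nat) : Prop := {
  s_q : [/\ (qs <= qe)%N, (i <= n)%N & uniq (mkseq Q qe)];
  s_lt : forall y, y \in mkseq Q qe -> (y < n)%N;
  s_re : forall y, (y < n)%N -> re y = (y \in mkseq Q qe) :> nat;
  s_cur : llist nx cur Lc;
  s_Lc : Lc <> [::] -> [/\ (0 < qs)%N, {subset Lc <= L (Q qs.-1)} & D (Q qs.-1) = tau];
  s_act : forall k, (qs <= k < qe)%N -> D (Q k) = tau;
  s_D : forall y, y \in mkseq Q qe -> lo y <= D y <= hi y /\ D y <= tau;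
  s_sound : forall y, y \in mkseq Q qe -> VR y (D y);
  s_pend : forall z, (z < n)%N -> (0 < pe z)%N ->
    src z \/ exists y h, [/\ y \in mkseq Q qe, h \in L y & tg h = z];
  s_done : forall k h, (k < qs)%N -> h \in L (Q k) ->
    (k = qs.-1 /\ h \in Lc) \/ hfin Q qe pe D (Q k) (tg h);
  s_src : forall z, (z < n)%N -> src z -> (0 < pe z)%N;
  s_back : forall z, (z < n)%N -> (0 < pe z)%N -> lo z <= hi z ->
    (z \in mkseq Q qe /\ D z <= lo z) \/ exists2 i', (i <= i' < n)%N & ord i' = z;
  s_ord : forall i', (i <= i' < n)%N -> (ord i' < n)%N /\ tau <= lo (ord i');
  s_sorted : forall i' i'', (i <= i' <= i'')%N -> (i'' < n)%N -> lo (ord i') <= lo (ord i'');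
  s_tau : forall z, (z < n)%N -> lo z <= tau \/ exists2 i', (i <= i' < n)%N & ord i' = z;
  s_tree : rooted -> i = n /\ forall k, (0 < k < qe)%N ->
    exists k', [/\ (k' < k)%N, pa (Q k) \in L (Q k') & tg (pa (Q k)) = Q k];
  s_pe1 : forall z, (z < n)%N -> (pe z <= 1)%N }.

(** Termination measure: window openings to come, half-edges left at the current vertex, and the
    scans of all vertices not yet taken from the queue. Initially it is linear in the size of the
    graph. *)
Definition smu qs i Q (Lc : seq nat) : nat :=
  ((n - i) + size Lc + \sum_(y <- iota 0 n | y \notin mkseq Q qs) (1 + size (L y)))%N.

Lemma mkseq_upd T (f : nat -> T) k v : mkseq (upd f k v) k.+1 = rcons (mkseq f k) v.
Proof.
rewrite /mkseq -addn1 iotaD map_cat cats1 /= updE; congr rcons.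
by apply/eq_in_map => j; rewrite mem_iota /= => jk; rewrite updN // ltn_eqF.
Qed.

Lemma mkseq_mem Q qe k : (k < qe)%N -> Q k \in mkseq Q qe.
Proof. by move=> kq; apply/mapP; exists k => //; rewrite mem_iota. Qed.

Lemma mkseq_memP Q qe y : y \in mkseq Q qe -> exists2 k, (k < qe)%N & y = Q k.
Proof. by move=> /mapP[k]; rewrite mem_iota => kq ->; exists k. Qed.

Context (hdL : forall y, (y < n)%N -> llist nx (hd y) (L y))
        (tgL : forall y h, (y < n)%N -> h \in L y -> (tg h < n)%N).

Lemma sinv_qe_le cur qs qe i Q re pe pa D tau Lc :
  sinv cur qs qe i Q re pe pa D tau Lc -> (qe <= n)%N.
Proof.
move=> S; have [_ _ u] := s_q S.
have /= := uniq_leq_size (s2 := iota 0 n) u; rewrite size_mkseq size_iota; apply => y /(s_lt S).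
by rewrite mem_iota.
Qed.

Lemma sinv_target h qs qe i Q re pe pa D tau Lc :
  sinv h.+1 qs qe i Q re pe pa D tau Lc -> (tg h < n)%N.
Proof.
move=> S; have [l' [E _]] := llist_cons (s_cur S).
have [|q0 sub _] := s_Lc S; first by rewrite E.
have [qq _ _] := s_q S.
apply: (@tgL (Q qs.-1)); last by apply: sub; rewrite E mem_head.
by apply: (s_lt S); apply: mkseq_mem; lia.
Qed.

(** A reached target was reached by time [tau], hence no later than through this half-edge, and a
    window that has closed stays closed. *)
Lemma sinv_skip h qs qe i Q re pe pa D tau Lc :
  sinv h.+1 qs qe i Q re pe pa D tau Lc ->
  (0 < re (tg h))%N \/ (lo (tg h) <= tau /\ hi (tg h) < tau) ->
  exists2 Lc', sinv (nx h) qs qe i Q re pe pa D tau Lc' &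
    (smu qs i Q Lc' < smu qs i Q Lc)%N.
Proof.
move=> S C; have [l' [E ll]] := llist_cons (s_cur S).
have tn := sinv_target S.
have [|q0 sub Dt] := s_Lc S; first by rewrite E.
exists l'; last by rewrite /smu E /=; lia.
case: S => Sq Slt Sre Scur SLc Sact SD Ssound Spend Sdone Ssrc Sback Sord Ssorted Stau Stree Spe1.
split=> //.
- by move=> _; split=> // x xl; apply: sub; rewrite E inE xl orbT.
- move=> k x kq xL; have [[kE]|] := Sdone k x kq xL; last by right.
  rewrite E inE => /predU1P[->|]; last by left.
  right; rewrite kE /hfin; case: C => [|[h1 h2]]; last by right; left; rewrite Dt.
  rewrite Sre // lt0b => tq; left; split=> //; left; rewrite Dt; exact: (SD _ tq).2.
Qed.

(** By [s_tau] a vertex whose window has not opened is still ahead in the order, so a mark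
    suffices. *)
Lemma sinv_wait h qs qe i Q re pe pa D tau Lc :
  sinv h.+1 qs qe i Q re pe pa D tau Lc -> tau < lo (tg h) ->
  exists2 Lc', sinv (nx h) qs qe i Q re (upd pe (tg h) 1%N) pa D tau Lc' &
    (smu qs i Q Lc' < smu qs i Q Lc)%N.
Proof.
move=> S C; have [l' [E ll]] := llist_cons (s_cur S).
have tn := sinv_target S.
have [|q0 sub Dt] := s_Lc S; first by rewrite E.
exists l'; last by rewrite /smu E /=; lia.
case: S => Sq Slt Sre Scur SLc Sact SD Ssound Spend Sdone Ssrc Sback Sord Ssorted Stau Stree Spe1.
have up z : (0 < pe z)%N -> (0 < upd pe (tg h) 1 z)%N.
  by rewrite /upd; case: eqP.
split=> //.
- by move=> _; split=> // x xl; apply: sub; rewrite E inE xl orbT.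
- move=> z zn; rewrite /upd; case: eqP => [-> _|_]; last exact: Spend.
  right; exists (Q qs.-1), h; split=> //; last by apply: sub; rewrite E mem_head.
  by apply: mkseq_mem; case: Sq; lia.
- move=> k x kq xL; have [[kE]|] := Sdone k x kq xL; last first.
    by move=> [|[|[/up ? ?]]]; right; [left|right; left|right; right].
  rewrite E inE => /predU1P[->|]; last by left.
  by right; rewrite kE; right; right; rewrite updE Dt.
- by move=> z zn /(Ssrc z zn)/up.
- move=> z zn; rewrite /upd; case: eqP => [-> _ _|_]; last exact: Sback.
  by right; have [|//] := Stau _ tn; rewrite leNgt C.
- by move=> z zn; rewrite /upd; case: eqP => // _; exact: Spe1.
Qed.

Lemma sinv_push h qs qe i Q re pe pa D tau Lc :
  sinv h.+1 qs qe i Q re pe pa D tau Lc -> re (tg h) = 0%N -> lo (tg h) <= tau <= hi (tg h) ->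
  exists2 Lc', sinv (nx h) qs qe.+1 i (upd Q qe (tg h)) (upd re (tg h) 1%N) pe (upd pa (tg h) h)
      (upd D (tg h) tau) tau Lc' &
    (smu qs i (upd Q qe (tg h)) Lc' < smu qs i Q Lc)%N.
Proof.
move=> S re0 C; have [l' [E ll]] := llist_cons (s_cur S).
have tn := sinv_target S.
have [|q0 sub Dt] := s_Lc S; first by rewrite E.
have := sinv_qe_le S => qen.
case: S => Sq Slt Sre Scur SLc Sact SD Ssound Spend Sdone Ssrc Sback Sord Ssorted Stau Stree Spe1.
have [qq iN uq] := Sq.
set z := tg h in tn re0 C *.
have zq : z \notin mkseq Q qe by move: (Sre z tn); rewrite re0; case: (z \in _).
have Qk k : (k < qe)%N -> upd Q qe z k = Q k by move=> kq; rewrite updN // ltn_eqF.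
have Dq y : y \in mkseq Q qe -> upd D z tau y = D y.
  by move=> yq; rewrite updN //; apply: contraNneq zq => <-.
have mq y : (y \in mkseq (upd Q qe z) qe.+1) = (y == z) || (y \in mkseq Q qe).
  by rewrite mkseq_upd mem_rcons inE.
have mqs : mkseq (upd Q qe z) qs = mkseq Q qs.
  by apply/eq_in_map => k; rewrite mem_iota /= => kq; rewrite Qk //; lia.
have yq : Q qs.-1 \in mkseq Q qe by apply: mkseq_mem; lia.
have VRz : VR z tau.
  apply: (VR_step (Ssound _ yq) (h := h)) => //; last by rewrite Dt.
  by apply: sub; rewrite E mem_head.
exists l'; last by rewrite /smu E /= mqs; lia.
split=> //.
- by split=> //; [lia | rewrite mkseq_upd rcons_uniq zq].
- by move=> y; rewrite mq => /predU1P[->//|]; exact: Slt.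
- move=> y yn; rewrite mq /upd; case: eqP => //= _; exact: Sre.
- move=> _; rewrite Qk ?Dq //; last by lia.
  by split=> // x xl; apply: sub; rewrite E inE xl orbT.
- move=> k /andP[k1 k2]; have [->|kq] := eqVneq k qe; first by rewrite updE updE.
  have kq' : (k < qe)%N by lia.
  by rewrite Qk // Dq ?mkseq_mem // Sact // k1.
- by move=> y; rewrite mq => /predU1P[->|yq']; [rewrite updE; split|rewrite Dq //; exact: SD].
- by move=> y; rewrite mq => /predU1P[->|yq']; [rewrite updE|rewrite Dq //; exact: Ssound].
- move=> x xn xp; have [|[y [g [yq' gL gx]]]] := Spend x xn xp; first by left.
  by right; exists y, g; split=> //; rewrite mq yq' orbT.
- move=> k x kq; rewrite Qk; last by lia.
  move=> xL; have [[kE]|] := Sdone k x kq xL.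
    rewrite E inE => /predU1P[->|]; last by left.
    right; left; rewrite mq eqxx updE; split=> //; left.
    by rewrite kE Dq // Dt.
  have kq' : Q k \in mkseq Q qe by apply: mkseq_mem; lia.
  move=> H; right; rewrite /hfin mq (Dq _ kq'); case: H => [[xq H]|H].
    by left; rewrite xq orbT (Dq _ xq).
  by right.
- move=> x xn xp xl; have [[xq H]|] := Sback x xn xp xl; last first.
    move=> [i' ii' E']; have [_ Hle] := Sord i' ii'; rewrite E' in Hle.
    have [xz|xz] := eqVneq x z; last by right; exists i'.
    by left; rewrite mq xz eqxx updE; split=> //; rewrite -xz.
  by left; rewrite mq xq orbT Dq.
- move=> rt; have [iE H] := Stree rt; split=> // k /andP[k0 k1].
  have paq y : y \in mkseq Q qe -> upd pa z h y = pa y.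
    by move=> yq'; rewrite updN //; apply: contraNneq zq => <-.
  have [->|kq] := eqVneq k qe.
    exists qs.-1; rewrite !updE Qk; last by lia.
    by split=> //; [lia | apply: sub; rewrite E mem_head].
  have kq' : (k < qe)%N by lia.
  have [|k' [kk' h1 h2]] := H k; first by rewrite k0.
  exists k'; rewrite !Qk ?paq ?mkseq_mem //; lia.
Qed.

Lemma sinv_dequeue qs qe i Q re pe pa D tau Lc :
  sinv 0 qs qe i Q re pe pa D tau Lc -> (qs < qe)%N ->
  exists2 Lc', sinv (hd (Q qs)) qs.+1 qe i Q re pe pa D tau Lc' &
    (smu qs.+1 i Q Lc' < smu qs i Q Lc)%N.
Proof.
move=> S qq'; have E := llist_nil (s_cur S).
case: S => Sq Slt Sre Scur SLc Sact SD Ssound Spend Sdone Ssrc Sback Sord Ssorted Stau Stree Spe1.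
have [qq iN uq] := Sq.
have yq : Q qs \in mkseq Q qe by exact: mkseq_mem.
have yn := Slt _ yq.
exists (L (Q qs)).
  split=> //; first exact: hdL.
  - by move=> _ /=; split=> //; apply: Sact; rewrite leqnn.
  - by move=> k /andP[k1 k2]; apply: Sact; rewrite (ltnW k1).
  - move=> k h; rewrite ltnS leq_eqVlt => /predU1P[->|kq] hL; first by left.
    by have [[_]|] := Sdone k h kq hL; [rewrite E | right].
(* Without repetitions in the queue, the front vertex is new and leaves the sum only now. *)
have yqs : Q qs \notin mkseq Q qs.
  apply/negP => /mkseq_memP[k kq Ek].
  have : nth 0%N (mkseq Q qe) qs = nth 0%N (mkseq Q qe) k by rewrite !nth_mkseq //; lia.
  by move=> /eqP; rewrite nth_uniq ?size_mkseq //; [move=> /eqP ?; lia | lia].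
rewrite /smu E /= addn0.
have -> : (\sum_(y <- iota 0 n | y \notin mkseq Q qs) (1 + size (L y)) =
   (1 + size (L (Q qs))) + \sum_(y <- iota 0 n | y \notin mkseq Q qs.+1) (1 + size (L y)))%N.
  have mS y : (y \in mkseq Q qs.+1) = (y \in mkseq Q qs) || (y == Q qs).
    by rewrite /mkseq -[qs.+1]addn1 iotaD map_cat mem_cat inE.
  rewrite [LHS]big_mkcond [X in (_ + X)%N]big_mkcond /=.
  rewrite !(bigD1_seq (Q qs)) ?iota_uniq ?mem_iota //= yqs mS eqxx orbT /= add0n.
  by congr addn; apply: eq_bigr => y /negbTE yQ; rewrite mS yQ orbF.
by rewrite -addnA ltn_add2l -addnA add1n.
Qed.

(** A marked vertex passed over here either has an empty window or was reached before, thus no later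
    than its window opens. *)
Lemma sinv_advance qs qe i Q re pe pa D tau Lc :
  sinv 0 qs qe i Q re pe pa D tau Lc -> (qe <= qs)%N -> (i < n)%N ->
  ~~ [&& (0 < pe (ord i))%N, (re (ord i) <= 0)%N & lo (ord i) <= hi (ord i)] ->
  sinv 0 qs qe i.+1 Q re pe pa D (lo (ord i)) Lc /\
    (smu qs i.+1 Q Lc < smu qs i Q Lc)%N.
Proof.
move=> S qq' iN C; have E := llist_nil (s_cur S); split; last by rewrite /smu; lia.
case: S => Sq Slt Sre Scur SLc Sact SD Ssound Spend Sdone Ssrc Sback Sord Ssorted Stau Stree Spe1.
have [qq iN' uq] := Sq.
have [on tl] := Sord i ltac:(lia).
split=> //.
- by move=> k; lia.
- by move=> y /SD[h1 h2]; split=> //; exact: le_trans tl.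
- move=> z zn zp zl; have [|[i' ii' E']] := Sback z zn zp zl; first by left.
  have [E2|ni] := eqVneq i i'; last by right; exists i' => //; lia.
  have zq : z \in mkseq Q qe.
    by move: C; rewrite E2 E' zp zl andbT /= Sre //; case: (z \in _).
  by left; split=> //; move: tl; rewrite E2 E'; apply: le_trans; exact: (SD _ zq).2.
- by move=> i' ii'; have [h _] := Sord i' ltac:(lia); split=> //; apply: Ssorted; lia.
- by move=> i' i'' h1 h2; apply: Ssorted; lia.
- move=> z zn; have [h|[i' ii' E']] := Stau z zn; first by left; exact: le_trans h tl.
  have [E2|ni] := eqVneq i i'; first by left; rewrite E2 E'.
  by right; exists i' => //; lia.
- by move=> /Stree[E2]; lia.
Qed.

(** The mark comes from a source or from a half-edge of a vertex reached no later than now; the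
    opening of the window is therefore a legitimate arrival time. *)
Lemma sinv_advance_push qs qe i Q re pe pa D tau Lc :
  sinv 0 qs qe i Q re pe pa D tau Lc -> (qe <= qs)%N -> (i < n)%N ->
  [&& (0 < pe (ord i))%N, (re (ord i) <= 0)%N & lo (ord i) <= hi (ord i)] ->
  sinv 0 qs qe.+1 i.+1 (upd Q qe (ord i)) (upd re (ord i) 1%N) pe pa
     (upd D (ord i) (lo (ord i))) (lo (ord i)) Lc /\
    (smu qs i.+1 (upd Q qe (ord i)) Lc < smu qs i Q Lc)%N.
Proof.
move=> S qq' iN /and3P[xp re0 xlh]; have E := llist_nil (s_cur S).
have qen := sinv_qe_le S.
case: S => Sq Slt Sre Scur SLc Sact SD Ssound Spend Sdone Ssrc Sback Sord Ssorted Stau Stree Spe1.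
have [qq iN' uq] := Sq.
have qE : qs = qe by lia.
have [on tl] := Sord i ltac:(lia).
set z := ord i in xp re0 xlh on tl *.
have zq : z \notin mkseq Q qe by move: re0; rewrite Sre // leqn0 eqb0.
have Qk k : (k < qe)%N -> upd Q qe z k = Q k by move=> kq; rewrite updN // ltn_eqF.
have Dq y : y \in mkseq Q qe -> upd D z (lo z) y = D y.
  by move=> yq; rewrite updN //; apply: contraNneq zq => <-.
have mq y : (y \in mkseq (upd Q qe z) qe.+1) = (y == z) || (y \in mkseq Q qe).
  by rewrite mkseq_upd mem_rcons inE.
have mqs : mkseq (upd Q qe z) qs = mkseq Q qs.
  by apply/eq_in_map => k; rewrite mem_iota /= => kq; rewrite Qk //; lia.
have VRz : VR z (lo z).
  have [sz|[y [h [yq hL hz]]]] := Spend z on xp; first by apply: VR_src; rewrite ?lexx.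
  apply: (VR_step (Ssound _ yq) hL hz); last by rewrite lexx.
  exact: le_trans (SD _ yq).2 tl.
split; last by rewrite /smu mqs; lia.
split=> //.
- by split=> //; [lia | rewrite mkseq_upd rcons_uniq zq].
- by move=> y; rewrite mq => /predU1P[->//|]; exact: Slt.
- move=> y yn; rewrite mq /upd; case: eqP => //= _; exact: Sre.
- move=> k /andP[k1 k2]; have -> : k = qe by lia.
  by rewrite !updE.
- move=> y; rewrite mq => /predU1P[->|yq']; first by rewrite updE lexx xlh.
  by rewrite Dq //; have [h1 h2] := SD _ yq'; split=> //; exact: le_trans tl.
- by move=> y; rewrite mq => /predU1P[->|yq']; [rewrite updE|rewrite Dq //; exact: Ssound].
- move=> x xn xp'; have [|[y [g [yq' gL gx]]]] := Spend x xn xp'; first by left.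
  by right; exists y, g; split=> //; rewrite mq yq' orbT.
- move=> k x kq; rewrite Qk; last by lia.
  move=> xL; have [[_]|] := Sdone k x kq xL; first by rewrite E.
  have kq' : Q k \in mkseq Q qe by apply: mkseq_mem; lia.
  move=> H; right; rewrite /hfin mq (Dq _ kq'); case: H => [[xq H]|H].
    by left; rewrite xq orbT (Dq _ xq).
  by right.
- move=> x xn xp' xl; have [[xq H]|] := Sback x xn xp' xl; last first.
    move=> [i' ii' E']; have [E2|ni] := eqVneq i i'; last by right; exists i' => //; lia.
    by left; rewrite mq -E' -E2 eqxx updE.
  by left; rewrite mq xq orbT Dq.
- by move=> i' ii'; have [h _] := Sord i' ltac:(lia); split=> //; apply: Ssorted; lia.
- by move=> i' i'' h1 h2; apply: Ssorted; lia.
- move=> x xn; have [h|[i' ii' E']] := Stau x xn; first by left; exact: le_trans h tl.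
  have [E2|ni] := eqVneq i i'; first by left; rewrite -E' -E2.
  by right; exists i' => //; lia.
- by move=> /Stree[E2]; lia.
Qed.

(** Induction on the walk: [D] is a lower bound for all arrival times, since each case of [hfin] for
    the last half-edge either gives an early enough arrival or contradicts the window. *)
Lemma sinv_final cur qs qe i Q re pe pa D tau Lc :
  sinv cur qs qe i Q re pe pa D tau Lc -> cur = 0%N -> (qe <= qs)%N -> (n <= i)%N ->
  forall z t, VR z t -> z \in mkseq Q qe /\ D z <= t.
Proof.
move=> S c0 qq' iN; rewrite c0 in S; have E := llist_nil (s_cur S).
have [qq _ _] := s_q S.
have back z : (z < n)%N -> (0 < pe z)%N -> lo z <= hi z -> z \in mkseq Q qe /\ D z <= lo z.
  by move=> zn zp zl; have [//|[i']] := s_back S zn zp zl; lia.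
move=> z t; elim=> [{}z {}t zn sz /andP[h1 h2]|y {}z {}t t' h _ [yq Dy] hL hz tt' /andP[h1 h2]].
  have [||zq Dz] := back z zn; [exact: s_src S _ zn sz|exact: le_trans h1 h2|].
  by split=> //; exact: le_trans h1.
have [k kq yE] := mkseq_memP yq; have yn := s_lt S yq; rewrite yE in hL.
have [[_]|] := s_done S (leq_trans kq qq') hL; first by rewrite E.
rewrite -yE hz => -[[zq H]|[H|[zp H]]].
- by split=> //; case: H => H; [apply: le_trans H (le_trans Dy tt')|exact: le_trans H h1].
- have : D y < D y by apply: le_lt_trans H; apply: le_trans Dy (le_trans tt' h2).
  by rewrite ltxx.
- have zn : (z < n)%N by rewrite -hz; rewrite -yE in hL; exact: tgL yn hL.
  have [zq Dz] := back z zn zp (le_trans h1 h2).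
  by split=> //; exact: le_trans Dz h1.
Qed.

End SearchTheory.

(** * The program *)

Fixpoint seqs (l : seq cmd) : cmd :=
  match l with
  | [::] => Skip
  | [:: c] => c
  | c :: l' => Seq c (seqs l')
  end.

Definition BIEq x y := BAnd (BILe x y) (BILe y x).
Definition BOr b c := BNot (BAnd (BNot b) (BNot c)).
Definition nz e := BILe (INat 1) e.

Definition n1e := IGet 0 (INat 0).
Definition m1e := IGet 0 (INat 1).
Definition n2e := IGet 0 (INat 2).
Definition m2e := IGet 0 (INat 3).
Definition end1 g j := IGet g (IMul (INat 2) j).
Definition end2 g j := IGet g (IAdd (IMul (INat 2) j) (INat 1)).
Definition rvar a := RGet a (INat 0).
Definition rassign a e := RStore a (INat 0) e.

(* Integer arrays: 8 list heads, 9 list successors, 10 targets and 11 edges of half-edges,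
   12 queue, 13 reached, 14 pending, 15 parent half-edge, 16 sorted order, 17 vertex in ball,
   18 component representative, 19 component number, 20 edge meets ball; 21 to 37 are variables.
   Real arrays: 3 to 7 are variables ([6], [7] hold a window), 8 and 9 the windows of all
   vertices, 10 arrival times, 11 the current time. *)
Definition vcoord d g v k := RGet g (IAdd (IMul v (INat d)) (INat k)).
Definition rsum d (f : nat -> rexpr) := foldr (fun k e => RAdd (f k) e) (RNat 0) (iota 0 d).
Definition rinner d (a b c e : nat * iexpr) := rsum d (fun k =>
  RMul (RSub (vcoord d b.1 b.2 k) (vcoord d a.1 a.2 k)) (RSub (vcoord d e.1 e.2 k) (vcoord d c.1 c.2 k))).

(* The times at which the segment from vertex [p] to vertex [q] of graph [g] is within eps of
   vertex [x] of graph [h]. *)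
Definition window d g p q h x : cmd := seqs [::
  rassign 3 (rinner d (g, p) (g, q) (g, p) (g, q));
  rassign 4 (rinner d (g, p) (g, q) (g, p) (h, x));
  rassign 5 (RSub (rinner d (g, p) (h, x) (g, p) (h, x)) (RMul (rvar 0) (rvar 0)));
  If (BRLe (rvar 3) (RNat 0))
     (If (BRLe (rvar 5) (RNat 0))
         (Seq (rassign 6 (RNat 0)) (rassign 7 (RNat 1)))
         (Seq (rassign 6 (RNat 1)) (rassign 7 (RNat 0))))
     (seqs [:: rassign 5 (RSub (RMul (rvar 4) (rvar 4)) (RMul (rvar 3) (rvar 5)));
        If (BRLe (RNat 0) (rvar 5))
           (seqs [:: rassign 6 (RDiv (RSub (rvar 4) (RSqrt (rvar 5))) (rvar 3));
              rassign 7 (RDiv (RAdd (rvar 4) (RSqrt (rvar 5))) (rvar 3));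
              If (BRLe (rvar 6) (RNat 0)) (rassign 6 (RNat 0)) Skip;
              If (BRLe (RNat 1) (rvar 7)) (rassign 7 (RNat 1)) Skip])
           (Seq (rassign 6 (RNat 1)) (rassign 7 (RNat 0)))])].

Definition incr x := iassign x (IAdd (ivar x) (INat 1)).

(** An end of an edge of G2 lies in the ball iff time 0 or 1 lies in the window. A vertex is written
    once for each incident edge, always with the same value. *)
Definition ball_loop d := for_ 22 m2e (seqs [::
  window d 2 (end1 2 (ivar 22)) (end2 2 (ivar 22)) 1 (ivar 34);
  If (BRLe (rvar 6) (rvar 7)) (IStore 20 (ivar 22) (INat 1)) (IStore 20 (ivar 22) (INat 0));
  If (BAnd (BRLe (rvar 6) (RNat 0)) (BRLe (RNat 0) (rvar 7)))
     (IStore 17 (end1 2 (ivar 22)) (INat 1)) (IStore 17 (end1 2 (ivar 22)) (INat 0));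
  If (BAnd (BRLe (rvar 6) (RNat 1)) (BRLe (RNat 1) (rvar 7)))
     (IStore 17 (end2 2 (ivar 22)) (INat 1)) (IStore 17 (end2 2 (ivar 22)) (INat 0))]).

Definition self_loop := for_ 25 n2e (IStore 18 (ivar 25) (ivar 25)).

(** Union by relabelling takes O(n2) steps per edge, which the budget per vertex of G1 allows. The
    two labels are copied first because the inner loop overwrites their cells. *)
Definition merge_loop := for_ 22 m2e
  (If (BAnd (nz (IGet 17 (end1 2 (ivar 22)))) (nz (IGet 17 (end2 2 (ivar 22)))))
      (seqs [:: iassign 27 (IGet 18 (end1 2 (ivar 22)));
         iassign 28 (IGet 18 (end2 2 (ivar 22)));
         for_ 26 n2e (If (BIEq (IGet 18 (ivar 26)) (ivar 27))
           (IStore 18 (ivar 26) (ivar 28)) Skip)])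
      Skip).

Definition number_loop := for_ 25 n2e
  (If (BAnd (nz (IGet 17 (ivar 25))) (BIEq (IGet 18 (ivar 25)) (ivar 25)))
      (Seq (incr 30) (IStore 19 (ivar 25) (ivar 30))) Skip).

Definition lab_cell v j := IAdd (IMul v m2e) j.

(** An edge with an end in the ball inherits the number of that end; an edge that meets the ball
    only in its interior is a placement of its own and gets a fresh number. *)
Definition label_loop := for_ 22 m2e
  (If (nz (IGet 17 (end1 2 (ivar 22))))
    (IStore 4 (lab_cell (ivar 34) (ivar 22)) (IGet 19 (IGet 18 (end1 2 (ivar 22)))))
    (If (nz (IGet 17 (end2 2 (ivar 22))))
      (IStore 4 (lab_cell (ivar 34) (ivar 22)) (IGet 19 (IGet 18 (end2 2 (ivar 22)))))
      (If (nz (IGet 20 (ivar 22)))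
        (Seq (incr 30) (IStore 4 (lab_cell (ivar 34) (ivar 22)) (ivar 30)))
        (IStore 4 (lab_cell (ivar 34) (ivar 22)) (INat 0))))).

Definition place_prog d := for_ 34 n1e (seqs [:: ball_loop d; self_loop; merge_loop;
  iassign 30 (INat 0); number_loop; label_loop; IStore 3 (ivar 34) (ivar 30)]).

(* Half-edge 2j leaves the first end of edge j, half-edge 2j + 1 the second one. *)
Definition add_half g h t := seqs [::
  IStore 9 h (IGet 8 (IGet g h));
  IStore 8 (IGet g h) (IAdd h (INat 1));
  IStore 10 h (IGet g t);
  IStore 11 h (ivar 22)].

Definition build_adj g n m := Seq
  (for_ 25 n (IStore 8 (ivar 25) (INat 0)))
  (for_ 22 m (Seq
     (add_half g (IMul (INat 2) (ivar 22)) (IAdd (IMul (INat 2) (ivar 22)) (INat 1)))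
     (add_half g (IAdd (IMul (INat 2) (ivar 22)) (INat 1)) (IMul (INat 2) (ivar 22))))).

Definition push z := seqs [:: IStore 13 z (INat 1); RStore 10 z (rvar 11);
  IStore 12 (ivar 29) z; incr 29].

(** By priority: scan the current vertex (27 is its list pointer), take the next one from the queue
    (from 28 to 29), or move the clock to the next window opening (21). Hence every vertex is
    scanned while the clock shows its arrival time. *)
Definition search n := While (BNot (BAnd (BILe (ivar 27) (INat 0))
    (BAnd (BILe (ivar 29) (ivar 28)) (BILe n (ivar 21)))))
  (If (nz (ivar 27))
    (seqs [:: iassign 37 (ISub (ivar 27) (INat 1)); iassign 26 (IGet 10 (ivar 37));
       iassign 27 (IGet 9 (ivar 37));
       If (BILe (IGet 13 (ivar 26)) (INat 0))
         (If (BRLe (RGet 8 (ivar 26)) (rvar 11))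
           (If (BRLe (rvar 11) (RGet 9 (ivar 26)))
             (Seq (IStore 15 (ivar 26) (ivar 37)) (push (ivar 26))) Skip)
           (IStore 14 (ivar 26) (INat 1)))
         Skip])
    (If (BILe (IAdd (ivar 28) (INat 1)) (ivar 29))
      (seqs [:: iassign 27 (IGet 8 (IGet 12 (ivar 28))); incr 28])
      (seqs [:: iassign 26 (IGet 16 (ivar 21)); incr 21; rassign 11 (RGet 8 (ivar 26));
         If (BAnd (nz (IGet 14 (ivar 26))) (BAnd (BILe (IGet 13 (ivar 26)) (INat 0))
              (BRLe (RGet 8 (ivar 26)) (RGet 9 (ivar 26)))))
           (push (ivar 26)) Skip]))).

Definition window_loop d := for_ 25 n2e (seqs [::
  window d 1 (end1 1 (ivar 32)) (end2 1 (ivar 32)) 2 (ivar 25);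
  RStore 8 (ivar 25) (rvar 6); RStore 9 (ivar 25) (rvar 7)]).

(** Sorting by counting predecessors is quadratic, but it is done once per edge of G1 and serves all
    searches for that edge. *)
Definition rank_loop := for_ 25 n2e (seqs [:: iassign 30 (INat 0);
  for_ 26 n2e (If (BAnd (BRLe (RGet 8 (ivar 26)) (RGet 8 (ivar 25)))
                  (BNot (BAnd (BRLe (RGet 8 (ivar 25)) (RGet 8 (ivar 26)))
                              (BILe (ivar 25) (ivar 26)))))
                (incr 30) Skip);
  IStore 16 (ivar 30) (ivar 25)]).

Definition clear_loop n := for_ 25 n (Seq (IStore 13 (ivar 25) (INat 0)) (IStore 14 (ivar 25) (INat 0))).

Definition in_class x k := BIEq (IGet 4 (lab_cell x (ivar 22))) (IAdd k (INat 1)).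

Definition source_loop := for_ 22 m2e (If (in_class (ivar 33) (ivar 23))
  (Seq (IStore 14 (end1 2 (ivar 22)) (INat 1)) (IStore 14 (end2 2 (ivar 22)) (INat 1))) Skip).

Definition reset_search := seqs [:: iassign 21 (INat 0); iassign 27 (INat 0); iassign 28 (INat 0);
  iassign 29 (INat 0); rassign 11 (RNat 0)].

(** An edge is reached if it belongs to the source class, which takes no crossing, or if one of its
    ends is reached. Labels are shifted by one, hence the subtraction. *)
Definition mark_loop := for_ 22 m2e (seqs [:: iassign 24 (IGet 4 (lab_cell (ivar 34) (ivar 22)));
  If (BAnd (nz (ivar 24)) (BOr (in_class (ivar 33) (ivar 23))
        (BOr (nz (IGet 13 (end1 2 (ivar 22)))) (nz (IGet 13 (end2 2 (ivar 22)))))))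
    (IStore 5 (IAdd (IMul (IAdd (IMul (ivar 32) m2e) (ivar 23)) m2e) (ISub (ivar 24) (INat 1))) (INat 1))
    Skip]).

Definition source_class_loop := for_ 23 (IGet 3 (ivar 33)) (seqs [::
  clear_loop n2e; source_loop; reset_search; search n2e; mark_loop]).

Definition reach_loop d := for_ 32 m1e (seqs [:: iassign 33 (end1 1 (ivar 32));
  iassign 34 (end2 1 (ivar 32)); window_loop d; rank_loop; source_class_loop]).

Definition alive_loop := for_ 34 n1e (for_ 23 (IGet 3 (ivar 34))
  (IStore 6 (lab_cell (ivar 34) (ivar 23)) (INat 1))).

Definition reach_prog d := seqs [:: build_adj 2 n2e m2e; reach_loop d; alive_loop].

(** The strides in 35 and 36 select the reachability matrix of the edge or its transpose, so that
    one loop serves both orientations. *)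
Definition support_loop := for_ 24 (IGet 3 (ivar 34))
  (If (BAnd (nz (IGet 6 (lab_cell (ivar 34) (ivar 24))))
       (nz (IGet 5 (IAdd (IMul (IMul (ivar 32) m2e) m2e)
                      (IAdd (IMul (ivar 23) (ivar 35)) (IMul (ivar 24) (ivar 36)))))))
     (iassign 31 (INat 1)) Skip).

(* Deletes the placements of vertex [33] without support at its neighbour [34] along edge [32]. *)
Definition revise := Seq
  (If (BIEq (end1 1 (ivar 32)) (ivar 33))
    (Seq (iassign 35 m2e) (iassign 36 (INat 1))) (Seq (iassign 35 (INat 1)) (iassign 36 m2e)))
  (for_ 23 (IGet 3 (ivar 33)) (If (nz (IGet 6 (lab_cell (ivar 33) (ivar 23))))
     (seqs [:: iassign 31 (INat 0); support_loop;
        If (BILe (ivar 31) (INat 0)) (IStore 6 (lab_cell (ivar 33) (ivar 23)) (INat 0)) Skip])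
     Skip)).

(** With all windows equal to {0} and the order already exhausted (21 is set to [n1]), the timed
    search is a breadth-first search from vertex 0. *)
Definition root_search := seqs [:: build_adj 1 n1e m1e;
  for_ 25 n1e (seqs [:: IStore 13 (ivar 25) (INat 0); IStore 14 (ivar 25) (INat 0);
                  RStore 8 (ivar 25) (RNat 0); RStore 9 (ivar 25) (RNat 0)]);
  reset_search; IStore 14 (INat 0) (INat 1); push (INat 0); iassign 21 n1e; search n1e].

(* [a], [b] receive the vertex at position [q] of the queue and its parent. *)
Definition at_edge q a b := seqs [:: iassign a (IGet 12 q); iassign 37 (IGet 15 (ivar a));
  iassign b (IGet 1 (ivar 37)); iassign 32 (IGet 11 (ivar 37)); revise].

(** Queue positions in decreasing order: the children of a vertex are treated before its own edge to
    the parent. Position 0 is the root, which has no such edge. *)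
Definition up_loop := for_ 21 n1e (seqs [:: iassign 25 (ISub (ISub n1e (INat 1)) (ivar 21));
  If (nz (ivar 25)) (at_edge (ivar 25) 34 33) Skip]).

Definition down_loop := for_ 21 n1e (If (nz (ivar 21)) (at_edge (ivar 21) 33 34) Skip).

Definition prune_prog := seqs [:: root_search; up_loop; down_loop].

Definition answer_prog := Seq (IStore 7 (INat 0) (INat 1))
  (for_ 34 n1e (seqs [:: iassign 31 (INat 0);
     for_ 23 (IGet 3 (ivar 34)) (If (nz (IGet 6 (lab_cell (ivar 34) (ivar 23))))
       (iassign 31 (INat 1)) Skip);
     If (BILe (ivar 31) (INat 0)) (IStore 7 (INat 0) (INat 0)) Skip])).

Definition gda d := GdaProgram (place_prog d) (reach_prog d) prune_prog answer_prog.

(** * Memory encoding of the input *)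

Section Inputs.
Context {R : realType} {d : nat}.

Record encodes (G : embgraph R d) g (s : state R) : Prop := {
  enc_end1 : forall e : 'I_(ne G), imem s g (2 * e) = (ends e).1;
  enc_end2 : forall e : 'I_(ne G), imem s g (2 * e + 1) = (ends e).2;
  enc_pos : forall (v : 'I_(nv G)) (k : 'I_d), rmem s g (v * d + k) = pos v 0 k }.

Record inputs (G1 G2 : embgraph R d) eps (s : state R) : Prop := {
  in_n1 : imem s 0 0 = nv G1;
  in_m1 : imem s 0 1 = ne G1;
  in_n2 : imem s 0 2 = nv G2;
  in_m2 : imem s 0 3 = ne G2;
  in_eps : rmem s 0 0 = eps;
  in_g1 : encodes G1 1 s;
  in_g2 : encodes G2 2 s }.

Lemma nth_flatten_const (T S : Type) (x0 : T) n (f : S -> seq T) u i j y0 :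
  (forall x, size (f x) = n) -> (i < size u)%N -> (j < n)%N ->
  nth x0 (flatten [seq f x | x <- u]) (i * n + j) = nth x0 (f (nth y0 u i)) j.
Proof.
move=> fn; elim: u i => //= x u IH [|i] iu jn; rewrite nth_cat fn.
  by rewrite mul0n add0n jn.
by rewrite mulSn -addnA ltnNge leq_addr /= addKn IH.
Qed.

Lemma inputs_initial (G1 G2 : embgraph R d) eps : inputs G1 G2 eps (input_state G1 G2 eps).
Proof.
have E (G : embgraph R d) (e : 'I_(ne G)) j : (j < 2)%N ->
    nth 0%N (edge_list G) (e * 2 + j) = nth 0%N [:: val (ends e).1; val (ends e).2] j.
  move=> j2; rewrite /edge_list (nth_flatten_const (n := 2) _ e) ?size_enum_ord //.
  by rewrite nth_ord_enum.
have C (G : embgraph R d) (v : 'I_(nv G)) (k : 'I_d) :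
    nth 0 (coordinates G) (v * d + k) = pos v 0 k.
  rewrite /coordinates (nth_flatten_const (n := d) _ v) ?size_enum_ord //; last first.
    by move=> x; rewrite size_map size_enum_ord.
  by rewrite nth_ord_enum (nth_map k) ?size_enum_ord // nth_ord_enum.
split=> //=; split=> [e|e|v k] /=.
- by have := E G1 e 0%N isT; rewrite addn0 mulnC.
- by have := E G1 e 1%N isT; rewrite mulnC.
- exact: C.
- by have := E G2 e 0%N isT; rewrite addn0 mulnC.
- by have := E G2 e 1%N isT; rewrite mulnC.
- exact: C.
Qed.

Lemma inputs_same (G1 G2 : embgraph R d) eps im rm s s' : same im rm s s' ->
  all (fun a => 2 < a)%N im -> all (fun a => 2 < a)%N rm ->
  inputs G1 G2 eps s -> inputs G1 G2 eps s'.
Proof.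
move=> [Hi Hr] /allP ai /allP ar.
have Ei a : (a < 3)%N -> imem s' a =1 imem s a.
  by move=> a3; apply: Hi; apply/negP => /ai; rewrite ltnNge -ltnS a3.
have Er a : (a < 3)%N -> rmem s' a =1 rmem s a.
  by move=> a3; apply: Hr; apply/negP => /ar; rewrite ltnNge -ltnS a3.
case=> n1 m1 n2 m2 ep [a1 b1 c1] [a2 b2 c2].
by split; rewrite ?Ei ?Er //; split=> *; rewrite ?Ei ?Er.
Qed.

Lemma inputs_iset (G1 G2 : embgraph R d) eps s a k n : (2 < a)%N ->
  inputs G1 G2 eps s -> inputs G1 G2 eps (iset s a k n).
Proof. by move=> a2; apply: inputs_same (same_iset a k n s) _ _; rewrite /= ?a2. Qed.

End Inputs.

(** [A] is the squared length of the segment, [B] an inner product, and [A * t ^+ 2 - 2 * B * t + C]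
    the squared distance minus the squared radius. For [A = 0] it is constant; a condition that
    never holds yields the pair 1, 0. *)
Lemma quadratic_window (R : rcfType) (A B C : R) : 0 <= A -> (A = 0 -> B = 0) ->
  let lo := if A <= 0 then (if C <= 0 then 0 else 1) else
    if 0 <= B * B - A * C then
      (if (B - Num.sqrt (B * B - A * C)) / A <= 0 then 0 else (B - Num.sqrt (B * B - A * C)) / A)
    else 1 in
  let hi := if A <= 0 then (if C <= 0 then 1 else 0) else
    if 0 <= B * B - A * C then
      (if 1 <= (B + Num.sqrt (B * B - A * C)) / A then 1 else (B + Num.sqrt (B * B - A * C)) / A)
    else 0 in
  0 <= lo /\ forall t, (0 <= t <= 1 /\ A * t ^+ 2 - 2 * B * t + C <= 0) <-> lo <= t <= hi.
Proof.
move=> A0 AB /=; set D := B * B - A * C.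
have [Ale|Agt] := leP A 0.
  have AE : A = 0 by apply/eqP; rewrite eq_le Ale.
  rewrite AE (AB AE); case: ifP => C0; split=> // t.
    by split=> [[//]|h]; split=> //; lra.
  split=> [[_]|/andP[h1 h2]]; last by have := le_trans h1 h2; rewrite ler10.
  by rewrite mul0r mulr0 mul0r subrr add0r C0.
have sq t : A * (A * t ^+ 2 - 2 * B * t + C) = (A * t - B) ^+ 2 - D by rewrite /D; ring.
have [D0|D0] := leP 0 D; last first.
  split=> // t; split=> [[_ h]|/andP[h1 h2]]; last by have := le_trans h1 h2; rewrite ler10.
  have : A * (A * t ^+ 2 - 2 * B * t + C) <= 0 by rewrite pmulr_rle0.
  by rewrite sq; have := sqr_ge0 (A * t - B); lra.
have maxE (x : R) : (if x <= 0 then 0 else x) = Num.max 0 x by case: leP.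
have minE (x : R) : (if 1 <= x then 1 else x) = Num.min 1 x by case: leP.
rewrite maxE minE; split; first by rewrite le_max lexx.
move=> t; rewrite ge_max le_min; set r := Num.sqrt D.
have r0 : 0 <= r by exact: sqrtr_ge0.
have rD : r ^+ 2 = D by exact: sqr_sqrtr.
have -> : (A * t ^+ 2 - 2 * B * t + C <= 0) = ((B - r) / A <= t) && (t <= (B + r) / A).
  rewrite -(pmulr_rle0 _ Agt) sq subr_le0 -rD ler_pdivrMr // ler_pdivlMr //.
  rewrite -ler_sqrt ?sqr_ge0 // !sqrtr_sqr (ger0_norm r0) ler_norml.
  by congr andb; apply/idP/idP => h; lra.
by split=> [[/andP[-> ->] /andP[-> ->]]|/andP[/andP[-> ->] /andP[-> ->]]].
Qed.

(** * Computation of time windows *)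

Section Window.
Context {R : realType} {d : nat}.
Implicit Types (s : state R) (W : nat).

Lemma iev_rset s a k (x : R) e : iev (rset s a k x) e = iev s e.
Proof. by elim: e => //= [b i ->|e -> f ->|e -> f ->|e -> f ->]. Qed.

Lemma isafe_rset W s a k (x : R) e : isafe W (rset s a k x) e <-> isafe W s e.
Proof.
elim: e => //= [b i IH|e IHe f IHf|e IHe f IHf|e IHe f IHf]; rewrite ?iev_rset.
- by rewrite IH.
- by split=> -[h1 h2 h3]; split=> //; apply/IHe || apply/IHf.
- by rewrite IHe IHf.
- by split=> -[h1 h2 h3]; split=> //; apply/IHe || apply/IHf.
Qed.

Lemma encodes_rset (G : embgraph R d) g s a k x : (g < a)%N -> encodes G g s ->
  encodes G g (rset s a k x).
Proof.
move=> ga [h1 h2 h3]; split=> //= v i; rewrite h3.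
by rewrite (ltn_eqF ga).
Qed.

Lemma rev_rsum s f : rev_ s (rsum d f) = \sum_(k < d) rev_ s (f k).
Proof.
rewrite /rsum -(big_mkord xpredT (fun k => rev_ s (f k))) /index_iota subn0.
by elim: (iota 0 d) => [|k u IH]; rewrite ?big_nil ?big_cons //= IH.
Qed.

Lemma rsafe_rsum W s f : (forall k, (k < d)%N -> rsafe W s (f k)) -> rsafe W s (rsum d f).
Proof.
move=> H; rewrite /rsum.
have : {subset iota 0 d <= iota 0 d} by [].
elim: {1 3}(iota 0 d) => //= k u IH sub; split.
  by apply: H; have := sub k (mem_head _ _); rewrite mem_iota.
by apply: IH => x xu; apply: sub; rewrite inE xu orbT.
Qed.

Definition denotes W (G : embgraph R d) s (e : iexpr) (v : 'I_(nv G)) : Prop :=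
  isafe W s e /\ iev s e = v.

Lemma denotes_rset W (G : embgraph R d) s a k x e (v : 'I_(nv G)) :
  denotes W s e v -> denotes W (rset s a k x) e v.
Proof. by move=> [h1 h2]; split; [apply/isafe_rset | rewrite iev_rset]. Qed.

Lemma vcoordP W (G : embgraph R d) g s e (v : 'I_(nv G)) (k : 'I_d) :
  (nv G * d.+1 < W)%N -> (d < W)%N -> encodes G g s -> denotes W s e v ->
  rsafe W s (vcoord d g e k) /\ rev_ s (vcoord d g e k) = pos v 0 k.
Proof.
move=> gW dW E [se ve]; split; last by rewrite /= ve (enc_pos E).
have vW : (v * d + k < W)%N.
  apply: leq_ltn_trans gW; have := ltn_ord v; have := ltn_ord k; nia.
by rewrite /= ve; split=> //; [split=> //; nia | have := ltn_ord k; lia].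
Qed.

Definition valued W s (e : nat * iexpr) (x : 'rV[R]_d) : Prop :=
  forall k : 'I_d, rsafe W s (vcoord d e.1 e.2 k) /\ rev_ s (vcoord d e.1 e.2 k) = x 0 k.

Lemma rinnerP W s a b c e (va vb vc ve : 'rV[R]_d) :
  valued W s a va -> valued W s b vb -> valued W s c vc -> valued W s e ve ->
  rsafe W s (rinner d a b c e) /\
  rev_ s (rinner d a b c e) = \sum_(k < d) (vb 0 k - va 0 k) * (ve 0 k - vc 0 k).
Proof.
move=> Ha Hb Hc He; split.
  apply: rsafe_rsum => k kd; set k' := Ordinal kd.
  by have [? _] := Ha k'; have [? _] := Hb k'; have [? _] := Hc k'; have [? _] := He k'.
rewrite rev_rsum; apply: eq_bigr => k _.
have [_ a1] := Ha k; have [_ a2] := Hb k; have [_ a3] := Hc k; have [_ a4] := He k.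
by move: a1 a2 a3 a4 => /= -> -> -> ->.
Qed.

(** Any pair with [b < a] encodes an empty window. The bound [0 <= a] lets the clock start at 0. *)
Definition window_spec (a b : R) (p q x : 'rV[R]_d) eps : Prop :=
  0 <= a /\ forall t, (0 <= t <= 1 /\ fclose p q eps t x) <-> a <= t <= b.

Lemma windowP W s (G H : embgraph R d) g h p q x (P Q : 'I_(nv G)) (X : 'I_(nv H)) eps :
  (nv G * d.+1 < W)%N -> (nv H * d.+1 < W)%N -> (d < W)%N -> (0 < W)%N ->
  (g < 3)%N -> (h < 3)%N ->
  encodes G g s -> encodes H h s -> rmem s 0 0 = eps ->
  denotes W s p P -> denotes W s q Q -> denotes W s x X ->
  ht W (fun _ _ => True) (window d g p q h x) s (scost (window d g p q h x))
   (fun s' => window_spec (rmem s' 6 0) (rmem s' 7 0) (pos P) (pos Q) (pos X) eps).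
Proof.
move=> gW hW dW W0 g3 h3 EG EH Ee dp dq dx; apply: wp_ht.
pose A := \sum_(k < d) (pos Q 0 k - pos P 0 k) * (pos Q 0 k - pos P 0 k).
pose B := \sum_(k < d) (pos Q 0 k - pos P 0 k) * (pos X 0 k - pos P 0 k).
pose C := \sum_(k < d) (pos X 0 k - pos P 0 k) * (pos X 0 k - pos P 0 k) - eps * eps.
have A0 : 0 <= A by apply: sumr_ge0 => k _; rewrite -expr2 sqr_ge0.
have AB : A = 0 -> B = 0.
  move=> /eqP; rewrite psumr_eq0 => [/allP AE|k _]; last by rewrite -expr2 sqr_ge0.
  apply: big1 => k _; have := AE k; rewrite mem_index_enum => /(_ isT) /=.
  by rewrite mulf_eq0 orbb => /eqP ->; rewrite mul0r.
have spec lo hi : 0 <= lo /\ (forall t, (0 <= t <= 1 /\ A * t ^+ 2 - 2 * B * t + C <= 0) <-> lo <= t <= hi) ->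
   window_spec lo hi (pos P) (pos Q) (pos X) eps.
  move=> [l0 Hl]; split=> // t; rewrite -Hl.
  have -> : A * t ^+ 2 - 2 * B * t + C = nsq (segment (pos P) (pos Q) t - pos X) - eps ^+ 2.
    rewrite /C addrA -expr2; congr (_ - _).
    rewrite /A /B /nsq mulr_suml mulr_sumr mulr_suml -sumrN -!big_split /=.
    by apply: eq_bigr => k _; rewrite !mxE; ring.
  by rewrite subr_le0.
have {}spec := spec _ _ (quadratic_window C A0 AB).
have rW a k y : let s' := rset s a k y in (2 < a)%N ->
    [/\ encodes G g s', encodes H h s', denotes W s' p P, denotes W s' q Q & denotes W s' x X].
  move=> s' a2; split; try exact: denotes_rset; apply: encodes_rset => //; lia.
have vals s' : encodes G g s' -> encodes H h s' -> denotes W s' p P -> denotes W s' q Q ->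
    denotes W s' x X ->
  [/\ valued W s' (g, p) (pos P), valued W s' (g, q) (pos Q) & valued W s' (h, x) (pos X)].
  by move=> EG' EH' dp' dq' dx'; split=> k; apply: vcoordP; eauto.
have [v1 v2 v3] := vals s EG EH dp dq dx.
have [sA eA] := rinnerP v1 v2 v1 v2.
set s1 := rset s 3 0 A.
have [EG1 EH1 dp1 dq1 dx1] := rW 3%N 0%N A isT.
have [v1' v2' v3'] := vals s1 EG1 EH1 dp1 dq1 dx1.
have [sB eB] := rinnerP v1' v2' v1' v3'.
set s2 := rset s1 4 0 B.

have v1'' : valued W s2 (g, p) (pos P).
  by move=> k; apply: vcoordP; [exact: gW | exact: dW | apply: encodes_rset EG1; lia | exact: denotes_rset].
have v3'' : valued W s2 (h, x) (pos X).
  by move=> k; apply: vcoordP; [exact: hW | exact: dW | apply: encodes_rset EH1; lia | exact: denotes_rset].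
have [sC eC] := rinnerP v1'' v3'' v1'' v3''.
rewrite /window /=; split=> //; rewrite eA -/A -/s1; split=> //; rewrite eB -/B -/s2.
split=> //; rewrite eC Ee -/C.
have WW : (0 < W)%N /\ True by [].
split=> //; case: ifP spec => _; first by split=> //; case: ifP spec.
move=> spec; split=> //; split=> //; case: ifP spec => _; last by split.
move=> spec; split=> //; split=> //; split=> //.
case: ifP spec => _ spec.
  by split=> //; split=> //; case: ifP spec => _ spec.
by split=> //; case: ifP spec => _ spec.
Qed.

End Window.

(** * Sorting by rank *)

Section Rank.
Context {R : realType} (n : nat) (lo : nat -> R).

(** The strict lexicographic order by [lo] and then by index, which makes ranks distinct; it is
    written with weak comparisons, as the machine tests it. *)
Definition before x w := (lo x <= lo w) && ~~ ((lo w <= lo x) && (w <= x)%N).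
Definition rank w := count (before^~ w) (iota 0 n).

Lemma before_trans y x z : before x y -> before y z -> before x z.
Proof.
rewrite /before => /andP[xy /nandP n1] /andP[yz /nandP n2]; rewrite (le_trans xy yz) /=.
apply/nandP; case: n1 => [n1|n1]; first by left; apply: contra n1; exact: le_trans.
case: n2 => [n2|n2]; first by left; apply: contra n2 => zx; exact: le_trans zx xy.
by right; move: n1 n2; rewrite -!ltnNge; exact: ltn_trans.
Qed.

Lemma before_irr x : ~~ before x x.
Proof. by rewrite /before lexx leqnn. Qed.

Lemma before_total x w : x != w -> before x w || before w x.
Proof. by rewrite /before neq_ltn; case: (ltgtP (lo x) (lo w)) => //= _; rewrite -!ltnNge. Qed.

Lemma rank_lt x w : (x < n)%N -> before x w -> (rank x < rank w)%N.
Proof.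
move=> xn xw; rewrite /rank -!size_filter.
have sub : {subset [seq y <- iota 0 n | before y x] <= rem x [seq y <- iota 0 n | before y w]}.
  move=> y; rewrite mem_filter => /andP[yx yn].
  rewrite mem_rem_uniq ?filter_uniq ?iota_uniq // inE mem_filter yn (before_trans yx xw) !andbT.
  by apply: contraTneq yx => ->; exact: before_irr.
have := uniq_leq_size (filter_uniq _ (iota_uniq 0 n)) sub.
have xin : x \in [seq y <- iota 0 n | before y w] by rewrite mem_filter xw mem_iota.
rewrite size_rem //; case: [seq y <- iota 0 n | before y w] xin => //.
Qed.

Lemma rank_bound w : (w < n)%N -> (rank w < n)%N.
Proof.
move=> wn; rewrite /rank -[X in (_ < X)%N](size_iota 0 n) -(count_predC (before^~ w) (iota 0 n)).
rewrite -[X in (X < _)%N]addn0 ltn_add2l -has_count; apply/hasP; exists w; first by rewrite mem_iota.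
exact: before_irr.
Qed.

Lemma rank_inj x w : (x < n)%N -> (w < n)%N -> rank x = rank w -> x = w.
Proof.
move=> xn wn E; apply/eqP; apply: contraT => /before_total/orP[/(rank_lt xn)|/(rank_lt wn)];
  by rewrite E ltnn.
Qed.

Lemma sorted_of_rank (ord : nat -> nat) : (forall w, (w < n)%N -> ord (rank w) = w) ->
  [/\ forall i, (i < n)%N -> (ord i < n)%N,
      forall w, (w < n)%N -> exists2 i, (i < n)%N & ord i = w &
      forall i i', (i <= i')%N -> (i' < n)%N -> lo (ord i) <= lo (ord i')].
Proof.
move=> H.
have onto i : (i < n)%N -> exists2 w, (w < n)%N & rank w = i.
  move=> iN; pose r (w : 'I_n) := Ordinal (rank_bound (ltn_ord w)).
  have ri : injective r.
    by move=> x w /(congr1 val) /= E; apply: val_inj; apply: rank_inj E.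
  have [r' _ r'K] := injF_bij ri.
  by exists (r' (Ordinal iN)) => //; have := congr1 val (r'K (Ordinal iN)).
split.
- by move=> i /onto[w wn <-]; rewrite H.
- by move=> w wn; exists (rank w); [exact: rank_bound | exact: H].
- move=> i i' ii' iN'; have [w wn Ew] := onto i (leq_ltn_trans ii' iN').
  have [w' wn' Ew'] := onto i' iN'; rewrite -Ew -Ew' !H // leNgt; apply/negP => lt.
  have b : before w' w by rewrite /before (ltW lt) /= leNgt lt.
  by have := rank_lt wn' b; rewrite Ew Ew'; lia.
Qed.

End Rank.

Lemma llist_upd nx k x h l : k \notin l -> llist nx h l -> llist (upd nx k x) h l.
Proof.
elim: l h => //= y l IH h; rewrite inE negb_or => /andP[ky kl] [-> H]; split=> //.
by rewrite updN 1?eq_sym //; exact: IH.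
Qed.

Lemma sum_size_owner (own : nat -> nat) n N :
  (\sum_(y <- iota 0 n) size [seq h <- iota 0 N | own h == y] <= N)%N.
Proof.
elim: N => [|N IH]; first by rewrite big1.
have E y : size [seq h <- iota 0 N.+1 | own h == y] =
    (size [seq h <- iota 0 N | own h == y] + (own N == y))%N.
  by rewrite -[N.+1]addn1 iotaD filter_cat size_cat /=; case: eqP.
under eq_bigr do rewrite E.
rewrite big_split /= -addn1; apply: leq_add => //.
rewrite -(big_mkcond (fun y => own N == y) (fun=> 1%N)) /= sum1_count.
rewrite (eq_count (a2 := pred1 (own N))); last by move=> y; rewrite /= eq_sym.
by rewrite count_uniq_mem ?iota_uniq // leq_b1.
Qed.

(** * Walks of the search and certificates *)

Section SearchCert.
Context {R : realType} {d : nat} (G : embgraph R d) (p q : 'rV[R]_d) (eps : R).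
Context (L : nat -> seq nat) (tg : nat -> nat) (lo hi : nat -> R) (class : 'I_(ne G) -> Prop).
Context (adj1 : forall (a : 'I_(nv G)) h, h \in L a ->
          exists j (z : 'I_(nv G)), [/\ tg h = z, inc j a & inc j z])
        (adj2 : forall j (a z : 'I_(nv G)), inc j a -> inc j z -> a != z ->
          exists2 h, h \in L a & tg h = z)
        (win : forall w : 'I_(nv G), window_spec (lo w) (hi w) p q (pos w) eps).

Definition source (z : nat) := exists j (w : 'I_(nv G)), [/\ z = val w, class j & inc j w].

Lemma cert_of_VR z t : VR (nv G) L tg lo hi source z t ->
  exists2 w : 'I_(nv G), z = w &
  exists2 i, class i & forall j, inc j w -> exists K, trav p q eps K i 0 j t.
Proof.
elim=> [{}z {}t zn [i [w [zw ci iw]]] lt|y {}z {}t t' h _ [a ya [i ci H]] hL hz tt' lt].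
  rewrite zw in lt; have [t01 cl] := ((win w).2 t).2 lt; have /andP[t0 _] := t01.
  exists w => //; exists i => // j jw; exists [:: (w, j)]; split=> //; by exists t.
rewrite ya in hL; have [j [w [hw ja jw]]] := adj1 hL.
rewrite -hz hw in lt *; have [t01 cl] := ((win w).2 t').2 lt.
have [K tr] := H j ja.
exists w => //; exists i => // j' jw'; exists (K ++ [:: (w, j')]); apply/trav_cat; exists j, t.
by split=> //; split=> //; exists t'.
Qed.

(** Walks of [VR] move between vertices, certificates between edges. Successive crossings at the
    same vertex correspond to no half-edge, and there the earlier arrival is kept. *)
Lemma VR_of_cert i K l t' : class i -> t' <= 1 -> trav p q eps K i 0 l t' ->
  class l \/ exists (w : 'I_(nv G)) t, inc l w /\ VR (nv G) L tg lo hi source w t.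
Proof.
move=> ci t1.
pose at_edge j t := class j \/ exists (w : 'I_(nv G)) t0, [/\ inc j w, t0 <= t & VR (nv G) L tg lo hi source w t0].
have gen j t : 0 <= t -> at_edge j t -> trav p q eps K j t l t' -> at_edge l t'.
  elim: K j t => [|[w m] K IH] j t t0 /=.
    move=> [cj|[w [s [jw st V]]]] [<- tt']; first by left.
    by right; exists w, s; split=> //; exact: le_trans tt'.
  move=> aj [jw mw [s [ts cl tr]]]; apply: (IH m s _ _ tr); first exact: le_trans ts.
  have s01 : 0 <= s <= 1 by rewrite (le_trans t0 ts) (le_trans _ t1) // (trav_le tr).
  have lt : lo w <= s <= hi w by apply/((win w).2 s).1.
  right; case: aj => [cj|[w0 [t2 [jw0 t2t V]]]].
    by exists w, s; split=> //; apply: VR_src => //; exists j, w.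
  have [E|w0w] := eqVneq w0 w.
    by exists w, t2; split=> //; [exact: le_trans ts | rewrite -E].
  have [h hL hz] := adj2 jw0 jw w0w.
  by exists w, s; split=> //; apply: (VR_step V hL hz) => //; exact: le_trans ts.
move=> tr; have [|//|[w [t [lw _ V]]]] := gen i 0 (lexx _) _ tr; first by left.
  by left.
by right; exists w, t.
Qed.

End SearchCert.

(** * Trees *)

Section Trees.
Context {R : realType} {d : nat} (G : embgraph R d).
Notation V := 'I_(nv G).

Lemma adj_sym : symmetric (adj G).
Proof. by move=> u v; rewrite /adj; apply: eq_existsb => e; rewrite orbC. Qed.

Lemma adj_irr u : ~~ adj G u u.
Proof.
apply/existsPn => e; rewrite negb_or; have := ends_loopless e.
by case: (ends e) => a b /= ab; rewrite !xpair_eqE; apply/andP; split; apply: contra ab => /andP[/eqP -> /eqP ->].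
Qed.

Lemma adjP u v : reflect (exists e : 'I_(ne G), ends e = (u, v) \/ ends e = (v, u)) (adj G u v).
Proof.
apply: (iffP existsP) => -[e H]; exists e; first by case/orP: H => /eqP; [left | right].
by case: H => ->; rewrite eqxx ?orbT.
Qed.

(** An order in which a connected graph can be built up vertex by vertex; the queue of a
    breadth-first search is one. *)
Definition grown (u : nat -> V) n := (forall i j, (i < n)%N -> (j < n)%N -> u i = u j -> i = j) /\
  forall k, (0 < k < n)%N -> exists2 k', (k' < k)%N & adj G (u k') (u k).

Lemma connect_invariant (S : pred V) x y : (forall x y, S x -> adj G x y -> S y) ->
  connect (adj G) x y -> S x -> S y.
Proof. by move=> H /connectP[p]; elim: p x => [|z p IH] x /= => [_ ->|/andP[xz pz] El Sx] //; exact: IH pz El (H _ _ Sx xz). Qed.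

Lemma grown_exists : graph_connected G -> (0 < nv G)%N -> exists u, grown u (nv G).
Proof.
move=> conn n0; suff H m : (m < nv G)%N -> exists u, grown u m.+1.
  by have := H (nv G).-1; rewrite prednK //; apply.
elim: m => [_|m IH mn].
  by exists (fun=> Ordinal n0); split=> [[|i] [|j]|k] //; lia.
have [u [inj par]] := IH (ltnW mn).
pose S : pred V := fun x => [exists i : 'I_m.+1, x == u i].
have [x nSx] : exists x, ~~ S x.
  apply/existsP; rewrite -negb_forall; apply/negP => /forallP all.
  have /choice[f fP] : forall x : V, exists i : 'I_m.+1, x = u i.
    by move=> x; have /existsP[i /eqP] := all x; exists i.
  have : (nv G <= m.+1)%N.
    by rewrite -[nv G]card_ord -[m.+1]card_ord; apply: (leq_card f) => y z E; rewrite (fP y) (fP z) E.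
  lia.
have [a [b [Sa Sb ab]]] : exists a b, [/\ S a, ~~ S b & adj G a b].
  apply: contrapT => H; have S0 : S (u 0%N) by apply/existsP; exists ord0.
  move/negP: nSx; apply; apply: connect_invariant (conn (u 0%N) x) S0 => a b Sa ab.
  by apply: contrapT => /negP Sb; apply: H; exists a, b.
have [i /eqP ai] := existsP Sa.
have nb j : (j < m.+1)%N -> u j <> b.
  by move=> jm E; move/negP: Sb; apply; apply/existsP; exists (Ordinal jm); rewrite E.
exists (fun j => if j == m.+1 then b else u j); split=> [j k|k].
  have [-> | nj] := eqVneq j m.+1; have [-> | nk] := eqVneq k m.+1 => // jm km E.
  - by exfalso; apply: (nb k); [lia | rewrite E].
  - by exfalso; apply: (nb j); [lia | rewrite E].
  - by apply: inj => //; lia.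
case: eqP => [-> _|nk km]; first by exists i => //; rewrite ltn_eqF // -ai.
have [|k' k'k ak] := par k; first by lia.
by exists k' => //; rewrite ifF //; apply/eqP; lia.
Qed.

Lemma grown_onto u : grown u (nv G) -> forall x, exists2 k, (k < nv G)%N & u k = x.
Proof.
move=> [inj _]; have fi : injective (fun k : 'I_(nv G) => u k).
  by move=> i j E; apply: val_inj; apply: inj E; exact: ltn_ord.
have [g _ gK] := injF_bij fi.
by move=> x; exists (g x).
Qed.

(* Two earlier neighbours of one vertex would close a cycle. *)
Lemma grown_parent u a b k : acyclic G -> grown u (nv G) -> (a < b < nv G)%N -> (k < b)%N ->
  adj G (u a) (u b) -> adj G (u k) (u b) -> k = a.
Proof.
move=> ac gu /andP[ab bn] kb Aab Akb; apply: contrapT => /eqP ka; have [inj par] := gu.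
(* The graph without the edge between [u a] and [u b] is still connected, as [u b] can be attached
   through [u k]. A simple path from [u a] to [u b] in it is closed to a cycle by the removed
   edge. *)
pose e' : rel V := fun x y => adj G x y && ~~ (((x == u a) && (y == u b)) || ((x == u b) && (y == u a))).
have e'S : symmetric e' by move=> x y; rewrite /e' adj_sym orbC ![(y == _) && _]andbC.
have dif i j : (i < nv G)%N -> (j < nv G)%N -> i != j -> (u i == u j) = false.
  by move=> iN jN; apply: contraNF => /eqP /inj ->.
have conn j : (j < nv G)%N -> connect e' (u 0%N) (u j).
  have [m] := ubnP j; elim: m j => // m IH [|j] // jm jn.
  have [k' [k'j A' ok]] : exists k', [/\ (k' < j.+1)%N, adj G (u k') (u j.+1) & e' (u k') (u j.+1)].
    have [E|jb] := eqVneq j.+1 b.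
      rewrite E; exists k; split=> //; rewrite /e' Akb /= (dif k a) ?(dif k b) //; lia.
    have [|k' k'j A'] := par j.+1; first by lia.
    exists k'; split=> //; rewrite /e' A' /= (dif j.+1 b) // andbF /=.
    apply/negP => /andP[/eqP/inj k'b /eqP/inj ja]; have := k'b ltac:(lia) bn; have := ja jn ltac:(lia); lia.
  by apply: connect_trans (connect1 ok); apply: IH; lia.
have : connect e' (u a) (u b).
  apply: connect_trans (conn b bn); rewrite (sym_connect_sym e'S); apply: conn; lia.
move=> /connectP[p0 /shortenP[p pp up _] lp].
have sub : subrel e' (adj G) by move=> x y /andP[].
apply: (ac (u a :: p)); last first.
  by rewrite /ucycle up andbT /= rcons_path (sub_path sub pp) -lp adj_sym.
case: p pp up lp => [_ _ /= /eqP|z [|z' p]] //=; first by rewrite dif //; lia.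
by move=> + _ E; rewrite -E andbT /e' !eqxx andbF.
Qed.

(** An edge is sent to its later end in a growing order; by [grown_parent] this end determines the
    other one. Work per edge of G1 can thus be charged to [nv G1]. *)
Lemma tree_edges : is_tree G -> (0 < nv G)%N -> (ne G <= nv G)%N.
Proof.
move=> [conn ac] n0; have [u gu] := grown_exists conn n0.
have /choice[f fP] : forall e : 'I_(ne G), exists b : 'I_(nv G), exists2 a, (a < b)%N &
    ends e = (u a, u b) \/ ends e = (u b, u a).
  move=> e; have [i iN ui] := grown_onto gu (ends e).1; have [j jN uj] := grown_onto gu (ends e).2.
  have := ends_loopless e; rewrite -ui -uj => /eqP nij.
  have E : ends e = (u i, u j) by rewrite ui uj -surjective_pairing.
  have [ij|ji|ij] := ltngtP i j; [exists (Ordinal jN); exists i => //; by left| |by rewrite ij in nij].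
  by exists (Ordinal iN), j => //; right.
rewrite -[X in (X <= _)%N]card_ord -[X in (_ <= X)%N]card_ord; apply: (leq_card f) => e e' E.
have [a ab H] := fP e; have [a' ab' H'] := fP e'; rewrite -E in ab' H'.
have A : adj G (u a) (u (f e)) by apply/adjP; exists e.
have A' : adj G (u a') (u (f e)) by apply/adjP; exists e'.
have aa : a' = a by apply: (grown_parent ac gu) A A' => //; rewrite ab ltn_ord.
by apply: ends_simple; rewrite aa in H'; case: H => ->; case: H' => ->; tauto.
Qed.

Lemma connected_inc : graph_connected G -> (0 < ne G)%N -> forall w, exists j, @inc R d G j w.
Proof.
move=> conn m0 w; set e := Ordinal m0.
have [z zw] : exists z, w != z.
  have [->|] := eqVneq w (ends e).1; last by exists (ends e).1.
  by exists (ends e).2; exact: ends_loopless.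
have /connectP[[|y p] /=] := conn w z; first by move=> _ E; rewrite E eqxx in zw.
move=> /andP[/adjP[j H] _] _; exists j; rewrite /inc.
by case: H => ->; rewrite eqxx ?orbT.
Qed.

(** Every vertex is an end of some edge. This turns costs in n2 into costs in m2. *)
Lemma connected_nv : graph_connected G -> (0 < ne G)%N -> (nv G <= 2 * ne G)%N.
Proof.
move=> conn m0; have /choice[f fP] : forall w : V, exists x : 'I_(ne G) * bool,
    w = if x.2 then (ends x.1).1 else (ends x.1).2.
  by move=> w; have [j /orP[]/eqP ->] := connected_inc conn m0 w; [exists (j, true)|exists (j, false)].
have : (#|'I_(nv G)| <= #|{: 'I_(ne G) * bool}|)%N.
  by apply: (leq_card f) => x y E; rewrite (fP x) (fP y) E.
by rewrite card_prod card_bool !card_ord mulnC.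
Qed.

End Trees.

(** * Correctness of the program *)

Section Adjacency.
Context {R : realType} {d : nat} (G : embgraph R d).
Implicit Types (s : state R).
Notation any := (fun _ _ => True).

Definition half_list (own : nat -> nat) N y := rev [seq h <- iota 0 N | own h == y].

(** [own h] is the vertex that half-edge [h] leaves. It is cell [h] of the edge list itself, where
    edge j occupies the cells 2j and 2j + 1; the opposite half-edge is the other cell of the
    pair. *)
Record linked_lists (own : nat -> nat) N s : Prop := {
  ll_list : forall y, (y < nv G)%N -> llist (imem s 9) (imem s 8 y) (half_list own N y);
  ll_tgt : forall h, (h < N)%N -> imem s 10 h = own (if odd h then h.-1 else h.+1);
  ll_edge : forall h, (h < N)%N -> imem s 11 h = h./2 }.

Lemma mem_half_list own N y h : (h \in half_list own N y) = (h < N)%N && (own h == y).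
Proof. by rewrite mem_rev mem_filter mem_iota andbC. Qed.

Lemma half_listS own N y : half_list own N.+1 y =
  if own N == y then N :: half_list own N y else half_list own N y.
Proof.
rewrite /half_list -[N.+1]addn1 iotaD filter_cat rev_cat /= add0n.
by case: eqP.
Qed.

Lemma linked_lists_step own N s s' : linked_lists own N s -> (own N < nv G)%N ->
  imem s' 9 =1 upd (imem s 9) N (imem s 8 (own N)) ->
  imem s' 8 =1 upd (imem s 8) (own N) N.+1 ->
  imem s' 10 =1 upd (imem s 10) N (own (if odd N then N.-1 else N.+1)) ->
  imem s' 11 =1 upd (imem s 11) N N./2 -> linked_lists own N.+1 s'.
Proof.
move=> [h1 h2 h3] oN e9 e8 e10 e11; split.
- move=> y yn; rewrite half_listS e8.
  have ext h l : llist (upd (imem s 9) N (imem s 8 (own N))) h l -> llist (imem s' 9) h l.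
    by elim: l h => //= x l IH h [-> H]; split=> //; rewrite e9; exact: IH.
  have Nl z : N \notin half_list own N z by rewrite mem_half_list ltnn.
  case: (eqVneq (own N) y) => [<-|ny].
    rewrite updE /=; split=> //; rewrite e9 updE; apply: ext; apply: llist_upd => //.
    exact: h1.
  by rewrite updN 1?eq_sym //; apply: ext; apply: llist_upd => //; exact: h1.
- move=> h; rewrite ltnS leq_eqVlt e10 => /predU1P[->|hN]; first by rewrite updE.
  by rewrite updN ?h2 // ltn_eqF.
- move=> h; rewrite ltnS leq_eqVlt e11 => /predU1P[->|hN]; first by rewrite updE.
  by rewrite updN ?h3 // ltn_eqF.
Qed.

Lemma enc_own g s h : encodes G g s -> (h < 2 * ne G)%N -> (imem s g h < nv G)%N.
Proof.
move=> E hm; have h2 : (h./2 < ne G)%N by lia.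
have := odd_double_half h; rewrite -mul2n; case: (odd h) => <-.
  by rewrite addnC (enc_end2 E (Ordinal h2)).
by rewrite (enc_end1 E (Ordinal h2)).
Qed.

Lemma half_list_adj1 g s own (a : 'I_(nv G)) h : imem s g = own -> encodes G g s ->
  h \in half_list own (2 * ne G) a ->
  exists j (z : 'I_(nv G)), [/\ own (if odd h then h.-1 else h.+1) = z, inc j a & inc j z].
Proof.
move=> Ho E; rewrite mem_half_list => /andP[hm /eqP oa].
have h2 : (h./2 < ne G)%N by lia.
have E1 := enc_end1 E (Ordinal h2); have E2 := enc_end2 E (Ordinal h2); rewrite Ho /= in E1 E2.
have hE := odd_double_half h; rewrite -mul2n in hE.
exists (Ordinal h2); case: ifP => oh; rewrite oh in hE.
  have hE1 : h = (2 * h./2 + 1)%N by lia.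
  exists (ends (Ordinal h2)).1; split; last by rewrite /inc eqxx.
    by rewrite -E1; congr own; lia.
  have -> : a = (ends (Ordinal h2)).2 by apply: val_inj; rewrite /= -oa -E2; congr own.
  by rewrite /inc eqxx orbT.
have hE1 : h = (2 * h./2)%N by lia.
exists (ends (Ordinal h2)).2; split; last by rewrite /inc eqxx orbT.
  by rewrite -E2; congr own; lia.
by rewrite /inc -!val_eqE -[val a]oa {1}hE1 E1 eqxx.
Qed.

Lemma half_list_adj2 g s own j (a z : 'I_(nv G)) : imem s g = own -> encodes G g s ->
  inc j a -> inc j z -> a != z ->
  exists2 h, h \in half_list own (2 * ne G) a & own (if odd h then h.-1 else h.+1) = z.
Proof.
move=> Ho E; have E1 := enc_end1 E j; have E2 := enc_end2 E j; rewrite Ho in E1 E2.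
have jm := ltn_ord j.
have odd1 : odd (2 * j + 1) = true by rewrite addn1 oddS mul2n odd_double.
have odd0 : odd (2 * j) = false by rewrite mul2n odd_double.
move=> /orP[]/eqP -> /orP[]/eqP ->; rewrite ?eqxx // => _.
  exists (2 * j)%N; first by rewrite mem_half_list E1 eqxx andbT; lia.
  by rewrite odd0 -addn1 E2.
exists (2 * j + 1)%N; first by rewrite mem_half_list E2 eqxx andbT; lia.
by rewrite odd1 addn1 /= E1.
Qed.

Lemma half_list_sum own : (\sum_(y <- iota 0 (nv G)) (1 + size (half_list own (2 * ne G) y))
  <= nv G + 2 * ne G)%N.
Proof.
rewrite big_split /= sum1_size size_iota leq_add2l.
under eq_bigr do rewrite size_rev.
exact: sum_size_owner.
Qed.

Context (W : nat) (W100 : (100 < W)%N) (Wn : (2 * nv G + 4 < W)%N) (Wm : (2 * ne G + 4 < W)%N).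

Definition half_cell (b : bool) :=
  if b then IAdd (IMul (INat 2) (ivar 22)) (INat 1) else IMul (INat 2) (ivar 22).

Lemma add_halfP (b : bool) g s j own : imem s g = own -> g = 1%N \/ g = 2%N -> encodes G g s ->
  (j < ne G)%N -> imem s 22 0 = j -> linked_lists own (2 * j + b) s ->
  htk W any (add_half g (half_cell b) (half_cell (~~ b))) s 1 (linked_lists own (2 * j + b).+1).
Proof.
move=> Ho gE E jm sj ll; apply: htk_wp => //.
have o1 : (own (2 * j) < nv G)%N by rewrite -Ho; apply: enc_own E _; lia.
have o2 : (own (2 * j + 1) < nv G)%N by rewrite -Ho; apply: enc_own E _; lia.
have jW : (j < W)%N by lia.
have j2W : (2 * j < W)%N by lia.
have j2W' : (2 * j + 1 < W)%N by lia.
have j2W'' : (2 * j + 1 + 1 < W)%N by lia.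
have o1W : (own (2 * j) < W)%N by lia.
have o2W : (own (2 * j + 1) < W)%N by lia.
have c0 : (0 < W)%N by lia.
have c1 : (1 < W)%N by lia.
have c2 : (2 < W)%N by lia.
have listW y h l : llist (imem s 9) h l -> l = half_list own (2 * j + b) y -> (h < W)%N.
  case: l => /= [-> //|x l [-> _] El].
  have : x \in half_list own (2 * j + b) y by rewrite -El mem_head.
  by rewrite mem_half_list => /andP[xlt _]; have := leq_b1 b; lia.
have hdW y : (y < nv G)%N -> (imem s 8 y < W)%N.
  by move=> yn; exact: (listW y) (ll_list ll yn) erefl.
have hd1 := hdW _ o1; have hd2 := hdW _ o2.
have odd1 : odd (2 * j + 1) = true by rewrite addn1 oddS mul2n odd_double.
have odd0 : odd (2 * j) = false by rewrite mul2n odd_double.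
have half0 : (2 * j)./2 = j by rewrite mul2n doubleK.
have half1 : (2 * j + 1)./2 = j by lia.
case: gE Ho => -> Ho; case: b ll listW => ll listW; rewrite /= ?addn0 in ll listW *; rewrite !sj Ho;
  (do 4!split=> //); apply: (linked_lists_step ll) => //= k; rewrite ?odd1 ?odd0 ?half0 ?half1 ?addn1 //.
Qed.

Lemma build_adjP g s own kn km M : imem s g = own -> g = 1%N \/ g = 2%N -> encodes G g s ->
  imem s 0 kn = nv G -> imem s 0 km = ne G -> (kn < W)%N -> (km < W)%N ->
  (0 < nv G <= M)%N -> (0 < ne G <= M)%N ->
  htk W any (build_adj g (IGet 0 (INat kn)) (IGet 0 (INat km))) s M (linked_lists own (2 * ne G)).
Proof.
move=> Ho gE E en em knW kmW /andP[n0 nM] /andP[m0 mM].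
have c0 : (0 < W)%N by lia.
have g8 : (g < 8)%N by case: gE => ->.
have gn a : (7 < a)%N -> (g == a) = false by move=> ?; apply/eqP; lia.
have frame im rm s1 s2 : same im rm s1 s2 -> all (fun a => 7 < a)%N im -> all (fun a => 7 < a)%N rm ->
    [/\ imem s2 g = imem s1 g, imem s2 0 =1 imem s1 0 & encodes G g s1 -> encodes G g s2].
  move=> [hi hr] /allP ai /allP ar.
  have gi a : (a < 8)%N -> imem s2 a =1 imem s1 a.
    by move=> a8; apply: hi; apply/negP => /ai; lia.
  have gr a : (a < 8)%N -> rmem s2 a =1 rmem s1 a.
    by move=> a8; apply: hr; apply/negP => /ar; lia.
  split; [exact/funext/gi | exact: gi |].
  by move=> [h1 h2 h3]; split=> *; rewrite ?gi ?gr.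
apply: (@htk_seq _ _ _ _ _ _ _ (fun s' => forall y, (y < nv G)%N -> imem s' 8 y = 0%N)).
  apply: (@htk_for _ _ _ (fun k s' => forall y, (y < k)%N -> imem s' 8 y = 0%N) _ _ _ _ (nv G) (nv G) 1) => //.
  - by split=> //=; rewrite en; lia.
  - by rewrite muln1.
  - move=> k s1 kn' Ik sk sm; apply: htk_wp => //.
    have kW : (k < W)%N by lia.
    rewrite /= sk; split=> // y; rewrite ltnS leq_eqVlt => /predU1P[->|yk]; first by rewrite /= eqxx.
    by rewrite /= ltn_eqF // Ik.
move=> s1 z8 f1; have [go zo eo] := frame _ _ _ _ f1 isT isT.
have E1 := eo E.
apply: (@htk_for _ _ _ (fun k s' => linked_lists own (2 * k) s') _ _ _ _ (ne G) (ne G) 1) => //.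
- by split=> //=; rewrite zo em; lia.
- by rewrite /= zo.
- by rewrite muln1.
- by move=> k s2 m [h1 h2 h3]; split.
- move=> k s2 km' Ik sk sm; have [go2 _ eo2] := frame _ _ _ _ sm isT isT.
  have Ho2 : imem s2 g = own by rewrite go2 go.
  have E2 := eo2 E1.
  have h0 : linked_lists own (2 * k + false) s2 by rewrite addn0.
  apply: (htk_seq (add_halfP Ho2 gE E2 km' sk h0)) => s3 h3 f3.
  have [go3 _ eo3] := frame _ _ _ _ f3 isT isT.
  have Ho3 : imem s3 g = own by rewrite go3.
  have sk3 : imem s3 22 0 = k by rewrite f3.1.
  have h1 : linked_lists own (2 * k + true) s3 by rewrite addn1 -[(2 * k)%N]addn0.
  apply: htk_post (add_halfP Ho3 gE (eo3 E2) km' sk3 h1) _ => s4 h4 _.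
  have -> : (2 * k.+1 = (2 * k + true).+1)%N by rewrite /=; lia.
  exact: h4.
Qed.

End Adjacency.

(** * The search loop *)

Section Search.
Context {R : realType} (W n : nat).
Implicit Types (s : state R).
Context (W100 : (100 < W)%N) (nW : (n + 1 < W)%N).
Notation any := (fun _ _ => True).

Definition search_inv L (lo hi : nat -> R) src ord rooted nx tg s Lc :=
  sinv n L nx tg lo hi src ord rooted (imem s 27 0) (imem s 28 0) (imem s 29 0) (imem s 21 0)
    (imem s 12) (imem s 13) (imem s 14) (imem s 15) (rmem s 10) (rmem s 11 0) Lc.

Lemma searchP s kn L src (rooted : Prop) X : imem s 0 kn = n -> (kn < W)%N ->
  (forall y, (y < n)%N -> llist (imem s 9) (imem s 8 y) (L y)) ->
  (forall y h, (y < n)%N -> h \in L y -> (imem s 10 h < n)%N) ->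
  (forall y h, (y < n)%N -> h \in L y -> (h.+1 < W)%N) ->
  let inv := search_inv L (rmem s 8) (rmem s 9) src (imem s 16) rooted (imem s 9) (imem s 10) in
  inv s [::] -> (smu n L (imem s 28 0) (imem s 21 0) (imem s 12) [::] < X)%N ->
  htk W any (search (IGet 0 (INat kn))) s X (fun s' =>
    [/\ exists Lc, inv s' Lc, imem s' 27 0 = 0%N, (imem s' 29 0 <= imem s' 28 0)%N & (n <= imem s' 21 0)%N]).
Proof.
move=> en knW hdL tgL hW inv I0 muX; rewrite -[X]muln1.
have c0 : (0 < W)%N by lia.
have c1 : (1 < W)%N by lia.
pose I m s1 := same (imods (search (IGet 0 (INat kn)))) (rmods (search (IGet 0 (INat kn)))) s s1 /\
  exists2 Lc, m = smu n L (imem s1 28 0) (imem s1 21 0) (imem s1 12) Lc & inv s1 Lc.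
(* A nonzero pointer is a half-edge number plus 1, and the half-edge leaves a vertex of the
   queue. *)
have ptrW s1 Lc c l : inv s1 Lc -> llist (imem s 9) c l -> {subset l <= Lc} -> (c < W)%N.
  move=> H; case: l => [/= -> //|x l [-> _] sub].
  have xL : x \in Lc by apply: sub; rewrite mem_head.
  have [|q0 sL _] := s_Lc H; first by case: (Lc) xL.
  apply: (hW (imem s1 12 (imem s1 28 0).-1)); last exact: sL.
  by apply: (s_lt H); apply: mkseq_mem; have [] := s_q H; lia.
have facts m s1 : I m s1 -> [/\ (imem s1 27 0 < W)%N, (imem s1 28 0 + 1 < W)%N, (imem s1 29 0 + 1 < W)%N & (imem s1 21 0 < W)%N].
  move=> [f [Lc mE H]]; have [a b _] := s_q H; have c := sinv_qe_le H.
  split; try lia.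
  exact: ptrW H (s_cur H) _.
apply: (@htk_while _ _ _ I _ _ _ (smu n L (imem s 28 0) (imem s 21 0) (imem s 12) [::])) => //.
- move=> m s1 Im; have [a b c e] := facts _ _ Im; have [f _] := Im.
  have z0 : imem s1 0 kn = n by rewrite f.1.
  have nW' : (n < W)%N by lia.
  have b' : (imem s1 28 0 < W)%N by lia.
  have c' : (imem s1 29 0 < W)%N by lia.
  by rewrite /= z0.
- move=> m s1 [f [Lc mE H]] /= /negbFE/and3P[h1 h2 h3].
  by split; [exists Lc | lia | | rewrite -en -(f.1 0%N isT kn)].
- move=> m s1 Im; have [cW qsW qeW iW] := facts _ _ Im.
  have qsW' : (imem s1 28 0 < W)%N by lia.
  have qeW' : (imem s1 29 0 < W)%N by lia.
  have [f [Lc mE H]] := Im => guard.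
  have r9 x : imem s1 9 x = imem s 9 x by rewrite f.1.
  have r8 x : imem s1 8 x = imem s 8 x by rewrite f.1.
  have r10 x : imem s1 10 x = imem s 10 x by rewrite f.1.
  have r16 x : imem s1 16 x = imem s 16 x by rewrite f.1.
  have rl x : rmem s1 8 x = rmem s 8 x by rewrite f.2.
  have rh x : rmem s1 9 x = rmem s 9 x by rewrite f.2.
  have step s2 : (exists2 Lc', inv s2 Lc' &
      (smu n L (imem s2 28 0) (imem s2 21 0) (imem s2 12) Lc' < smu n L (imem s1 28 0) (imem s1 21 0) (imem s1 12) Lc)%N) ->
    same (imods (search (IGet 0 (INat kn)))) (rmods (search (IGet 0 (INat kn)))) s1 s2 ->
    exists2 m', (m' < m)%N & I m' s2.
    move=> [Lc' H' lt] f'; exists (smu n L (imem s2 28 0) (imem s2 21 0) (imem s2 12) Lc'); first by rewrite mE.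
    by split; [exact: same_trans f'|exists Lc'].
  apply: (@htk_post _ _ _ _ _ _ (fun s2 => exists2 Lc', inv s2 Lc' &
      (smu n L (imem s2 28 0) (imem s2 21 0) (imem s2 12) Lc' < smu n L (imem s1 28 0) (imem s1 21 0) (imem s1 12) Lc)%N));
    last by move=> s2 h1 h2; exact: step.
  apply: htk_wp => //=.
  split=> //; case: ifP => cur.
    have cE : imem s1 27 0 = (imem s1 27 0 - 1).+1 by lia.
    set h := (imem s1 27 0 - 1)%N in cE *.
    have H' := H; rewrite /inv /search_inv cE in H'.
    have [l' [El ll]] := llist_cons (s_cur H').
    have tn := sinv_target tgL H'.
    have hW' : (h < W)%N by lia.
    have tW : (imem s 10 h < W)%N by lia.
    have nxW : (imem s 9 h < W)%N.
      by apply: ptrW H ll _ => x xl; rewrite El inE xl orbT.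
    have re01 := s_re H' tn.
    have reW : (imem s1 13 (imem s 10 h) < W)%N by rewrite re01; case: (_ \in _).
    rewrite r10 r9 rl rh.
    split=> //; split=> //; split=> //; split=> //.
    case: ifP => re0; last first.
      by apply: (sinv_skip tgL H'); left; rewrite ltnNge re0.
    split=> //; case: ifP => lt.
      split=> //; case: ifP => ht; last first.
        by apply: (sinv_skip tgL H'); right; split=> //; rewrite ltNge ht.
      split=> //; split=> //; split=> //; split=> //; split=> //.
      have rz : imem s1 13 (imem s 10 h) = 0%N by lia.
      have lh : rmem s 8 (imem s 10 h) <= rmem s1 11 0 <= rmem s 9 (imem s 10 h) by rewrite lt ht.
      by rewrite addn1; exact: (sinv_push tgL H' rz lh).
    by split=> //; apply: (sinv_wait tgL H'); rewrite ltNge lt.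
  have cE : imem s1 27 0 = 0%N by lia.
  have H' := H; rewrite /inv /search_inv cE in H'.
  split=> //; case: ifP => qq.
    have qq' : (imem s1 28 0 < imem s1 29 0)%N by lia.
    have yn : (imem s1 12 (imem s1 28 0) < n)%N by apply: (s_lt H'); exact: mkseq_mem.
    have yW : (imem s1 12 (imem s1 28 0) < W)%N by lia.
    have hdW : (imem s 8 (imem s1 12 (imem s1 28 0)) < W)%N.
      have := hdL _ yn; case El: (L _) => [|x l] /=; first by move=> ->.
      by move=> [-> _]; apply: (hW (imem s1 12 (imem s1 28 0))); rewrite ?El ?mem_head.
    rewrite r8; split=> //; split=> //.
    by rewrite addn1; exact: (sinv_dequeue hdL H' qq').
  have qq' : (imem s1 29 0 <= imem s1 28 0)%N by lia.
  have z0 : imem s1 0 kn = n by rewrite f.1.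
  have iN : (imem s1 21 0 < n)%N by move: guard; rewrite /= cE z0 qq' /=; lia.
  have [on _] := s_ord H' (i' := imem s1 21 0) ltac:(lia).
  have oW : (imem s 16 (imem s1 21 0) < W)%N by lia.
  have iW' : (imem s1 21 0 + 1 < W)%N by lia.
  have re01 := s_re H' on.
  have reW : (imem s1 13 (imem s 16 (imem s1 21 0)) < W)%N by rewrite re01; case: (_ \in _).
  have peW : (imem s1 14 (imem s 16 (imem s1 21 0)) < W)%N.
    by have := s_pe1 H' on; lia.
  rewrite r16 rl rh.
  do 4!split=> //.
  case: ifP => cond.
    do 4!split=> //.
    have [h1 h2] := sinv_advance_push H' qq' iN cond.
    by exists Lc; rewrite /inv /search_inv /= ?cE !addn1.
  have [h1 h2] := sinv_advance H' qq' iN (negbT cond).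
  by exists Lc; rewrite /inv /search_inv /= ?cE !addn1.
- by split=> //; exists [::].
Qed.

End Search.

Lemma linked_lists_same (R : realType) d (G : embgraph R d) own N im rm (s s' : state R) :
  same im rm s s' -> all (fun a => a \notin im) [:: 8; 9; 10; 11] ->
  linked_lists G own N s -> linked_lists G own N s'.
Proof.
move=> [h _] /= /and5P[i8 i9 i10 i11 _] [h1 h2 h3]; split.
- by move=> y yn; rewrite (funext (h _ i9)) h //; exact: h1.
- by move=> x xN; rewrite h //; exact: h2.
- by move=> x xN; rewrite h //; exact: h3.
Qed.

Lemma cell_inj m r r' l l' : (l < m)%N -> (l' < m)%N -> (r * m + l == r' * m + l')%N = (r == r') && (l == l').
Proof.
move=> lm lm'; apply/eqP/andP => [E|[/eqP -> /eqP ->] //].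
have m0 : (0 < m)%N by lia.
have /(congr1 (divn^~ m)) := E; rewrite /= !divnMDl // !divn_small // !addn0 => rr'.
by rewrite rr' eqxx; split=> //; apply/eqP/(@addnI (r * m)); rewrite E rr'.
Qed.

(** The alternative [class l] accounts for certificates without crossings. *)
Lemma reached_cert (R : realType) d (G : embgraph R d) (p q : 'rV[R]_d) eps
    (L : nat -> seq nat) (tg : nat -> nat) (lo hi : nat -> R)
    (class : 'I_(ne G) -> Prop) l : 0 <= eps ->
  (forall (a : 'I_(nv G)) h, h \in L a -> exists j (z : 'I_(nv G)), [/\ tg h = z, inc j a & inc j z]) ->
  (forall j (a z : 'I_(nv G)), inc j a -> inc j z -> a != z -> exists2 h, h \in L a & tg h = z) ->
  (forall w : 'I_(nv G), window_spec (lo w) (hi w) p q (pos w) eps) ->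
  (class l \/ exists (w : 'I_(nv G)) t, inc l w /\ VR (nv G) L tg lo hi (source class) w t) <->
  exists2 i, class i & cert p q eps i l.
Proof.
move=> e0 a1 a2 win; split; last first.
  by move=> [i ci [K tr]]; apply: VR_of_cert tr.
move=> [cl|[w [t [lw V]]]]; first by exists l => //; exists [::]; split.
have t1 : t <= 1.
  suff : lo w <= t <= hi w by move=> /((win w).2 t).2[/andP[]].
  by case: V => [z t' _ _ //|y z t0 t' h _ _ _ _ //].
have [w' /val_inj <- [i ci H]] := cert_of_VR a1 win V.
by have [K tr] := H l lw; exists i => //; exists K; exact: trav_weaken tr.
Qed.

Lemma sinv_start (R : realType) n L nx tg (lo hi : nat -> R) src ord Q re pe pa D :
  (forall w, (w < n)%N -> re w = 0%N) -> (forall w, (w < n)%N -> pe w = `[< src w >] :> nat) ->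
  (forall i, (i < n)%N -> (ord i < n)%N) ->
  (forall w, (w < n)%N -> exists2 i, (i < n)%N & ord i = w) ->
  (forall i i', (i <= i')%N -> (i' < n)%N -> lo (ord i) <= lo (ord i')) ->
  (forall w, (w < n)%N -> 0 <= lo w) ->
  sinv n L nx tg lo hi src ord False 0 0 0 0 Q re pe pa D 0 [::].
Proof.
move=> re0 peE on oo os l0; split=> //.
- by move=> z zn; rewrite peE // lt0b => /asboolP; left.
- by move=> z zn sz; rewrite peE // lt0b; apply/asboolP.
- by move=> z zn _ _; right; have [i iN E] := oo z zn; exists i.
- by move=> i iN; split; [exact: on | apply: l0; exact: on].
- by move=> z zn; right; have [i iN E] := oo z zn; exists i.
- by move=> z zn; rewrite peE // leq_b1.
Qed.

(** The root is in the queue from the start, and [i = n] excludes any move of the clock. *)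
Lemma sinv_root (R : realType) n L nx tg (lo hi : nat -> R) ord (Q re pe pa : nat -> nat) D : (0 < n)%N ->
  (forall y, (y < n)%N -> lo y = 0 /\ hi y = 0) -> Q 0%N = 0%N -> D 0%N = 0 ->
  (forall y, (y < n)%N -> re y = (y == 0%N)) -> (forall y, (y < n)%N -> pe y = (y == 0%N)) ->
  sinv n L nx tg lo hi (fun z => z = 0%N) ord True 0 0 1 n Q re pe pa D 0 [::].
Proof.
move=> n0 w0 Q0 D0 reE peE; have mQ y : (y \in mkseq Q 1) = (y == 0%N) by rewrite inE Q0.
have [lo0 hi0] := w0 0%N n0.
split=> //; try by move=> *; lia.
- by move=> y; rewrite mQ => /eqP ->.
- by move=> y yn; rewrite reE // mQ.
- by move=> k; rewrite ltnS leqn0 => /eqP ->; rewrite Q0.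
- by move=> y; rewrite mQ => /eqP ->; rewrite D0 lo0 hi0 !lexx.
- by move=> y; rewrite mQ => /eqP ->; apply: VR_src; rewrite // lo0 hi0 D0 lexx.
- by move=> z zn; rewrite peE // lt0b => /eqP; left.
- by move=> z zn ->; rewrite peE.
- by move=> z zn; rewrite peE // lt0b => /eqP -> _; left; rewrite mQ D0 lo0.
- by move=> z zn; left; rewrite (w0 z zn).1.
- by move=> _; split=> // k; lia.
- by move=> z zn; rewrite peE // leq_b1.
Qed.

Section Correctness.
Context {R : realType} {d : nat} (G1 G2 : embgraph R d) (eps : R) (W : nat).
Implicit Types (s : state R).

(** Everything about sizes that the verification uses: indices and counters stay below [W], and
    [nv G2] and [ne G1] are of the order of [ne G2] and [nv G1]. *)
Record bounds : Prop := {
  b_const : (100 < W)%N;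
  b_d : (d < W)%N;
  b_g1 : (nv G1 * d.+1 < W)%N;
  b_g2 : (nv G2 * d.+1 < W)%N;
  b_n1_gt0 : (0 < nv G1)%N;
  b_n1 : (2 * nv G1 + 4 < W)%N;
  b_n2 : (2 * nv G2 + 4 < W)%N;
  b_m1 : (2 * ne G1 + 4 < W)%N;
  b_m2 : (2 * ne G2 + 4 < W)%N;
  b_m1n1 : (ne G1 <= nv G1)%N;
  b_cube : (nv G1 * ne G2 * ne G2 + ne G2 < W)%N;
  b_m2_gt0 : (0 < ne G2)%N;
  b_n2m2 : (nv G2 <= 2 * ne G2)%N;
  b_inc : forall w : 'I_(nv G2), exists j, inc j w }.

Context (bd : bounds) (eps0 : 0 < eps) (tree : is_tree G1) (m1_gt0 : (0 < ne G1)%N).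
Notation inputs := (inputs G1 G2 eps).
Notation n1 := (nv G1).
Notation n2 := (nv G2).
Notation m2 := (ne G2).
Notation V := 'I_(nv G1).
Notation E := 'I_(ne G1).

Lemma lt_const k : (k <= 100)%N -> (k < W)%N.
Proof. by move=> h; apply: leq_ltn_trans h (b_const bd). Qed.

Lemma lt_cell v j : (v < nv G1)%N -> (j < ne G2)%N -> (v * ne G2 < W)%N /\ (v * ne G2 + j < W)%N.
Proof.
move=> vn jm; have := b_cube bd; have := b_m2_gt0 bd.
move: (nv G1) (ne G2) vn jm => n m vn jm m0 H.
have : (v.+1 * m <= n * m)%N by rewrite leq_mul2r vn orbT.
have : (n * m <= n * m * m)%N by rewrite leq_pmulr.
rewrite mulSn; lia.
Qed.

(** Two alternative stores are treated as one store of a truth value, so that consecutive flags do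
    not multiply the cases. *)
Lemma wp_flag b a i Q s : bsafe W s b -> isafe W s i ->
  Q (iset s a (iev s i) (bev s b)) ->
  wp W (If b (IStore a i (INat 1)) (IStore a i (INat 0))) Q s.
Proof.
move=> sb si; have h0 := lt_const (isT : 0 <= 100)%N; have h1 := lt_const (isT : 1 <= 100)%N.
by move=> q /=; split=> //; case: (bev s b) q.
Qed.

Lemma wp_flag_seq b a i c Q s : bsafe W s b -> isafe W s i ->
  wp W c Q (iset s a (iev s i) (bev s b)) ->
  wp W (Seq (If b (IStore a i (INat 1)) (IStore a i (INat 0))) c) Q s.
Proof. by move=> sb si q; apply: wp_flag. Qed.

Let W_gt0 : (0 < W)%N. Proof. exact: lt_const. Qed.
Let W_gt1 : (1 < W)%N. Proof. exact: lt_const. Qed.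
Let W_gt2 : (2 < W)%N. Proof. exact: lt_const. Qed.
Let W_gt3 : (3 < W)%N. Proof. exact: lt_const. Qed.

Notation inball v w := (nsq (pos (w : 'I_(nv G2)) - pos (v : 'I_(nv G1))) <= eps ^+ 2).
Notation any := (fun _ _ => True).

Lemma ball_loopP s (v : 'I_(nv G1)) : inputs s -> imem s 34 0 = v ->
  htk W any (ball_loop d) s (ne G2) (fun s' =>
    (forall j : 'I_(ne G2), imem s' 20 j = `[< hits (pos v) eps j >]) /\
    (forall w : 'I_(nv G2), imem s' 17 w = inball v w)).
Proof.
move=> inp sv.
pose I k s := forall j : 'I_(ne G2), (j < k)%N -> imem s 20 j = `[< hits (pos v) eps j >] /\
  forall w, inc j w -> imem s 17 w = inball v w.
apply: (@htk_for _ _ _ I _ _ _ _ (ne G2) (ne G2) 1) => //.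
- by split=> //=; rewrite (in_m2 inp); have := b_m2 bd; lia.
- by rewrite /= (in_m2 inp).
- exact: b_m2_gt0.
- by rewrite muln1.
- move=> k s1 km Ik sk sm.
  have inp1 : inputs s1 by apply: inputs_same sm _ _ inp.
  have sv1 : imem s1 34 0 = v by rewrite sm.1.
  set j := Ordinal km; have jk : imem s1 22 0 = j by [].
  have E1 := enc_end1 (in_g2 inp1) j; have E2 := enc_end2 (in_g2 inp1) j.
  have w1 := ltn_ord (ends j).1; have w2 := ltn_ord (ends j).2.
  have jm := ltn_ord j; have := b_m2 bd => bm2; have := b_n2 bd => bn2; have := b_n1 bd => bn1.
  have vn := ltn_ord v.
  have jW : (j < W)%N by lia.
  have j2W : (2 * j < W)%N by lia.
  have j2W' : (2 * j + 1 < W)%N by lia.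
  have w1W : ((ends j).1 < W)%N by lia.
  have w2W : ((ends j).2 < W)%N by lia.
  have d1 : denotes W s1 (end1 2 (ivar 22)) (ends j).1.
    by split=> /=; rewrite jk E1 //; do !split=> //; lia.
  have d2 : denotes W s1 (end2 2 (ivar 22)) (ends j).2.
    by split=> /=; rewrite jk E2 //; do !split=> //; lia.
  have dv : denotes W s1 (ivar 34) v by split=> //=; rewrite sv1; split=> //; lia.
  have HW := windowP (b_g2 bd) (b_g1 bd) (b_d bd) W_gt0 (isT : 2 < 3)%N (isT : 1 < 3)%N
      (in_g2 inp1) (in_g1 inp1) (in_eps inp1) d1 d2 dv.
  apply: (htk_seq (ht_htk HW)).
  move=> s2 [lo0 spec] sm2; set lo := rmem s2 6 0 in lo0 spec; set hi := rmem s2 7 0 in spec.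
  have inp2 : inputs s2 by apply: inputs_same sm2 _ _ inp1.
  have jk2 : imem s2 22 0 = j by rewrite sm2.1.
  have F1 := enc_end1 (in_g2 inp2) j; have F2 := enc_end2 (in_g2 inp2) j.
  have hitE : (lo <= hi) = `[< hits (pos v) eps j >].
    apply/idP/asboolP => [h|/hitsP[t t01 cl]].
      have [] := (spec lo).2; first by rewrite lexx.
      by move=> t01 cl; apply/hitsP; exists lo.
    by have /andP[] := (spec t).1 (conj t01 cl); exact: le_trans.
  have endE t w : 0 <= t <= 1 -> segment (pos (ends j).1) (pos (ends j).2) t = pos w ->
      (lo <= t) && (t <= hi) = inball v w.
    move=> t01 E; apply/idP/idP => [/(spec t).2[_]|h]; first by rewrite /fclose E.
    by apply/(spec t).1; rewrite /fclose E.
  have e1E : (lo <= 0) && (0 <= hi) = inball v (ends j).1.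
    by apply: endE; [rewrite lexx ler01 | exact: segment0].
  have e2E : (lo <= 1) && (1 <= hi) = inball v (ends j).2.
    by apply: endE; [rewrite ler01 lexx | exact: segment1].
  apply: htk_wp; first by [].
  refine (wp_flag_seq _ _ _); [by []|by rewrite /= jk2|].
  refine (wp_flag_seq _ _ _); [by []|by rewrite /= jk2 F1|].
  refine (wp_flag _ _ _); [by []|by rewrite /= jk2 F2|].
  rewrite /=.
  rewrite -/lo -/hi hitE e1E e2E jk2 F1 F2.
  have keep (j' : 'I_(ne G2)) w : (j' < k)%N -> inc j' w -> imem s2 17 w = inball v w.
    by move=> j'k iw; rewrite sm2.1 //; have [_ ->] := Ik _ j'k.
  (* The current edge may overwrite a vertex that an earlier edge has written; the value is the
     same. *)
  have val17 (w : 'I_(nv G2)) : (inc j w \/ exists2 j' : 'I_(ne G2), (j' < k)%N & inc j' w) ->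
     (if w == (ends j).2 :> nat then nat_of_bool (inball v (ends j).2) else
      if w == (ends j).1 :> nat then nat_of_bool (inball v (ends j).1) else imem s2 17 w) = inball v w.
    have [/val_inj ->//|nw2] := eqVneq (w : nat) (ends j).2.
    have [/val_inj ->//|nw1] := eqVneq (w : nat) (ends j).1.
    case=> [|[j' j'k iw]]; last exact: keep iw.
    by rewrite /inc -!val_eqE /= (negbTE nw1) (negbTE nw2).
  move=> j'; rewrite ltnS leq_eqVlt => /predU1P[Ej|j'k].
    have -> : j' = j by apply: val_inj.
    split; first by rewrite /= eqxx.
    by move=> w iw; apply: val17; left.
  split; first by rewrite /= (ltn_eqF j'k) sm2.1 //; have [] := Ik _ j'k.
  by move=> w iw; apply: val17; right; exists j'.
- move=> s1 H _; split=> [j|w]; first by have [] := H j (ltn_ord j).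
  by have [j jw] := b_inc bd w; have [_] := H j (ltn_ord j); apply.
Qed.

Lemma edgeW2 (j : 'I_(ne G2)) :
  [/\ (j < W)%N, (2 * j < W)%N, (2 * j + 1 < W)%N, ((ends j).1 < W)%N & ((ends j).2 < W)%N].
Proof.
have := ltn_ord j; have := ltn_ord (ends j).1; have := ltn_ord (ends j).2.
by have := b_m2 bd; have := b_n2 bd; split; lia.
Qed.

Lemma m2_safe s : inputs s -> isafe W s m2e.
Proof. by move=> inp; split; [exact: lt_const | rewrite /= (in_m2 inp); have := b_m2 bd; lia]. Qed.

Lemma n2_safe s : inputs s -> isafe W s n2e.
Proof. by move=> inp; split; [exact: lt_const | rewrite /= (in_n2 inp); have := b_n2 bd; lia]. Qed.

Lemma n1_safe s : inputs s -> isafe W s n1e.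
Proof. by move=> inp; split; [exact: lt_const | rewrite /= (in_n1 inp); have := b_n1 bd; lia]. Qed.

Lemma m1_safe s : inputs s -> isafe W s m1e.
Proof. by move=> inp; split; [exact: lt_const | rewrite /= (in_m1 inp); have := b_m1 bd; lia]. Qed.

Lemma n2_gt0 : (0 < nv G2)%N.
Proof. by have := ltn_ord (ends (Ordinal (b_m2_gt0 bd))).1; lia. Qed.

Lemma self_loopP s : inputs s ->
  htk W any self_loop s (2 * ne G2) (fun s' => forall w, (w < nv G2)%N -> imem s' 18 w = w).
Proof.
move=> inp; have n0 := n2_gt0.
pose I k s := forall w, (w < k)%N -> imem s 18 w = w.
apply: (@htk_for _ _ _ I _ _ _ _ (nv G2) (nv G2) 1) => //.
- exact: n2_safe.
- exact: in_n2 inp.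
- by rewrite muln1; exact: b_n2m2.
- move=> k s1 kn Ik sk sm; apply: htk_wp; first by [].
  have kW : (k < W)%N by have := b_n2 bd; lia.
  rewrite /= sk; split=> //.
  move=> w; rewrite ltnS leq_eqVlt => /predU1P[->|wk]; first by rewrite /= eqxx.
  by rewrite /= ltn_eqF //; exact: Ik.
Qed.

(** * Components of a ball by relabelling *)

Section MergeInvariant.
Context (v : 'I_(nv G1)).

(** [mg_rep] keeps the label of a class a fixed point in the ball, by which the class can be
    numbered. Completeness is recorded edge by edge only; this suffices because linked edges share a
    vertex in the ball. *)
Record merged k (f : nat -> nat) : Prop := {
  mg_lt : forall w, (w < nv G2)%N -> (f w < nv G2)%N;
  mg_rep : forall w, inball v w -> exists w' : 'I_(nv G2), [/\ inball v w', f w = w' & f w' = w'];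
  mg_sound : forall w w', inball v w -> inball v w' -> f w = f w' ->
    forall j l, inc j w -> inc l w' -> connect (linked (pos v) eps) j l;
  mg_done : forall j : 'I_(ne G2), (j < k)%N -> inball v (ends j).1 -> inball v (ends j).2 ->
    f (ends j).1 = f (ends j).2 }.

Lemma merged0 f : (forall w, (w < nv G2)%N -> f w = w) -> merged 0 f.
Proof.
move=> F; have Fo (w : 'I_(nv G2)) : f w = w by exact: F.
split=> //.
- by move=> w wn; rewrite F.
- by move=> w iw; exists w; rewrite !Fo.
- move=> w w' iw _; rewrite !Fo => /val_inj <- j l jw lw; apply: connect1.
  by apply/linkedP; exists w.
Qed.

Lemma merged_skip (j : 'I_(ne G2)) f : merged j f ->
  ~~ (inball v (ends j).1 && inball v (ends j).2) -> merged j.+1 f.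
Proof.
move=> [h1 h2 h3 h4] N; split=> // j'; rewrite ltnS leq_eqVlt => /predU1P[/val_inj ->|//].
  by move=> a b; rewrite a b in N.
exact: h4.
Qed.

Lemma merged_step (j : 'I_(ne G2)) f f' : merged j f ->
  inball v (ends j).1 -> inball v (ends j).2 ->
  (forall w, (w < nv G2)%N -> f' w = if f w == f (ends j).1 then f (ends j).2 else f w) ->
  merged j.+1 f'.
Proof.
move=> [h1 h2 h3 h4] a b F.
have Fo (w : 'I_(nv G2)) : f' w = if f w == f (ends j).1 then f (ends j).2 else f w by exact: F.
have ja : inc j (ends j).1 by rewrite /inc eqxx.
have jb : inc j (ends j).2 by rewrite /inc eqxx orbT.
split.
- by move=> w wn; rewrite F //; case: ifP => _; apply: h1.
- move=> w iw; rewrite Fo; case: ifP => E.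
    have [w' [iw' E1 E2]] := h2 _ b; exists w'; split=> //.
    by rewrite Fo E2 -E1; case: ifP.
  have [w' [iw' E1 E2]] := h2 _ iw; exists w'; split=> //.
  by rewrite Fo E2 -E1 E.
- move=> w w' iw iw'; rewrite !Fo.
  case: ifP => [/eqP E|_]; case: ifP => [/eqP E'|_] EE i l iiw lw'.
  + by apply: (h3 w w') => //; rewrite E E'.
  + apply: (@connect_trans _ _ j); first exact: (h3 w _ iw a E).
    by apply: (h3 _ w' b iw').
  + apply: (@connect_trans _ _ j); first exact: (h3 w _ iw b EE).
    by apply: (h3 _ w' a iw').
  + exact: (h3 w w').
- move=> j'; rewrite ltnS leq_eqVlt => /predU1P[/val_inj ->|j'k] a' b'.
    by rewrite !Fo eqxx; case: ifP.
  by rewrite !Fo h4.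
Qed.

Lemma relabel_loopP s x y : inputs s -> imem s 27 0 = x -> imem s 28 0 = y ->
  (x < nv G2)%N -> (y < nv G2)%N -> (forall w, (w < nv G2)%N -> (imem s 18 w < nv G2)%N) ->
  htk W any (for_ 26 n2e (If (BIEq (IGet 18 (ivar 26)) (ivar 27))
           (IStore 18 (ivar 26) (ivar 28)) Skip)) s (2 * ne G2)
   (fun s' => forall w, (w < nv G2)%N -> imem s' 18 w = if imem s 18 w == x then y else imem s 18 w).
Proof.
move=> inp sx sy xn yn lt; have n0 := n2_gt0.
pose I k s1 := forall w, (w < nv G2)%N -> imem s1 18 w =
  if (w < k)%N && (imem s 18 w == x) then y else imem s 18 w.
apply: (@htk_for _ _ _ I _ _ _ _ (nv G2) (nv G2) 1) => //.
- exact: n2_safe.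
- exact: in_n2 inp.
- by rewrite muln1; exact: b_n2m2.
- move=> k s1 kn Ik sk sm; apply: htk_wp; first by [].
  have bn2 := b_n2 bd.
  have nW z : (z < nv G2)%N -> (z < W)%N by lia.
  have kW := nW _ kn; have xW := nW _ xn; have yW := nW _ yn.
  have sx1 : imem s1 27 0 = x by rewrite sm.1.
  have sy1 : imem s1 28 0 = y by rewrite sm.1.
  have vk : imem s1 18 k = imem s 18 k by rewrite Ik // ltnn.
  have vkW := nW _ (lt _ kn).
  rewrite /= sk sx1 sy1 vk -eqn_leq; split=> //.
  have step w : (w < nv G2)%N ->
      (if (w < k.+1)%N && (imem s 18 w == x) then y else imem s 18 w) =
      if w == k then (if imem s 18 k == x then y else imem s 18 k) else imem s1 18 w.
    move=> wn; rewrite ltnS leq_eqVlt; case: (eqVneq w k) => [->//|wk].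
    by rewrite orFb Ik.
  case: ifP => E; last first.
    move=> w wn; rewrite step //; case: (eqVneq w k) => [->|//].
    by rewrite vk E.
  split=> // w wn; rewrite step //= E; by case: (w == k).
- by move=> s1 H _ w wn; rewrite H // wn.
Qed.

End MergeInvariant.

Lemma merge_loopP s (v : 'I_(nv G1)) : inputs s ->
  (forall w : 'I_(nv G2), imem s 17 w = inball v w) ->
  (forall w, (w < nv G2)%N -> imem s 18 w = w) ->
  htk W any merge_loop s (ne G2 * (2 * ne G2)) (fun s' => merged v (ne G2) (imem s' 18)).
Proof.
move=> inp s17 s18; have n0 := n2_gt0.
have m0 := b_m2_gt0 bd.
pose I k s1 := merged v k (imem s1 18).
apply: (@htk_for _ _ _ I _ _ _ _ (ne G2) (ne G2) (2 * ne G2)) => //.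
- exact: m2_safe.
- exact: in_m2 inp.
- by rewrite muln_gt0 m0.
- exact: merged0.
- move=> k s1 km Ik sk sm; set j := Ordinal km; have jk : imem s1 22 0 = j by [].
  have inp1 : inputs s1 by apply: inputs_same sm _ _ inp.
  have E1 := enc_end1 (in_g2 inp1) j; have E2 := enc_end2 (in_g2 inp1) j.
  have [jW j2W j2W' aW bW] := edgeW2 j.
  have v17 (w : 'I_(nv G2)) : imem s1 17 w = inball v w by rewrite sm.1 // s17.
  have bW' (b : bool) : (b < W)%N by case: b.
  have fa := mg_lt Ik (ltn_ord (ends j).1); have fb := mg_lt Ik (ltn_ord (ends j).2).
  have bn2 := b_n2 bd.
  have faW : (imem s1 18 (ends j).1 < W)%N by lia.
  have fbW : (imem s1 18 (ends j).2 < W)%N by lia.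
  apply: htk_if; first by rewrite muln_gt0 m0.
    by rewrite /= jk E1 E2 !v17; split; split=> //; split=> //; split=> //.
  rewrite /= jk E1 E2 !v17 !lt0b; case: ifP => ab; last first.
    apply: htk_wp; first by rewrite muln_gt0 m0.
    by apply: (@merged_skip v j) => //; rewrite ab.
  have /andP[a b] := ab.
  pose s2 := iset (iset s1 27 0 (imem s1 18 (ends j).1)) 28 0 (imem s1 18 (ends j).2).
  apply: (@htk_seq _ _ _ _ _ _ _ (fun s' => s' = iset s1 27 0 (imem s1 18 (ends j).1))).
    apply: htk_wp; first by rewrite muln_gt0 m0.
    by rewrite /= jk E1.
  move=> _ -> _.
  apply: (@htk_seq _ _ _ _ _ _ _ (fun s' => s' = s2)).
    apply: htk_wp; first by rewrite muln_gt0 m0.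
    by rewrite /= jk E2.
  move=> _ -> _.
  apply: htk_post.
    apply: (@relabel_loopP s2 (imem s1 18 (ends j).1) (imem s1 18 (ends j).2)) => //.
      by apply: inputs_iset => //; exact: inputs_iset.
    by move=> w wn; exact: (mg_lt Ik wn).
  by move=> s3 H _; apply: (@merged_step v j (imem s1 18)) => // w wn; rewrite H.
Qed.

(** * Numbering the placements of a vertex *)

Section Labels.
Context (v : 'I_(nv G1)) (f : nat -> nat) (mf : merged v (ne G2) f).

Definition is_rep r := exists w : 'I_(nv G2), [/\ r = w :> nat, inball v w & f w = w].

(** A bijection between the representatives below [k] and the numbers from 1 to [c]. *)
Record numbered k (num : nat -> nat) c : Prop := {
  nb_le : (c <= k)%N;
  nb_bound : forall r, (r < k)%N -> is_rep r -> (0 < num r <= c)%N;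
  nb_inj : forall r r', (r < k)%N -> (r' < k)%N -> is_rep r -> is_rep r' -> num r = num r' -> r = r';
  nb_onto : forall i, (0 < i <= c)%N -> exists r, [/\ (r < k)%N, is_rep r & num r = i] }.

Lemma numbered_skip k num c : numbered k num c -> ~ is_rep k -> numbered k.+1 num c.
Proof.
move=> [h1 h2 h3 h4] N.
have lt r : (r < k.+1)%N -> is_rep r -> (r < k)%N.
  by rewrite ltnS leq_eqVlt => /predU1P[->|//].
split=> //.
- exact: leqW.
- by move=> r rk rr; apply: h2 => //; exact: lt.
- by move=> r r' rk rk' rr rr'; apply: h3 => //; exact: lt.
- by move=> i /h4[r [rk rr E]]; exists r; split=> //; exact: leqW.
Qed.

Lemma numbered_step k num num' c : numbered k num c -> is_rep k ->
  (forall r, num' r = if r == k then c.+1 else num r) -> numbered k.+1 num' c.+1.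
Proof.
move=> [h1 h2 h3 h4] rk E.
have old r : (r < k)%N -> num' r = num r by move=> lt; rewrite E ltn_eqF.
have new : num' k = c.+1 by rewrite E eqxx.
split=> //.
- move=> r; rewrite ltnS leq_eqVlt => /predU1P[->|lt] rr; first by rewrite new /= ltnS.
  by rewrite old //; have /andP[-> h] := h2 r lt rr; exact: leqW.
- have spl r : (r < k.+1)%N -> r = k \/ (r < k)%N.
    by rewrite ltnS leq_eqVlt => /predU1P[|]; [left|right].
  move=> r r' /spl[->|lt] /spl[->|lt'] rr rr' //.
  + by rewrite new old // => h; have := h2 r' lt' rr'; lia.
  + by rewrite new old // => h; have := h2 r lt rr; lia.
  + by rewrite !old //; exact: h3.
- move=> i /andP[i0]; rewrite leq_eqVlt => /predU1P[->|lt]; first by exists k.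
  have [|r [rk' rr e]] := h4 i; first by rewrite i0.
  by exists r; split=> //; [exact: leqW | rewrite old].
Qed.

Lemma number_loopP s : inputs s ->
  (forall w : 'I_(nv G2), imem s 17 w = inball v w) -> imem s 18 =1 f -> imem s 30 0 = 0%N ->
  htk W any number_loop s (2 * ne G2) (fun s' => numbered (nv G2) (imem s' 19) (imem s' 30 0)).
Proof.
move=> inp s17 s18 s30; have n0 := n2_gt0.
pose I k s1 := numbered k (imem s1 19) (imem s1 30 0).
apply: (@htk_for _ _ _ I _ _ _ _ (nv G2) (nv G2) 1) => //.
- exact: n2_safe.
- exact: in_n2 inp.
- by rewrite muln1; exact: b_n2m2.
- by rewrite /I s30; split=> // i; case: i.
- move=> k s1 kn Ik sk sm; apply: htk_wp; first by [].
  set w := Ordinal kn; have wk : imem s1 25 0 = w by [].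
  have bn2 := b_n2 bd; have fl := mg_lt mf kn; have cl := nb_le Ik.
  have kW : (w < W)%N by rewrite /=; lia.
  have fW : (f w < W)%N by rewrite /=; lia.
  have cW : (imem s1 30 0 < W)%N by lia.
  have cW' : (imem s1 30 0 + 1 < W)%N by lia.
  have v17 : imem s1 17 w = inball v w by rewrite sm.1 // s17.
  have v18 : imem s1 18 w = f w by rewrite sm.1 // s18.
  have bW (b : bool) : (b < W)%N by case: b.
  rewrite /= wk v17 v18 lt0b -eqn_leq; split; first by split=> //; split=> //.
  case: ifP => E.
    split=> //; split=> //.
    have -> : nat_of_ord w = k by [].
    rewrite /I /= addn1; apply: (numbered_step Ik) => //.
    by exists w; case/andP: E => h1 /eqP h2.
  apply: numbered_skip => // -[w' [kw' iw' fw']].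
  have ww' : w' = w by apply: val_inj.
  by move: E; rewrite -ww' iw' fw' eqxx.
Qed.

Definition outer (j : 'I_(ne G2)) := ~~ inball v (ends j).1 && ~~ inball v (ends j).2.

Lemma outerP (j : 'I_(ne G2)) w : outer j -> inc j w -> ~~ inball v w.
Proof. by move=> /andP[a b] /orP[]/eqP ->. Qed.

Context (num : nat -> nat) (c0 : nat) (nb : numbered (nv G2) num c0).

(** Labels up to [c0] belong to the classes with a vertex in the ball, larger ones to outer edges,
    which are linked to no edge and so form classes of their own. *)
Record labelled k (lab : 'I_(ne G2) -> nat) c : Prop := {
  lb_c : (c0 <= c <= c0 + k)%N;
  lb_in : forall (j : 'I_(ne G2)) w, (j < k)%N -> inc j w -> inball v w -> lab j = num (f w);
  lb_out : forall j : 'I_(ne G2), (j < k)%N -> outer j -> hits (pos v) eps j -> (c0 < lab j <= c)%N;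
  lb_miss : forall j : 'I_(ne G2), (j < k)%N -> ~ hits (pos v) eps j -> lab j = 0%N;
  lb_inj : forall j l : 'I_(ne G2), (j < k)%N -> (l < k)%N -> outer j -> outer l ->
    hits (pos v) eps j -> hits (pos v) eps l -> lab j = lab l -> j = l;
  lb_onto : forall i, (c0 < i <= c)%N -> exists2 j : 'I_(ne G2), (j < k)%N & lab j = i }.

Lemma hits_in (j : 'I_(ne G2)) w : inc j w -> inball v w -> hits (pos v) eps j.
Proof. by move=> jw iw; exists (vtx w); [apply/vtx_edge | rewrite inside_vtx]. Qed.

Lemma labelled_step (j : 'I_(ne G2)) lab lab' c c' : labelled j lab c ->
  (forall l, l != j -> lab' l = lab l) ->
  (if outer j then if `[< hits (pos v) eps j >] then c' = c.+1 /\ lab' j = c'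
                   else c' = c /\ lab' j = 0%N
   else c' = c /\ exists w, [/\ inc j w, inball v w & lab' j = num (f w)]) ->
  labelled j.+1 lab' c'.
Proof.
move=> [h1 h2 h3 h4 h5 h6] old new.
have lt (l : 'I_(ne G2)) : (l < j)%N -> lab' l = lab l by move=> lj; apply: old; rewrite -val_eqE /= ltn_eqF.
have cc : (c <= c' <= c.+1)%N.
  by move: new; case: ifP => _; [case: ifP => _|] => -[-> _]; rewrite leqnn leqnSn.
have spl (l : 'I_(ne G2)) : (l < j.+1)%N -> l = j \/ (l < j)%N.
  by rewrite ltnS leq_eqVlt => /predU1P[/val_inj|]; [left|right].
split.
- lia.
- move=> l w /spl[->|lj] lw iw; last by rewrite lt // (h2 l w).
  move: new; case: ifP => [ou| _ [_ [w' [jw' iw' ->]]]]; first by rewrite (negbTE (outerP ou lw)) in iw.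
  suff -> : f w' = f w by [].
  have dn := mg_done mf (ltn_ord j).
  move: lw jw' iw iw' => /orP[]/eqP -> /orP[]/eqP -> // a b; [exact/esym/dn | exact: dn].
- move=> l /spl[->|lj] o hl; last by rewrite lt //; have := h3 l lj o hl; lia.
  by move: new; rewrite o (asboolT hl) => -[-> ->]; lia.
- move=> l /spl[->|lj] nh; last by rewrite lt // h4.
  move: new; case: ifP => [_|_ [_ [w [jw iw _]]]]; last by case: nh; exact: hits_in iw.
  by rewrite (asboolF nh) => -[].
- move=> l m /spl[->|lj] /spl[->|mj] ol om hl hm //.
  + move: new; rewrite ol (asboolT hl) => -[-> ->]; rewrite lt // => E.
    by have := h3 m mj om hm; lia.
  + move: new; rewrite om (asboolT hm) => -[-> ->]; rewrite lt // => E.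
    by have := h3 l lj ol hl; lia.
  + by rewrite !lt //; exact: h5.
- move=> i /andP[i0 ic]; have [il|il] := leqP i c.
    have [|l lj El] := h6 i; first by rewrite i0.
    by exists l; [exact: leqW | rewrite lt].
  have iE : i = c.+1 by lia.
  exists j => //; move: new; case: ifP => _; last by case; lia.
  by case: ifP => _ []; [move=> -> ->|lia].
Qed.

Lemma labelling_of_labelled lab c : labelled (ne G2) lab c -> labelling (pos v) eps lab c.
Proof.
move=> [h1 h2 h3 h4 h5 h6].
have rep w : inball v w -> is_rep (f w) /\ (f w < nv G2)%N.
  move=> iw; have [w' [iw' E1 E2]] := mg_rep mf iw.
  by rewrite E1; split; [exists w' | exact: ltn_ord].
have numb w : inball v w -> (0 < num (f w) <= c0)%N.
  by move=> /rep[r lt]; exact: nb_bound nb _ lt r.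
have cases j : outer j \/ exists w, inc j w /\ inball v w.
  case: (boolP (outer j)) => [|]; first by left.
  rewrite negb_and !negbK => /orP[h|h]; right.
    by exists (ends j).1; rewrite /inc eqxx.
  by exists (ends j).2; rewrite /inc eqxx orbT.
split.
- move=> j; split=> [l0|hj].
    by apply: contrapT => /(h4 j (ltn_ord j)) E; rewrite E in l0.
  have [ou|[w [jw iw]]] := cases j; first by have := h3 j (ltn_ord j) ou hj; lia.
  by rewrite (h2 j w) //; have := numb w iw; lia.
- move=> j; have [ou|[w [jw iw]]] := cases j; last first.
    by rewrite (h2 j w) //; have := numb w iw; lia.
  have [hj|nh] := pselect (hits (pos v) eps j); last by rewrite (h4 j).
  by have := h3 j (ltn_ord j) ou hj; lia.
- move=> k kc; have [kc0|kc0] := ltnP k c0; last first.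
    by have [|j _ E] := h6 k.+1; [lia | exists j].
  have [|r [rn [w [rw iw fw]] E]] := nb_onto nb (i := k.+1); first by lia.
  have [j jw] := b_inc bd w.
  by exists j; rewrite (h2 j w) // fw -rw.
- have one j l w : inc j w -> inball v w -> linked (pos v) eps j l -> exists w', inc l w' /\ inball v w'.
    by move=> _ _ /linkedP[w' [_ lw' iw']]; exists w'.
  move=> j l hj hl; split.
    have [oj|[w [jw iw]]] := cases j; have [ol|[w' [lw' iw']]] := cases l.
    + by move=> /(h5 j l (ltn_ord j) (ltn_ord l) oj ol hj hl) ->; rewrite connect0.
    + rewrite (h2 l w') // => E; have := h3 j (ltn_ord j) oj hj; rewrite E.
      by have := numb w' iw'; lia.
    + rewrite (h2 j w) // => E; have := h3 l (ltn_ord l) ol hl; rewrite -E.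
      by have := numb w iw; lia.
    + rewrite (h2 j w) // (h2 l w') //.
      have [r rn] := rep w iw; have [r' rn'] := rep w' iw'.
      by move=> /(nb_inj nb rn rn' r r') E; exact: (mg_sound mf iw iw' E jw lw').
  (* Consecutive edges of a chain share a vertex in the ball, which determines the labels of
     both. *)
  move=> /connectP[u]; elim: u j hj => [|m u IH] j hj /=; first by move=> _ ->.
  move=> /andP[/linkedP[w [jw mw iw]] pu] E.
  rewrite (h2 j w) // -(h2 m w) //; apply: IH => //; exact: hits_in mw iw.
Qed.

Lemma label_loopP s : inputs s -> imem s 34 0 = v ->
  (forall w : 'I_(nv G2), imem s 17 w = inball v w) -> imem s 18 =1 f -> imem s 19 =1 num ->
  imem s 30 0 = c0 -> (forall j : 'I_(ne G2), imem s 20 j = `[< hits (pos v) eps j >]) ->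
  htk W any label_loop s (ne G2) (fun s' =>
    labelling (pos v) eps (fun j : 'I_(ne G2) => imem s' 4 (v * ne G2 + j)%N) (imem s' 30 0) /\
    forall i, (i < v * ne G2)%N -> imem s' 4 i = imem s 4 i).
Proof.
move=> inp s34 s17 s18 s19 s30 s20.
pose I k s1 := labelled k (fun j : 'I_(ne G2) => imem s1 4 (v * ne G2 + j)%N) (imem s1 30 0) /\
  forall i, (i < v * ne G2)%N -> imem s1 4 i = imem s 4 i.
apply: (@htk_for _ _ _ I _ _ _ _ (ne G2) (ne G2) 1) => //.
- exact: m2_safe.
- exact: in_m2 inp.
- exact: b_m2_gt0.
- by rewrite muln1.
- by split=> //; rewrite s30; split=> // [|i]; lia.
- move=> k s1 km [Ik Jk] sk sm; set j := Ordinal km; have jk : imem s1 22 0 = j by [].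
  have inp1 : inputs s1 by apply: inputs_same sm _ _ inp.
  have E1 := enc_end1 (in_g2 inp1) j; have E2 := enc_end2 (in_g2 inp1) j.
  have [jW j2W j2W' aW bW] := edgeW2 j.
  have v34 : imem s1 34 0 = v by rewrite sm.1.
  have v17 (w : 'I_(nv G2)) : imem s1 17 w = inball v w by rewrite sm.1.
  have v18 w : imem s1 18 w = f w by rewrite sm.1.
  have v19 w : imem s1 19 w = num w by rewrite sm.1.
  have v20 : imem s1 20 j = `[< hits (pos v) eps j >] by rewrite sm.1.
  have m2E := in_m2 inp1.
  have [cW1 cW2] := lt_cell (ltn_ord v) km.
  have vW : (v < W)%N by have := ltn_ord v; have := b_n1 bd; lia.
  have mW : (ne G2 < W)%N by have := b_m2 bd; lia.
  have bW' (b : bool) : (b < W)%N by case: b.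
  have cl := lb_c Ik; have cn := nb_le nb; have bn2 := b_n2 bd; have bm2 := b_m2 bd.
  have ccW : (imem s1 30 0 < W)%N by lia.
  have ccW' : (imem s1 30 0 + 1 < W)%N by lia.
  have fW (w : 'I_(nv G2)) : (f w < W)%N by have := mg_lt mf (ltn_ord w); lia.
  have nW (w : 'I_(nv G2)) : inball v w -> (num (f w) < W)%N.
    move=> iw; have [w' [iw' e1 e2]] := mg_rep mf iw.
    have rr : is_rep (f w) by rewrite e1; exists w'.
    have fl : (f w < nv G2)%N by rewrite e1.
    by have := nb_bound nb fl rr; lia.
  have fin x c' : c' = imem s1 30 0 \/ c' = (imem s1 30 0).+1 ->
     (if outer j then if `[< hits (pos v) eps j >] then c' = (imem s1 30 0).+1 /\ x = c'
                   else c' = imem s1 30 0 /\ x = 0%N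
      else c' = imem s1 30 0 /\ exists w, [/\ inc j w, inball v w & x = num (f w)]) ->
     forall s2, imem s2 4 =1 upd (imem s1 4) (v * ne G2 + j)%N x -> imem s2 30 0 = c' -> I k.+1 s2.
    move=> _ H s2 e4 e30; split; last first.
      by move=> i iv; rewrite e4 updN ?Jk //; lia.
    have lj : labelled j (fun j : 'I_(ne G2) => imem s1 4 (v * ne G2 + j)%N) (imem s1 30 0) by [].
    apply: (labelled_step lj); rewrite ?e30.
      by move=> l lj'; rewrite e4 updN // eqn_add2l.
    by rewrite /= e4 updE; exact: H.
  apply: htk_wp; first by [].
  rewrite /= jk E1 E2 v34 m2E !v17 v20 !lt0b !v18 !v19.
  split; first by split.
  case: ifP => a.
    split; [by split|by have := nW _ a; split|].
    apply: (fin (num (f (ends j).1)) (imem s1 30 0)) => //; first by left.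
    by rewrite /outer a; split=> //; exists (ends j).1; rewrite /inc eqxx.
  split; first by split.
  case: ifP => b.
    split; [by split|by have := nW _ b; split|].
    apply: (fin (num (f (ends j).2)) (imem s1 30 0)) => //; first by left.
    by rewrite /outer b andbF; split=> //; exists (ends j).2; rewrite /inc eqxx orbT.
  split; first by split.
  have oj : outer j by rewrite /outer a b.
  case: ifP => h.
    split; [by []|by split|split; [by split|by split|]].
    apply: (fin (imem s1 30 0 + 1)%N (imem s1 30 0).+1) => //; first by right.
      by rewrite oj h addn1.
    by rewrite /= addn1.
  split; [by split|by []|].
  apply: (fin 0%N (imem s1 30 0)) => //; first by left.
  by rewrite oj h.
- by move=> s1 [H1 H2] _; split=> //; exact: labelling_of_labelled.
Qed.

End Labels.

Definition placed s (v : 'I_(nv G1)) :=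
  labelling (pos v) eps (fun j : 'I_(ne G2) => imem s 4 (v * ne G2 + j)%N) (imem s 3 v).

Lemma place_progP s : inputs s ->
  htk W any (place_prog d) s (nv G1 * (ne G2 * (2 * ne G2))) (fun s' => forall v, placed s' v).
Proof.
move=> inp; have m0 := b_m2_gt0 bd.
pose I k s1 := forall v : 'I_(nv G1), (v < k)%N -> placed s1 v.
have n0 := b_n1_gt0 bd.
have X0 : (0 < ne G2 * (2 * ne G2))%N by rewrite !muln_gt0 m0.
have X1 : (ne G2 <= ne G2 * (2 * ne G2))%N by rewrite leq_pmulr // muln_gt0 m0.
have X2 : (2 * ne G2 <= ne G2 * (2 * ne G2))%N by rewrite leq_pmull.
apply: (@htk_for _ _ _ I _ _ _ _ (nv G1) (nv G1) (ne G2 * (2 * ne G2))) => //.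
- exact: n1_safe.
- exact: in_n1 inp.
- move=> k s1 kn Ik sk sm; set v := Ordinal kn; have vk : imem s1 34 0 = v by [].
  have inp1 : inputs s1 by apply: inputs_same sm _ _ inp.
  have vW : (v < W)%N by have := ltn_ord v; have := b_n1 bd; lia.
  have bn := b_n2 bd; have bm := b_m2 bd.
  apply: (htk_seq (htk_mono X1 (ball_loopP inp1 vk))) => s2 [s20 s17] f2.
  have inp2 : inputs s2 by apply: inputs_same f2 _ _ inp1.
  apply: (htk_seq (htk_mono X2 (self_loopP inp2))) => s3 s18 f3.
  have inp3 : inputs s3 by apply: inputs_same f3 _ _ inp2.
  have s17' (w : 'I_(nv G2)) : imem s3 17 w = inball v w by rewrite f3.1.
  apply: (htk_seq (merge_loopP inp3 s17' s18)) => s4 mf f4.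
  have inp4 : inputs s4 by apply: inputs_same f4 _ _ inp3.
  apply: (@htk_seq _ _ _ _ _ _ _ (fun s' => s' = iset s4 30 0 0)); first exact: htk_wp.
  move=> _ -> _; set s5 := iset s4 30 0 0.
  have inp5 : inputs s5 by exact: inputs_iset.
  have s17'' (w : 'I_(nv G2)) : imem s5 17 w = inball v w by rewrite /= f4.1.
  have e18 : imem s5 18 =1 imem s4 18 by [].
  apply: (htk_seq (htk_mono X2 (number_loopP mf inp5 s17'' e18 erefl))) => s6 nb f6.
  have inp6 : inputs s6 by apply: inputs_same f6 _ _ inp5.
  have v34 : imem s6 34 0 = v by rewrite f6.1 //= f4.1 // f3.1 // f2.1.
  have v17 (w : 'I_(nv G2)) : imem s6 17 w = inball v w by rewrite f6.1.
  have v18 : imem s6 18 =1 imem s4 18 by move=> w; rewrite f6.1.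
  have v20 (j : 'I_(ne G2)) : imem s6 20 j = `[< hits (pos v) eps j >].
    by rewrite f6.1 //= f4.1 // f3.1.
  have H := label_loopP mf nb inp6 v34 v17 v18 (fun _ => erefl) erefl v20.
  apply: (htk_seq (htk_mono X1 H)) => s7 [L7 old] f7.
  have v34' : imem s7 34 0 = v by rewrite f7.1.
  have cW : (imem s7 30 0 < W)%N by have := cnt_le L7; lia.
  apply: htk_wp; first by [].
  rewrite /= v34'; split=> // v'; rewrite ltnS leq_eqVlt => /predU1P[/(@val_inj _ _ _ v' v) ->|v'k].
    by rewrite /placed /= eqxx.
  rewrite /placed /= (ltn_eqF v'k).
  have -> : imem s7 3 v' = imem s1 3 v' by rewrite f7.1 // f6.1 //= f4.1 // f3.1 // f2.1.
  have -> : (fun j : 'I_(ne G2) => imem s7 4 (v' * ne G2 + j)%N) =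
            (fun j : 'I_(ne G2) => imem s1 4 (v' * ne G2 + j)%N).
    apply: funext => j; rewrite old ?f6.1 //= ?f4.1 // ?f3.1 // ?f2.1 //.
    have : (v'.+1 * ne G2 <= k * ne G2)%N by rewrite leq_mul2r v'k orbT.
    by rewrite mulSn; have := ltn_ord j; lia.
  exact: Ik.
- by move=> s1 H _ v; exact: H.
Qed.

(** * Reachability between placements *)

Section Labelled.
Context (lab : V -> 'I_m2 -> nat) (cnt : V -> nat).
Context (L : forall v, labelling (pos v) eps (lab v) (cnt v)).

Definition labels (s : state R) := forall v : 'I_(nv G1), imem s 3 v = cnt v /\ forall j : 'I_m2, imem s 4 (v * m2 + j)%N = lab v j.

Lemma labels_same im rm s s' : same im rm s s' -> 3 \notin im -> 4 \notin im -> labels s -> labels s'.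
Proof. by move=> [h _] i3 i4 H v; have [a b] := H v; split=> [|j]; rewrite h //. Qed.

Lemma cntm v : (cnt v <= m2)%N. Proof. exact: cnt_le (L v). Qed.
Lemma labm v j : (lab v j <= m2)%N. Proof. exact: leq_trans (lab_le (L v) j) (cntm v). Qed.

Lemma window_loopP s (e : 'I_(ne G1)) : inputs s -> imem s 32 0 = e ->
  htk W any (window_loop d) s (2 * m2) (fun s' => forall w : 'I_n2,
    window_spec (rmem s' 8 w) (rmem s' 9 w) (pos (ends e).1) (pos (ends e).2) (pos w) eps).
Proof.
move=> inp se; have n0 := n2_gt0.
have em := ltn_ord e; have bm1 := b_m1 bd; have bn1 := b_n1 bd; have bn2 := b_n2 bd.
have eW : (e < W)%N by lia.
have e2W : (2 * e < W)%N by lia.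
have e2W' : (2 * e + 1 < W)%N by lia.
have u1 := ltn_ord (ends e).1; have u2 := ltn_ord (ends e).2.
have u1W : ((ends e).1 < W)%N by lia.
have u2W : ((ends e).2 < W)%N by lia.
pose I k s := forall w : 'I_n2, (w < k)%N ->
  window_spec (rmem s 8 w) (rmem s 9 w) (pos (ends e).1) (pos (ends e).2) (pos w) eps.
apply: (@htk_for _ _ _ I _ _ _ _ n2 n2 1) => //.
- exact: (n2_safe inp).
- exact: in_n2 inp.
- by rewrite muln1; exact: b_n2m2 bd.
- move=> k s1 kn Ik sk sm.
  have kW : (k < W)%N by lia.
  have inp1 : inputs s1 by apply: inputs_same sm _ _ inp.
  have se1 : imem s1 32 0 = e by rewrite sm.1.
  set w := Ordinal kn.
  have E1 := enc_end1 (in_g1 inp1) e; have E2 := enc_end2 (in_g1 inp1) e.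
  have d1 : denotes W s1 (end1 1 (ivar 32)) (ends e).1 by split=> /=; rewrite se1 E1.
  have d2 : denotes W s1 (end2 1 (ivar 32)) (ends e).2 by split=> /=; rewrite se1 E2.
  have dv : denotes W s1 (ivar 25) w by split=> //=; rewrite sk.
  have HW := windowP (b_g1 bd) (b_g2 bd) (b_d bd) W_gt0 (isT : 1 < 3)%N (isT : 2 < 3)%N
      (in_g1 inp1) (in_g2 inp1) (in_eps inp1) d1 d2 dv.
  apply: (htk_seq (ht_htk HW)) => s2 spec sm2.
  have sk2 : imem s2 25 0 = k by rewrite sm2.1.
  apply: htk_wp; first by [].
  rewrite /= sk2; split=> //; split=> // w'.
  rewrite ltnS leq_eqVlt => /predU1P[Ew|w'k].
    have -> : w' = w by exact: val_inj.
    by rewrite /= eqxx.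
  by rewrite /= (ltn_eqF w'k) !sm2.2 //; exact: Ik.
- by move=> s1 H _ w; exact: H.
Qed.

Lemma rank_loopP s : inputs s ->
  htk W any rank_loop s (4 * m2 * m2) (fun s' => forall w, (w < n2)%N ->
    imem s' 16 (rank n2 (rmem s 8) w) = w).
Proof.
move=> inp; have n0 := n2_gt0.
have bn2 := b_n2 bd; have bnm := b_n2m2 bd.
have nW k : (k <= n2)%N -> (k < W)%N by lia.
set lo := rmem s 8.
pose I k s := forall w, (w < k)%N -> imem s 16 (rank n2 lo w) = w.
apply: (@htk_for _ _ _ I _ _ _ _ n2 n2 n2) => //.
- exact: (n2_safe inp).
- exact: in_n2 inp.
- by nia.
- move=> k s1 kn Ik sk sm; have kW := nW k (ltnW kn).
  apply: (@htk_seq _ _ _ _ _ _ _ (fun s' => s' = iset s1 30 0 0%N)); first by apply: htk_wp.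
  move=> _ -> _; set s2 := iset s1 30 0 0%N.
  have inp2 : inputs s2 by apply: inputs_iset => //; apply: inputs_same sm _ _ inp.
  have lo2 x : rmem s2 8 x = lo x by rewrite /= sm.2.
  pose J i s := imem s 30 0 = count ((before lo)^~ k) (iota 0 i).
  apply: (@htk_seq _ _ _ _ _ _ _ (J n2)).
    apply: (@htk_for _ _ _ J _ _ _ _ n2 n2 1) => //.
    + exact: (n2_safe inp2).
    + exact: in_n2 inp2.
    + by rewrite muln1.
    + move=> i s3 iN Ji si sm3; apply: htk_wp; first by [].
      have iW := nW i (ltnW iN).
      have cb := count_size ((before lo)^~ k) (iota 0 i); rewrite size_iota in cb.
      have c30 : (imem s3 30 0 < W)%N by rewrite Ji; apply: nW; lia.
      have c30' : (imem s3 30 0 + 1 < W)%N by rewrite Ji; apply: nW; lia.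
      have sk3 : imem s3 25 0 = k by rewrite sm3.1.
      have lo3 x : rmem s3 8 x = lo x by rewrite sm3.2 // lo2.
      rewrite /= sk3 si !lo3 -/(before lo i k); split=> //.
      have JS : count ((before lo)^~ k) (iota 0 i.+1) = (imem s3 30 0 + before lo i k)%N.
        by rewrite -[i.+1]addn1 iotaD count_cat /= addn0 Ji.
      by case: ifP => b; rewrite /J JS b ?addn0.
  move=> s3 J3 sm3; have sk3 : imem s3 25 0 = k by rewrite sm3.1.
  have rk : imem s3 30 0 = rank n2 lo k by [].
  have rb := rank_bound lo kn.
  apply: htk_wp; first by [].
  have rW : (rank n2 lo k < W)%N by exact/nW/ltnW.
  rewrite /= rk sk3; split=> // w; rewrite ltnS leq_eqVlt => /predU1P[->|wk] /=.
    by rewrite eqxx.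
  case: eqP => [/(rank_inj (ltn_trans wk kn) kn)|_]; first by lia.
  by rewrite sm3.1 //= Ik.
Qed.

Lemma clear_loopP s : inputs s ->
  htk W any (clear_loop n2e) s (2 * m2) (fun s' => forall w, (w < n2)%N ->
    imem s' 13 w = 0%N /\ imem s' 14 w = 0%N).
Proof.
move=> inp; have n0 := n2_gt0.
have bn2 := b_n2 bd.
pose I k s := forall w, (w < k)%N -> imem s 13 w = 0%N /\ imem s 14 w = 0%N.
apply: (@htk_for _ _ _ I _ _ _ _ n2 n2 1) => //.
- exact: (n2_safe inp).
- exact: in_n2 inp.
- by rewrite muln1; exact: b_n2m2 bd.
- move=> k s1 kn Ik sk sm; apply: htk_wp; first by [].
  have kW : (k < W)%N by lia.
  rewrite /= sk; do 2!split=> //; move=> w; rewrite ltnS leq_eqVlt => /predU1P[->|wk] /=.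
    by rewrite eqxx.
  by rewrite ltn_eqF //; exact: Ik.
Qed.

Lemma in_classP s (v : 'I_(nv G1)) x k (j : 'I_m2) : inputs s -> labels s -> imem s x 0 = v ->
  imem s 22 0 = j -> imem s 23 0 = k -> (x <= 100)%N -> (k < m2)%N ->
  bsafe W s (in_class (ivar x) (ivar 23)) /\ bev s (in_class (ivar x) (ivar 23)) = (lab v j == k.+1).
Proof.
move=> inp lb sx sj sk x100 km; have [_ lbj] := lb v.
have vn := ltn_ord v; have bn1 := b_n1 bd; have bm2 := b_m2 bd.
have [cW cW'] := lt_cell vn (ltn_ord j).
have vW : (v < W)%N by lia.
have jW : (j < W)%N by have := ltn_ord j; lia.
have mW : (m2 < W)%N by lia.
have lW : (lab v j < W)%N by have := labm v j; lia.
have kW : (k < W)%N by lia.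
have kW' : (k + 1 < W)%N by lia.
have xW := lt_const x100.
by rewrite /= sx sj sk (in_m2 inp) lbj; split=> //; rewrite -eqn_leq addn1.
Qed.

Lemma source_loopP s (u : 'I_(nv G1)) k : inputs s -> labels s -> imem s 33 0 = u -> imem s 23 0 = k ->
  (k < m2)%N -> (forall w, (w < n2)%N -> imem s 14 w = 0%N) ->
  htk W any source_loop s m2 (fun s' => forall w, (w < n2)%N ->
    imem s' 14 w = `[< source (fun j => lab u j = k.+1) w >] :> nat).
Proof.
move=> inp lb su sk km z14.
pose I i s := forall w : 'I_n2, imem s 14 w =
  `[< exists j : 'I_m2, [/\ (j < i)%N, lab u j = k.+1 & inc j w] >] :> nat.
apply: (@htk_for _ _ _ I _ _ _ _ m2 m2 1) => //.
- exact: (m2_safe inp).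
- exact: in_m2 inp.
- exact: b_m2_gt0 bd.
- by rewrite muln1.
- by move=> w; rewrite z14 // asboolF // => -[j []].
- move=> i s1 im Ii si sm; set j := Ordinal im; have sj : imem s1 22 0 = j by [].
  have inp1 : inputs s1 by apply: inputs_same sm _ _ inp.
  have lb1 : labels s1 by apply: labels_same sm _ _ lb.
  have su1 : imem s1 33 0 = u by rewrite sm.1.
  have sk1 : imem s1 23 0 = k by rewrite sm.1.
  have [bs be] := in_classP (x := 33) inp1 lb1 su1 sj sk1 isT km.
  have [jW j2W j2W' aW bW] := edgeW2 j.
  have E1 := enc_end1 (in_g2 inp1) j; have E2 := enc_end2 (in_g2 inp1) j.
  have split_ex (w : 'I_n2) : `[< exists j : 'I_m2, [/\ (j < i.+1)%N, lab u j = k.+1 & inc j w] >] =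
     ((lab u j == k.+1) && inc j w) || (0 < imem s1 14 w)%N.
    rewrite Ii lt0b; apply/asboolP/orP.
      move=> [j' [j'i cj' jw]]; move: j'i; rewrite ltnS leq_eqVlt => /predU1P[Ej|j'i].
        have EE : j' = j by exact: val_inj.
        by left; rewrite -EE cj' eqxx.
      by right; apply/asboolP; exists j'.
    move=> [/andP[/eqP cj jw]|/asboolP[j' [j'i cj' jw]]]; first by exists j.
    by exists j'; split=> //; exact: ltnW.
  apply: htk_if => //; rewrite be; case: ifP => cj; apply: htk_wp => //.
    rewrite /= sj E1 E2; do 2!split=> //; move=> w; rewrite split_ex cj /=.
    by rewrite /inc -!val_eqE /=; case: eqP => _; case: eqP => _; rewrite ?orbT //= Ii lt0b.
  by move=> w; rewrite split_ex cj /= Ii lt0b.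
- move=> s1 H _ w wn; rewrite (H (Ordinal wn)); congr nat_of_bool; apply: asbool_equiv_eq.
  split; first by move=> [j [_ cj jw]]; exists j, (Ordinal wn).
  by move=> [j [w' [Ew cj jw]]]; exists j; split=> //; have -> : Ordinal wn = w' by exact: val_inj.
Qed.

Lemma lt_cube e k l : (e < nv G1)%N -> (k < m2)%N -> (l < m2)%N ->
  [/\ (e * m2 < W)%N, (e * m2 + k < W)%N, (e * m2 + k) * m2 < W & ((e * m2 + k) * m2 + l < W)]%N.
Proof.
move=> en km lm; have bc := b_cube bd; have [h1 h2] := lt_cell en km.
have : ((e * m2 + k).+1 * m2 <= nv G1 * m2 * m2)%N.
  rewrite leq_mul2r; apply/orP; right.
  have : (e.+1 * m2 <= nv G1 * m2)%N by rewrite leq_mul2r en orbT.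
  by rewrite mulSn; lia.
by rewrite mulSn => H; split=> //; lia.
Qed.

Lemma mark_loopP s (e : 'I_(ne G1)) k : inputs s -> labels s -> imem s 32 0 = e ->
  imem s 33 0 = (ends e).1 -> imem s 34 0 = (ends e).2 -> imem s 23 0 = k -> (k < m2)%N ->
  (forall w, (w < n2)%N -> (imem s 13 w <= 1)%N) ->
  htk W any mark_loop s m2 (fun s' => forall r l, (l < m2)%N -> imem s' 5 (r * m2 + l)%N =
    if (r == e * m2 + k)%N && `[< exists2 j : 'I_m2, lab (ends e).2 j = l.+1 &
        lab (ends e).1 j = k.+1 \/ exists2 w : 'I_n2, inc j w & (0 < imem s 13 w)%N >]
    then 1%N else imem s 5 (r * m2 + l)%N).
Proof.
move=> inp lb se su sv sk km re1.
have bm1 := b_m1 bd; have bm2 := b_m2 bd; have bn1 := b_n1 bd.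
set u := (ends e).1 in su *; set v := (ends e).2 in sv *.
have vn := ltn_ord v; have en : (e < nv G1)%N by have := ltn_ord e; have := b_m1n1 bd; lia.
have eW : (e < W)%N by lia.
have vW : (v < W)%N by lia.
have kW : (k < W)%N by lia.
have mW : (m2 < W)%N by lia.
pose good (j : 'I_m2) := lab u j = k.+1 \/ exists2 w : 'I_n2, inc j w & (0 < imem s 13 w)%N.
pose I i s1 := forall r l, (l < m2)%N -> imem s1 5 (r * m2 + l)%N =
    if (r == e * m2 + k)%N && `[< exists j : 'I_m2, [/\ (j < i)%N, lab v j = l.+1 & good j] >]
    then 1%N else imem s 5 (r * m2 + l)%N.
apply: (@htk_for _ _ _ I _ _ _ _ m2 m2 1) => //.
- exact: (m2_safe inp).
- exact: in_m2 inp.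
- exact: b_m2_gt0 bd.
- by rewrite muln1.
- by move=> r l lm; rewrite asboolF ?andbF // => -[j []].
- move=> i s1 im Ii si sm; set j := Ordinal im; have sj : imem s1 22 0 = j by [].
  have inp1 : inputs s1 by apply: inputs_same sm _ _ inp.
  have lb1 : labels s1 by apply: labels_same sm _ _ lb.
  have [cW cW'] := lt_cell vn im.
  have [jW j2W j2W' aW bW] := edgeW2 j.
  have lm := labm v j.
  have lW : (lab v j < W)%N by lia.
  have sv1 : imem s1 34 0 = v by rewrite sm.1.
  have [_ lbv] := lb1 v.
  apply: (@htk_seq _ _ _ _ _ _ _ (fun s' => s' = iset s1 24 0 (lab v j))).
    apply: htk_wp => //.
    by rewrite /= sv1 sj (in_m2 inp1) lbv; do 3!split=> //.
  move=> _ -> _; set s2 := iset s1 24 0 (lab v j).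
  have inp2 : inputs s2 by apply: inputs_iset.
  have lb2 : labels s2 by apply: labels_same (same_iset _ _ _ _) _ _ lb1.
  have su2 : imem s2 33 0 = u by rewrite /= sm.1.
  have sk2 : imem s2 23 0 = k by rewrite /= sm.1.
  have se2 : imem s2 32 0 = e by rewrite /= sm.1.
  have [bs be] := in_classP (x := 33) inp2 lb2 su2 (sj : imem s2 22 0 = j) sk2 isT km.
  have E1 := enc_end1 (in_g2 inp2) j; have E2 := enc_end2 (in_g2 inp2) j.
  have F1 := enc_end1 (in_g2 inp1) j; have F2 := enc_end2 (in_g2 inp1) j.
  have s13 w : imem s2 13 w = imem s 13 w by rewrite /= sm.1.
  have reW w : (w < n2)%N -> (imem s 13 w < W)%N by move=> /re1; lia.
  have r1W := reW _ (ltn_ord (ends j).1); have r2W := reW _ (ltn_ord (ends j).2).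
  have goodE : (lab u j == k.+1) || ((0 < imem s 13 (ends j).1)%N || (0 < imem s 13 (ends j).2)%N) = `[< good j >].
    apply/idP/asboolP.
      move=> /or3P[/eqP h|h|h]; first by left.
        by right; exists (ends j).1 => //; rewrite /inc eqxx.
      by right; exists (ends j).2 => //; rewrite /inc eqxx orbT.
    by move=> [-> |[w /orP[]/eqP -> ->]]; rewrite ?eqxx ?orbT.
  set B := BOr _ _.
  have BE : bev s2 B = `[< good j >].
    have orE b c : bev s2 (BOr b c) = bev s2 b || bev s2 c by rewrite /= negb_and !negbK.
    rewrite /B !orE -[bev s2 (nz (IGet 13 (end1 2 _)))]/(0 < imem s2 13 (imem s2 2 (2 * imem s2 22 0)))%N.
    rewrite -[bev s2 (nz _)]/(0 < imem s2 13 (imem s2 2 (2 * imem s2 22 0 + 1)))%N.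
    by rewrite be (sj : imem s2 22 0 = j) E1 E2 !s13 goodE.
  have BS : bsafe W s2 B.
    have r1W' : (imem s1 13 (ends j).1 < W)%N by rewrite sm.1.
    have r2W' : (imem s1 13 (ends j).2 < W)%N by rewrite sm.1.
    split; first exact: bs.
    by rewrite /nz; do 2!split=> //=; rewrite sj ?F1 ?F2; do !split.
  clearbody B; apply: htk_if => //.
  have -> : bev s2 (BAnd (nz (ivar 24)) B) = (0 < lab v j)%N && `[< good j >] by rewrite -BE.
  have step s3 : (forall c, imem s3 5 c = if [&& (0 < lab v j)%N, `[< good j >] & c == ((e * m2 + k) * m2 + (lab v j).-1)%N] then 1%N else imem s1 5 c) -> I i.+1 s3.
    move=> H r l lm'; rewrite H (Ii r l lm').
    have -> : `[< exists j : 'I_m2, [/\ (j < i.+1)%N, lab v j = l.+1 & good j] >] =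
       (lab v j == l.+1) && `[< good j >] || `[< exists j : 'I_m2, [/\ (j < i)%N, lab v j = l.+1 & good j] >].
      apply/asboolP/orP.
        move=> [j' [j'i cj' jw]]; move: j'i; rewrite ltnS leq_eqVlt => /predU1P[Ej|j'i].
          have EE : j' = j by exact: val_inj.
          by left; rewrite -EE cj' eqxx; apply/asboolP.
        by right; apply/asboolP; exists j'.
      move=> [/andP[/eqP cj /asboolP jw]|/asboolP[j' [j'i cj' jw]]]; first by exists j.
      by exists j'; split=> //; exact: ltnW.
    have -> : [&& (0 < lab v j)%N, `[< good j >] & (r * m2 + l == (e * m2 + k) * m2 + (lab v j).-1)%N] =
        (r == e * m2 + k)%N && ((lab v j == l.+1) && `[< good j >]).
      case: (lab v j) lm => [|l'] lm /=; first by rewrite andbF.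
      by rewrite cell_inj // eqSS andbC -andbA eq_sym [l == _]eq_sym [_ == r]eq_sym.
    by case: (_ == _) => //=; case: (_ && _).
  case: ifP => cond.
    have /andP[l0 gj] := cond.
    have l1 : ((lab v j).-1 < m2)%N by lia.
    have [k1 k2 k3 k4] := lt_cube en km l1.
    have l1W : ((lab v j).-1 < W)%N by lia.
    apply: htk_wp => //; rewrite /= (in_m2 inp1) !sm.1 // se sk subn1; do !split=> //.
    by apply: step => c; rewrite /= l0 gj /=.
  apply: htk_wp => //; apply: step => c; case: ifP => // /and3P[l0 gj _].
  by move: cond; rewrite l0 gj.
- move=> s1 H _ r l lm; rewrite H //; congr (if _ && _ then _ else _).
  apply: asbool_equiv_eq; split=> [[j [_ lj gj]]|[j lj gj]]; first by exists j.
  by exists j.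
Qed.

Definition joined (e : 'I_(ne G1)) k l := exists (i j : 'I_m2),
  [/\ lab (ends e).1 i = k.+1, lab (ends e).2 j = l.+1 & cert (pos (ends e).1) (pos (ends e).2) eps i j].

Definition class_body := seqs [:: clear_loop n2e; source_loop; reset_search; search n2e; mark_loop].

Lemma class_bodyP s (e : 'I_(ne G1)) k : inputs s -> labels s -> imem s 32 0 = e ->
  imem s 33 0 = (ends e).1 -> imem s 34 0 = (ends e).2 -> imem s 23 0 = k -> (k < m2)%N ->
  (forall w : 'I_n2, window_spec (rmem s 8 w) (rmem s 9 w) (pos (ends e).1) (pos (ends e).2) (pos w) eps) ->
  (forall w, (w < n2)%N -> imem s 16 (rank n2 (rmem s 8) w) = w) ->
  linked_lists G2 (imem s 2) (2 * m2) s ->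
  htk W any class_body s (8 * m2) (fun s' => forall r l, (l < m2)%N -> imem s' 5 (r * m2 + l)%N =
    if (r == e * m2 + k)%N && `[< joined e k l >] then 1%N else imem s 5 (r * m2 + l)%N).
Proof.
move=> inp lb se su sv sk km win ordE ll.
have m0 := b_m2_gt0 bd; have bn2 := b_n2 bd; have bm2 := b_m2 bd; have n0 := n2_gt0.
have bnm := b_n2m2 bd.
have m2X : (2 * m2 <= 8 * m2)%N by lia.
have m1X : (m2 <= 8 * m2)%N by lia.
have X0 : (0 < 8 * m2)%N by lia.
set own := imem s 2 in ll.
rewrite /class_body; apply: (htk_seq (htk_mono m2X (clear_loopP inp))) => s1 z1 f1.
have inp1 : inputs s1 by apply: inputs_same f1 _ _ inp.
have lb1 : labels s1 by apply: labels_same f1 _ _ lb.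
have su1 : imem s1 33 0 = (ends e).1 by rewrite f1.1.
have sk1 : imem s1 23 0 = k by rewrite f1.1.
have z14 w : (w < n2)%N -> imem s1 14 w = 0%N by move=> /z1[].
apply: (htk_seq (htk_mono m1X (source_loopP inp1 lb1 su1 sk1 km z14))) => s2 src2 f2.
set class := fun j : 'I_m2 => lab (ends e).1 j = k.+1 in src2.
pose s3 := rset (iset (iset (iset (iset s2 21 0 0%N) 27 0 0%N) 28 0 0%N) 29 0 0%N) 11 0 0.
apply: (@htk_seq _ _ _ _ _ _ _ (fun s' => s' = s3)); first by apply: htk_wp.
move=> _ -> _.
have e0 a : a \notin [:: 25; 22; 13; 14; 21; 27; 28; 29] -> imem s3 a =1 imem s a.
  rewrite !inE !negb_or => /and5P[a25 a22 a13 a14 /and4P[a21 a27 a28 a29]] j.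
  rewrite /= (negbTE a21) (negbTE a27) (negbTE a28) (negbTE a29) /= f2.1 ?f1.1 //.
    by rewrite !inE !negb_or a25 a13 a14.
  by rewrite !inE !negb_or a22 a14.
have r0 a : a != 11%N -> rmem s3 a =1 rmem s a.
  by move=> a11 j; rewrite /= (negbTE a11) /= f2.2 // f1.2.
have lo3 : rmem s3 8 = rmem s 8 by exact/funext/r0.
have hi3 : rmem s3 9 = rmem s 9 by exact/funext/r0.
have fs3 : same [:: 25; 22; 13; 14; 21; 27; 28; 29] [:: 11] s s3.
  by split=> a na; [exact: e0 | apply: r0; move: na; rewrite inE].
have inp3 : inputs s3 by apply: inputs_same fs3 _ _ inp.
have ll3 : linked_lists G2 own (2 * m2) s3 by apply: linked_lists_same fs3 _ ll.
have own3 : imem s3 2 = own by exact/funext/e0.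
have oE h : (h < 2 * m2)%N -> (own h < n2)%N.
  by move=> hm; exact: (enc_own (in_g2 inp) hm).
pose Lf := half_list own (2 * m2).
have tg3 y h : (y < n2)%N -> h \in Lf y -> (imem s3 10 h < n2)%N.
  move=> _; rewrite mem_half_list => /andP[hm _]; rewrite (ll_tgt ll3) //; apply: oE.
  by have := odd_double_half h; rewrite -mul2n; case: ifP => o1; lia.
have hW y h : (y < n2)%N -> h \in Lf y -> (h.+1 < W)%N.
  by move=> _; rewrite mem_half_list => /andP[hm _]; lia.
have [os1 os2 os3] := sorted_of_rank ordE.
have adj1 (a : 'I_n2) h : h \in Lf a -> exists j (z : 'I_n2), [/\ imem s3 10 h = z, inc j a & inc j z].
  move=> hL; have [j [z [h1 h2 h3]]] := half_list_adj1 own3 (in_g2 inp3) hL.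
  exists j, z; split=> //; rewrite (ll_tgt ll3) //.
  by move: hL; rewrite mem_half_list => /andP[].
have adj2 j (a z : 'I_n2) : inc j a -> inc j z -> a != z -> exists2 h, h \in Lf a & imem s3 10 h = z.
  move=> ja jz az; have [h hL E] := half_list_adj2 own3 (in_g2 inp3) ja jz az.
  exists h => //; rewrite (ll_tgt ll3) //.
  by move: hL; rewrite mem_half_list => /andP[].
have win3 (w : 'I_n2) : window_spec (rmem s3 8 w) (rmem s3 9 w) (pos (ends e).1) (pos (ends e).2) (pos w) eps.
  by rewrite lo3 hi3.
have I0 : search_inv n2 Lf (rmem s3 8) (rmem s3 9) (source class) (imem s3 16) False (imem s3 9) (imem s3 10) s3 [::].
  have ord3 : imem s3 16 = imem s 16 by exact/funext/e0.
  rewrite /search_inv; apply: sinv_start; rewrite ?lo3 ?ord3 //.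
  - by move=> w wn; rewrite /= f2.1 //; have [] := z1 w wn.
  - by move=> w wn; exact: (win (Ordinal wn)).1.
(* There are n2 window openings, n2 vertices to scan and at most 2 m2 half-edges; since n2 is at
   most 2 m2, this is at most 6 m2. *)
have muX : (smu n2 Lf (imem s3 28 0) (imem s3 21 0) (imem s3 12) [::] < 8 * m2)%N.
  have := half_list_sum G2 own; rewrite /smu /= addn0 subn0 -/Lf => H.
  apply: leq_ltn_trans (_ : n2 + (n2 + 2 * m2) < _)%N; last by lia.
  by rewrite leq_add2l.
have nW : (n2 + 1 < W)%N by lia.
have kn2 : imem s3 0 2 = n2 by exact: in_n2 inp3.
have hd3 y : (y < n2)%N -> llist (imem s3 9) (imem s3 8 y) (Lf y) by exact: ll_list ll3 y.
apply: (htk_seq (searchP (b_const bd) nW kn2 (lt_const (isT : 2 <= 100)%N) hd3 tg3 hW I0 muX)).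
move=> s4 [[Lc S4] c4 q4 i4] f4.
have inp4 : inputs s4 by apply: inputs_same f4 _ _ inp3.
have lb4 : labels s4 by apply: labels_same f4 _ _ _ => //; apply: labels_same fs3 _ _ lb.
have se4 : imem s4 32 0 = e by rewrite f4.1 // e0.
have su4 : imem s4 33 0 = (ends e).1 by rewrite f4.1 // e0.
have sv4 : imem s4 34 0 = (ends e).2 by rewrite f4.1 // e0.
have sk4 : imem s4 23 0 = k by rewrite f4.1 // e0.
have re4 w : (w < n2)%N -> (imem s4 13 w <= 1)%N by move=> wn; rewrite (s_re S4 wn) leq_b1.
apply: htk_post (htk_mono m1X (mark_loopP inp4 lb4 se4 su4 sv4 sk4 km re4)) _ => s5 H _ r l lm.
rewrite H // f4.1 // e0 //; congr (if _ && _ then _ else _); apply: asbool_equiv_eq.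
(* One direction is soundness of the queue, the other its completeness by [sinv_final]. *)
have reach j : (class j \/ (exists2 w : 'I_n2, inc j w & (0 < imem s4 13 w)%N)) <->
    exists2 i, class i & cert (pos (ends e).1) (pos (ends e).2) eps i j.
  rewrite -(reached_cert _ _ (ltW eps0) adj1 adj2 win3).
  split=> -[cj|]; try by left.
    move=> [w jw]; rewrite (s_re S4 (ltn_ord w)) lt0b => wq; right.
    by exists w, (rmem s4 10 w); split=> //; exact: (s_sound S4 wq).
  move=> [w [t [jw V]]]; right; exists w => //.
  by rewrite (s_re S4 (ltn_ord w)) lt0b; have [] := sinv_final tg3 S4 c4 q4 i4 V.
split.
  by move=> [j lj /reach[i ci ce]]; exists i, j.
by move=> [i [j [li lj ce]]]; exists j => //; apply/reach; exists i.
Qed.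

(** Entries not yet treated are exactly 0: the program writes only ones and relies on memory that is
    zero at the start. *)
Definition reach_upto e k s := forall (f : 'I_(ne G1)) i l, (i < m2)%N -> (l < m2)%N ->
  imem s 5 ((f * m2 + i) * m2 + l)%N =
    ((f < e)%N || (f == e :> nat) && (i < k)%N) && `[< joined f i l >] :> nat.

(** Rows beyond the last placement contain no pair that is joined, so the edge is finished after
    [cnt] rows. *)
Lemma reach_upto_cnt (e : 'I_(ne G1)) k : (cnt (ends e).1 <= k)%N -> forall s, reach_upto e k s -> reach_upto e.+1 0 s.
Proof.
move=> ck s H f i l im lm; rewrite H // andbF orbF ltnS [in RHS]leq_eqVlt.
have [fe|_] := eqVneq (f : nat) e; last by rewrite orbF.
have -> : f = e by exact: val_inj.
rewrite ltnn /=; case: asboolP => [[i' [j [li _ _]]]|]; last by rewrite !andbF.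
have := lab_le (L (ends e).1) i'; rewrite li => /leq_trans/(_ ck) ->.
by [].
Qed.

Lemma cnt_safe s a (v : 'I_(nv G1)) : labels s -> imem s a 0 = v -> (a <= 100)%N ->
  isafe W s (IGet 3 (ivar a)) /\ iev s (IGet 3 (ivar a)) = cnt v.
Proof.
move=> lb sa a100; have [c _] := lb v; have cm := cntm v; have bm2 := b_m2 bd; have bn1 := b_n1 bd; have vn := ltn_ord v.
have vW : (v < W)%N by lia.
have cW : (cnt v < W)%N by lia.
by rewrite /= sa c.
Qed.

Lemma source_class_loopP s (e : 'I_(ne G1)) : inputs s -> labels s -> imem s 32 0 = e ->
  imem s 33 0 = (ends e).1 -> imem s 34 0 = (ends e).2 ->
  (forall w : 'I_n2, window_spec (rmem s 8 w) (rmem s 9 w) (pos (ends e).1) (pos (ends e).2) (pos w) eps) ->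
  (forall w, (w < n2)%N -> imem s 16 (rank n2 (rmem s 8) w) = w) ->
  linked_lists G2 (imem s 2) (2 * m2) s -> reach_upto e 0 s ->
  htk W any source_class_loop s (8 * m2 * m2) (reach_upto e.+1 0).
Proof.
move=> inp lb se su sv win ordE ll R0.
have m0 := b_m2_gt0 bd; have [cs ce] := cnt_safe lb su isT; have cm := cntm (ends e).1.
apply: (@htk_for _ _ _ (reach_upto e) _ _ _ _ (cnt (ends e).1) m2 (8 * m2)) => //.
- by rewrite muln_gt0.
- by rewrite mulnC.
- move=> k s1 kc Ik sk sm; have km : (k < m2)%N by lia.
  have inp1 : inputs s1 by apply: inputs_same sm _ _ inp.
  have lb1 : labels s1 by apply: labels_same sm _ _ lb.
  have g2 : imem s1 2 = imem s 2 by apply: funext; apply: sm.1.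
  have ll1 : linked_lists G2 (imem s1 2) (2 * m2) s1 by rewrite g2; apply: linked_lists_same sm _ ll.
  have lo1 : rmem s1 8 = rmem s 8 by apply: funext; apply: sm.2.
  have hi1 : rmem s1 9 = rmem s 9 by apply: funext; apply: sm.2.
  have win1 (w : 'I_n2) : window_spec (rmem s1 8 w) (rmem s1 9 w) (pos (ends e).1) (pos (ends e).2) (pos w) eps.
    by rewrite lo1 hi1.
  have ord1 w : (w < n2)%N -> imem s1 16 (rank n2 (rmem s1 8) w) = w.
    by move=> wn; rewrite lo1 sm.1 // ordE.
  have se1 : imem s1 32 0 = e by rewrite sm.1.
  have su1 : imem s1 33 0 = (ends e).1 by rewrite sm.1.
  have sv1 : imem s1 34 0 = (ends e).2 by rewrite sm.1.
  apply: htk_post (class_bodyP inp1 lb1 se1 su1 sv1 sk km win1 ord1 ll1) _.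
  move=> s2 H _ f i l im lm; rewrite H // Ik // cell_inj // ltnS [(i <= k)%N]leq_eqVlt.
  have [fe|_] := eqVneq (f : nat) e; last by [].
  have -> : f = e by exact: val_inj.
  rewrite ltnn /=; case: (i =P k) => [->|] //=; rewrite ltnn /=.
  by case: asboolP.
- by move=> s1 H _; apply: reach_upto_cnt H.
Qed.

Lemma reach_loopP s : inputs s -> labels s -> linked_lists G2 (imem s 2) (2 * m2) s ->
  reach_upto 0 0 s ->
  htk W any (reach_loop d) s (nv G1 * (8 * m2 * m2)) (reach_upto (ne G1) 0).
Proof.
move=> inp lb ll R0.
have m0 := b_m2_gt0 bd; have n0 := b_n1_gt0 bd; have mn := b_m1n1 bd.
have X0 : (0 < 8 * m2 * m2)%N by rewrite !muln_gt0 m0.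
have X1 : (2 * m2 <= 8 * m2 * m2)%N by nia.
have X2 : (4 * m2 * m2 <= 8 * m2 * m2)%N by nia.
have bm1 := b_m1 bd; have bn1 := b_n1 bd.
apply: (@htk_for _ _ _ (fun e => reach_upto e 0) _ _ _ _ (ne G1) (nv G1) (8 * m2 * m2)) => //.
- exact: (m1_safe inp).
- exact: in_m1 inp.
- move=> k s1 km Ik sk sm; set e := Ordinal km; have se : imem s1 32 0 = e by [].
  have inp1 : inputs s1 by apply: inputs_same sm _ _ inp.
  have E1 := enc_end1 (in_g1 inp1) e; have E2 := enc_end2 (in_g1 inp1) e.
  have eW : (e < W)%N by lia.
  have e2W : (2 * e < W)%N by lia.
  have e2W' : (2 * e + 1 < W)%N by lia.
  have u1 := ltn_ord (ends e).1; have u2 := ltn_ord (ends e).2.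
  have u1W : ((ends e).1 < W)%N by lia.
  have u2W : ((ends e).2 < W)%N by lia.
  pose s2 := iset s1 33 0 (val (ends e).1); pose s3 := iset s2 34 0 (val (ends e).2).
  apply: (@htk_seq _ _ _ _ _ _ _ (fun s' => s' = s2)).
    by apply: htk_wp => //; rewrite /= se E1.
  move=> _ -> _; apply: (@htk_seq _ _ _ _ _ _ _ (fun s' => s' = s3)).
    by apply: htk_wp => //; rewrite /= se E2.
  move=> _ -> _.
  have inp3 : inputs s3 by do 2!apply: inputs_iset => //.
  have se3 : imem s3 32 0 = e by [].
  apply: (htk_seq (htk_mono X1 (window_loopP inp3 se3))) => s4 win4 f4.
  have inp4 : inputs s4 by apply: inputs_same f4 _ _ inp3.
  apply: (htk_seq (htk_mono X2 (rank_loopP inp4))) => s5 ord5 f5.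
  have inp5 : inputs s5 by apply: inputs_same f5 _ _ inp4.
  have low a : a \notin [:: 22; 23; 24; 25; 26; 27; 28; 29; 30; 13; 14; 15; 37; 12; 16; 21; 5; 32; 33; 34] ->
      imem s5 a =1 imem s a.
    move=> na j; rewrite f5.1; last by apply: contra na; apply/allP: a.
    rewrite f4.1; last by apply: contra na; apply/allP: a.
    have /= [] : a <> 33%N /\ a <> 34%N by split=> E; rewrite E in na.
    move=> /eqP/negbTE -> /eqP/negbTE ->; rewrite sm.1 //.
    by apply: contra na; apply/allP: a.
  have lb5 : labels s5.
    by move=> v; have [a b] := lb v; split=> [|j]; rewrite low.
  have g2 : imem s5 2 = imem s 2 by apply: funext; apply: low.
  have ll5 : linked_lists G2 (imem s5 2) (2 * m2) s5.
    rewrite g2; case: ll => h1 h2 h3; split.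
    - by move=> y yn; rewrite (funext (low 9%N isT)) low //; exact: h1.
    - by move=> x xN; rewrite low //; exact: h2.
    - by move=> x xN; rewrite low //; exact: h3.
  have lo5 : rmem s5 8 = rmem s4 8 by apply: funext; apply: f5.2.
  have hi5 : rmem s5 9 = rmem s4 9 by apply: funext; apply: f5.2.
  have ord5' w : (w < n2)%N -> imem s5 16 (rank n2 (rmem s5 8) w) = w by rewrite lo5; exact: ord5.
  have win5 (w : 'I_n2) : window_spec (rmem s5 8 w) (rmem s5 9 w) (pos (ends e).1) (pos (ends e).2) (pos w) eps.
    by rewrite lo5 hi5.
  have R5 : reach_upto e 0 s5.
    by move=> f i l im lm; rewrite f5.1 // f4.1 //= Ik.
  have se5 : imem s5 32 0 = e by rewrite f5.1 // f4.1.
  have su5 : imem s5 33 0 = (ends e).1 by rewrite f5.1 // f4.1.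
  have sv5 : imem s5 34 0 = (ends e).2 by rewrite f5.1 // f4.1.
  exact: (@source_class_loopP s5 e inp5 lb5 se5 su5 sv5 win5 ord5' ll5 R5).
Qed.

Lemma alive_loopP s : inputs s -> labels s ->
  htk W any alive_loop s (nv G1 * m2) (fun s' => forall v k, (k < cnt v)%N -> imem s' 6 (v * m2 + k)%N = 1%N).
Proof.
move=> inp lb.
have m0 := b_m2_gt0 bd; have n0 := b_n1_gt0 bd; have bm2 := b_m2 bd; have bn1 := b_n1 bd.
pose I n s1 := forall (v : 'I_(nv G1)) k, (v < n)%N -> (k < cnt v)%N -> imem s1 6 (v * m2 + k)%N = 1%N.
apply: (@htk_for _ _ _ I _ _ _ _ (nv G1) (nv G1) m2) => //.
- exact: (n1_safe inp).
- exact: in_n1 inp.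
- move=> n s1 nn In sn sm; set v := Ordinal nn; have sv : imem s1 34 0 = v by [].
  have inp1 : inputs s1 by apply: inputs_same sm _ _ inp.
  have lb1 : labels s1 by apply: labels_same sm _ _ lb.
  have cm := cntm v; have [cs ce] := cnt_safe lb1 sv isT.
  pose J k s2 := I n s2 /\ forall i, (i < k)%N -> imem s2 6 (v * m2 + i)%N = 1%N.
  apply: (@htk_for _ _ _ J _ _ _ _ (cnt v) m2 1) => //.
  + by rewrite muln1.
  + move=> k s2 kc [Ik Jk] sk sm2; have km : (k < m2)%N by lia.
    have inp2 : inputs s2 by apply: inputs_same sm2 _ _ inp1.
    have sv2 : imem s2 34 0 = v by rewrite sm2.1.
    have [cW cW'] := lt_cell nn km.
    have nW : (n < W)%N by lia.
    have kW : (k < W)%N by lia.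
    have mW : (m2 < W)%N by lia.
    have vW : (v < W)%N by [].
    apply: htk_wp => //; rewrite /= sv2 sk (in_m2 inp2); split=> //.
    split=> [v' i v'n ic|i]; rewrite /=.
      have im : (i < m2)%N by have := cntm v'; lia.
      by rewrite cell_inj // (ltn_eqF v'n) /=; exact: Ik.
    rewrite ltnS leq_eqVlt => /predU1P[->|ik]; first by rewrite eqxx.
    by rewrite cell_inj ?(ltn_trans ik) // (ltn_eqF ik) andbF; exact: Jk.
  + move=> s2 [Ik Jk] _ v' i; rewrite ltnS leq_eqVlt => /predU1P[E|v'n]; last exact: Ik.
    have -> : v' = v by exact: val_inj.
    exact: Jk.
- by move=> s1 H _ v k kc; exact: H.
Qed.

Record reached s : Prop := {
  rc_inputs : inputs s;
  rc_labels : labels s;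
  rc_reach : forall (e : 'I_(ne G1)) k l, (k < m2)%N -> (l < m2)%N ->
    imem s 5 ((e * m2 + k) * m2 + l)%N = `[< joined e k l >] :> nat }.

Lemma reach_progP s : inputs s -> labels s -> (forall c, imem s 5 c = 0%N) ->
  htk W any (reach_prog d) s (nv G1 * (8 * m2 * m2)) (fun s' => reached s' /\
    forall v k, (k < cnt v)%N -> imem s' 6 (v * m2 + k)%N = 1%N).
Proof.
move=> inp lb z5.
have m0 := b_m2_gt0 bd; have n0 := b_n1_gt0 bd; have n20 := n2_gt0; have bnm := b_n2m2 bd.
have X1 : (2 * m2 <= nv G1 * (8 * m2 * m2))%N by nia.
have X2 : (nv G1 * m2 <= nv G1 * (8 * m2 * m2))%N by rewrite leq_mul2l; apply/orP; right; nia.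
have M1 : (0 < n2 <= 2 * m2)%N by lia.
have M2 : (0 < m2 <= 2 * m2)%N by lia.
apply: (htk_seq (htk_mono X1 (build_adjP (b_const bd) (b_n2 bd) (b_m2 bd) erefl (or_intror erefl)
   (in_g2 inp) (in_n2 inp) (in_m2 inp) W_gt2 W_gt3 M1 M2))) => s1 ll1 f1.
have inp1 : inputs s1 by apply: inputs_same f1 _ _ inp.
have lb1 : labels s1 by apply: labels_same f1 _ _ lb.
have g2 : imem s1 2 = imem s 2 by apply: funext; apply: f1.1.
rewrite -g2 in ll1.
have R1 : reach_upto 0 0 s1 by move=> f i l im lm; rewrite f1.1 // z5 ltn0 andbF.
apply: (htk_seq (reach_loopP inp1 lb1 ll1 R1)) => s2 R2 f2.
have inp2 : inputs s2 by apply: inputs_same f2 _ _ inp1.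
have lb2 : labels s2 by apply: labels_same f2 _ _ lb1.
apply: htk_post (htk_mono X2 (alive_loopP inp2 lb2)) _ => s3 H f3; split=> //; split.
- by apply: inputs_same f3 _ _ inp2.
- by apply: labels_same f3 _ _ lb2.
- by move=> e k l km lm; rewrite f3.1 // R2 // ltn_ord.
Qed.

(** * Deletion of unsupported placements *)

Implicit Types (v : V).

Definition class v k : set (gpoint G2) := class_set (G := G2) (pos v) eps (lab v) k.
Definition alive s v k := (k < cnt v)%N /\ imem s 6 (v * m2 + k)%N = 1%N.
Definition alive01 s := forall v k, (k < cnt v)%N -> (imem s 6 (v * m2 + k)%N <= 1)%N.
(** The relation imposed on every single store of the pruning step. *)
Definition step_ok s s' := remaining cnt class s' = remaining cnt class s \/
  deletion eps (remaining cnt class s) (remaining cnt class s').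

(** Parent and child may be stored in either order; the flag keeps track of the orientation. *)
Definition end_of (o : bool) (e : E) := if o then (ends e).1 else (ends e).2.
Definition compatible (o : bool) e k l := if o then joined e k l else joined e l k.

Lemma end_of_neq o e : end_of o e != end_of (~~ o) e.
Proof. by case: o; rewrite /end_of /= ?ends_loopless // eq_sym ends_loopless. Qed.

Lemma reachable_compatible o e k l :
  reachable eps (end_of o e) (end_of (~~ o) e) (class (end_of o e) k) (class (end_of (~~ o) e) l) <->
  compatible o e k l.
Proof.
have H f i j : reachable eps (ends f).1 (ends f).2 (class (ends f).1 i) (class (ends f).2 j) <-> joined f i j.
  exact: reachableP (L _) (L _).
case: o; rewrite /end_of /compatible /=; first exact: H.
by rewrite -H; split; apply: reachable_sym (L _) (L _).
Qed.

Lemma compatible_sym o e k l : compatible o e k l <-> compatible (~~ o) e l k.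
Proof. by case: o. Qed.

Lemma remaining_same s s' : imem s' 6 =1 imem s 6 -> remaining cnt class s' = remaining cnt class s.
Proof. by move=> E; apply: funext => v; rewrite /remaining (funext E). Qed.

Lemma step_same im rm s s' : same im rm s s' -> 6%N \notin im -> step_ok s s'.
Proof. by move=> [h _] n6; left; apply: remaining_same; exact: h. Qed.

Lemma step_assign s x n : x != 6%N -> step_ok s (iset s x 0 n).
Proof. by move=> x6; apply: step_same (same_iset x 0 n s) _; rewrite inE eq_sym. Qed.

(** Missing support at a single neighbour already makes a placement invalid, whatever the other
    neighbours offer. *)
Lemma step_delete s o e k : alive s (end_of o e) k ->
  (forall l, alive s (end_of (~~ o) e) l -> ~ compatible o e k l) ->
  step_ok s (iset s 6 (end_of o e * m2 + k)%N 0).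
Proof.
move=> Ak N; right; set x := end_of o e in Ak *; have [kc k1] := Ak.
exists x, (class x k); split; first by exists k.
- move=> /(_ (end_of (~~ o) e)) []; first by apply/adjP; exists e; rewrite /x /end_of; case: (o); [right | left]; exact: surjective_pairing.
  move=> _ [l [lc l1] <-] H; apply: (N l) => //.
  by apply/compatible_sym/reachable_compatible; rewrite negbK.
- have cell w i : (i < cnt w)%N -> imem (iset s 6 (x * m2 + k)%N 0) 6 (w * m2 + i)%N =
      if (w == x) && (i == k) then 0%N else imem s 6 (w * m2 + i)%N.
    by move=> ic; rewrite /= cell_inj ?val_eqE //; have := cntm w; have := cntm x; lia.
  apply: funext => w; apply/seteqP; split=> D.
    move=> [i [ic]]; rewrite cell //; case: ifP => // nwk i1 <-; split; first by exists i.
    move=> [wx E]; rewrite wx in ic E nwk; have [_ inj _] := class_bij (L x).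
    by rewrite (inj i k _ _ E) ?inE // !eqxx in nwk.
  move=> [[i [ic i1] <-] nwk]; exists i => //; split=> //; rewrite cell //.
  by case: ifP => // /andP[/eqP wx /eqP ik]; exfalso; apply: nwk; rewrite wx ik.
Qed.

Lemma reached_same im rm s s' : same im rm s s' -> all (fun a => 5 < a)%N im -> all (fun a => 2 < a)%N rm ->
  reached s -> reached s'.
Proof.
move=> sm ai ar [h1 h2 h3].
have low a : (a < 6)%N -> a \notin im by move=> a6; apply/negP => /(allP ai); lia.
split; last by move=> e k l km lm; rewrite sm.1 ?low // h3.
  by apply: inputs_same sm _ ar h1; apply: sub_all ai => a; lia.
by apply: labels_same sm _ _ h2; apply: low.
Qed.

Lemma cell_compatible s o (e : E) k l : reached s -> (k < m2)%N -> (l < m2)%N ->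
  imem s 5 (e * m2 * m2 + (k * (if o then m2 else 1) + l * (if o then 1 else m2)))%N = `[< compatible o e k l >] :> nat.
Proof.
move=> rc km lm; have H i j : (i < m2)%N -> (j < m2)%N ->
    imem s 5 (e * m2 * m2 + (i * m2 + j))%N = `[< joined e i j >] :> nat.
  by move=> im jm; rewrite -(rc_reach rc e im jm); congr (imem s 5); ring.
case: o; rewrite muln1; first exact: H.
by rewrite [(k + _)%N]addnC H.
Qed.

Lemma support_loopP s o (e : E) k : reached s -> alive01 s -> imem s 32 0 = e ->
  imem s 34 0 = end_of (~~ o) e -> imem s 35 0 = (if o then m2 else 1%N) ->
  imem s 36 0 = (if o then 1%N else m2) -> imem s 23 0 = k -> (k < m2)%N -> imem s 31 0 = 0%N ->
  htk W any support_loop s m2 (fun s' =>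
    imem s' 31 0 = `[< exists2 l, alive s (end_of (~~ o) e) l & compatible o e k l >] :> nat).
Proof.
move=> rc a01 se sy s35 s36 sk km s31; set y := end_of (~~ o) e in sy *.
have inp := rc_inputs rc; have lb := rc_labels rc; have cm := cntm y.
have m0 := b_m2_gt0 bd; have bm2 := b_m2 bd; have bn1 := b_n1 bd; have yn := ltn_ord y.
have [cs ce] := cnt_safe lb sy isT.
have en : (e < nv G1)%N by have := ltn_ord e; have := b_m1n1 bd; lia.
have eW : (e < W)%N by lia.
have yW : (y < W)%N by lia.
have mW : (m2 < W)%N by lia.
have kW : (k < W)%N by lia.
pose I i s1 := imem s1 31 0 = `[< exists2 l, (l < i)%N /\ alive s y l & compatible o e k l >] :> nat.
apply: (@htk_for _ _ _ I _ _ _ _ (cnt y) m2 1) => //.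
- by rewrite muln1.
- by rewrite /I s31 asboolF // => -[l []].
- move=> l s1 lc Il sl sm; have lm : (l < m2)%N by lia.
  have rc1 : reached s1 by apply: reached_same sm _ _ rc.
  have al1 : imem s1 6 (y * m2 + l)%N = imem s 6 (y * m2 + l)%N by rewrite sm.1.
  have se1 : imem s1 32 0 = e by rewrite sm.1.
  have sy1 : imem s1 34 0 = y by rewrite sm.1.
  have sk1 : imem s1 23 0 = k by rewrite sm.1.
  have p1 : imem s1 35 0 = (if o then m2 else 1%N) by rewrite sm.1.
  have p2 : imem s1 36 0 = (if o then 1%N else m2) by rewrite sm.1.
  have em2 : imem s1 0 3 = m2 by exact: in_m2 (rc_inputs rc1).
  have lW : (l < W)%N by lia.
  have [cW cW'] := lt_cell yn lm.
  have alW : (imem s1 6 (y * m2 + l) < W)%N by have := a01 y l lc; lia.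
  have [k1 k2 k3 k4] := lt_cube en km lm; have [l1 l2 l3 l4] := lt_cube en lm km.
  have oW : ((if o then m2 else 1) < W)%N by case: (o).
  have oW' : ((if o then 1 else m2) < W)%N by case: (o).
  have t0 : (e * m2 * m2 < W)%N by apply: leq_ltn_trans k3; rewrite leq_mul2r leq_addr orbT.
  have Sle : (e * m2 * m2 + (k * (if o then m2 else 1) + l * (if o then 1 else m2)) < W)%N.
    by case: (o); rewrite muln1; move: k4 l4; rewrite !mulnDl; lia.
  have t1 : (k * (if o then m2 else 1) + l * (if o then 1 else m2) < W)%N.
    by apply: leq_ltn_trans Sle; exact: leq_addl.
  have t2 : (k * (if o then m2 else 1) < W)%N by apply: leq_ltn_trans t1; exact: leq_addr.
  have t3 : (l * (if o then 1 else m2) < W)%N by apply: leq_ltn_trans t1; exact: leq_addl.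
  have cc := cell_compatible o e rc1 km lm.
  have ccW : (imem s1 5 (e * m2 * m2 + (k * (if o then m2 else 1) + l * (if o then 1 else m2))) < W)%N.
    by rewrite cc; case: asboolP.
  have step : `[< exists2 l', (l' < l.+1)%N /\ alive s y l' & compatible o e k l' >] =
      (0 < imem s1 31 0)%N || ((0 < imem s1 6 (y * m2 + l))%N && `[< compatible o e k l >]).
    rewrite Il lt0b al1; apply/asboolP/orP.
      move=> [l' [+ Al] cl]; rewrite ltnS leq_eqVlt => /predU1P[E|ll].
        by right; move: Al cl; rewrite E => -[_ ->] cl; apply/asboolP.
      by left; apply/asboolP; exists l'.
    move=> [/asboolP[l' [ll Al] cl]|/andP[Al /asboolP cl]]; first by exists l' => //; split=> //; exact: ltnW.
    exists l => //; split=> //; split=> //; have := a01 y l lc; lia.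
  apply: htk_wp => //.
  rewrite /= se1 sy1 sk1 p1 p2 sl em2; split=> //.
  rewrite cc lt0b; case: ifP => cond.
    by split=> //; rewrite /I step cond orbT.
  by rewrite /I step cond orbF Il lt0b.
- move=> s1 H _; rewrite H; congr nat_of_bool; apply: asbool_equiv_eq.
  split=> [[l [lc Al] cl]|[l Al cl]]; first by exists l.
  by exists l => //; split=> //; case: Al.
Qed.

(** Support may be judged in the old state, as the loop changes only the placements of [end_of o e]
    and the supporting end is different. *)
Definition revised o e s s' := forall v k, alive s' v k <-> alive s v k /\
  (v = end_of o e -> exists2 l, alive s (end_of (~~ o) e) l & compatible o e k l).

Lemma reviseP s o (e : E) : reached s -> alive01 s -> imem s 32 0 = e -> imem s 33 0 = end_of o e ->
  imem s 34 0 = end_of (~~ o) e ->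
  htk W step_ok revise s (m2 * m2) (fun s' => [/\ reached s', alive01 s' & revised o e s s']).
Proof.
move=> rc a01 se sx sy; set x := end_of o e in sx *; set y := end_of (~~ o) e in sy *.
have xy : x != y by exact: end_of_neq.
have m0 := b_m2_gt0 bd; have bm2 := b_m2 bd; have bn1 := b_n1 bd; have xn := ltn_ord x.
have bm1 := b_m1 bd; have em := ltn_ord e; have un := ltn_ord (ends e).1.
have eW : (e < W)%N by lia.
have e2W : (2 * e < W)%N by lia.
have uW : ((ends e).1 < W)%N by lia.
have xW : (x < W)%N by lia.
have mW : (m2 < W)%N by lia.
have X0 : (0 < m2 * m2)%N by rewrite muln_gt0 m0.
have E1 := enc_end1 (in_g1 (rc_inputs rc)) e; have m2E := in_m2 (rc_inputs rc).
apply: (@htk_seq _ _ _ _ _ _ _ (fun s1 => imem s1 35 0 = (if o then m2 else 1%N) /\ imem s1 36 0 = if o then 1%N else m2)).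
  apply: htk_guarantee => [s1 s2 sm|]; first exact: step_same sm _.
  apply: htk_wp => //; rewrite /= se sx E1 m2E -eqn_leq; split=> //.
  have -> : ((ends e).1 == x :> nat) = o.
    by rewrite /x /end_of val_eqE; case: (o); rewrite ?eqxx // (negbTE (ends_loopless e)).
  by case: (o).
move=> s0 [s35 s36] f0.
have rc0 : reached s0 by apply: reached_same f0 _ _ rc.
have al0 v k : alive s0 v k <-> alive s v k by rewrite /alive f0.1.
have a010 : alive01 s0 by move=> v k kc; rewrite f0.1 // a01.
have sx0 : imem s0 33 0 = x by rewrite f0.1.
have lb0 := rc_labels rc0; have [cs ce] := cnt_safe lb0 sx0 isT; have cm := cntm x.
pose supp k := exists2 l, alive s y l & compatible o e k l.
pose I i s1 := alive01 s1 /\ forall v k, alive s1 v k <-> alive s v k /\ (v = x -> (k < i)%N -> supp k).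
apply: (@htk_for _ _ _ I _ _ _ _ (cnt x) m2 m2) => //.
- by move=> s1 k; exact: step_same (same_iset 23 0 k s1) _.
- by split=> // v k; rewrite al0; split=> [h|[]//]; split.
- move=> k s1 kc [h01 hA] sk sm; have km : (k < m2)%N by lia.
  have rc1 : reached s1.
    have [h1 h2] := sm; have [i1 i2 i3] := rc0; split.
    - by apply: inputs_same sm _ _ i1.
    - by apply: labels_same sm _ _ i2.
    - by move=> f i l im lm; rewrite sm.1 // i3.
  have sx1 : imem s1 33 0 = x by rewrite sm.1.
  have sy1 : imem s1 34 0 = y by rewrite sm.1 // f0.1.
  have se1 : imem s1 32 0 = e by rewrite sm.1 // f0.1.
  have m2E1 : imem s1 0 3 = m2 by exact: in_m2 (rc_inputs rc1).
  have kW : (k < W)%N by lia.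
  have [cW cW'] := lt_cell xn km.
  have alW : (imem s1 6 (x * m2 + k) < W)%N by have := h01 x k kc; lia.
  have Ax : alive s1 x k <-> (0 < imem s1 6 (x * m2 + k))%N.
    by split=> [[_ ->] //|h]; split=> //; have := h01 x k kc; lia.
  have Axs : alive s1 x k <-> alive s x k.
    by rewrite hA; split=> [[]//|h]; split=> // _; rewrite ltnn.
  have Ay l : alive s1 y l <-> alive s y l.
    by rewrite hA; split=> [[]//|h]; split=> // yx; rewrite yx eqxx in xy.
  have keep s2 : imem s2 6 =1 imem s1 6 -> (alive s x k -> supp k) -> I k.+1 s2.
    move=> E ok; split; first by move=> v i ic; rewrite E h01.
    move=> v i; rewrite /alive E -/(alive s1 v i) hA; split=> -[h1 h2]; split=> // vx.
      rewrite ltnS leq_eqVlt => /predU1P[ik|]; last exact: h2.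
      by rewrite ik; apply: ok; rewrite -vx -ik.
    by move=> ik; apply: h2 => //; exact: ltnW.
  apply: htk_if => //.
    by rewrite /= sx1 sk m2E1.
  rewrite [bev _ _]/(0 < _)%N /= sx1 sk m2E1; case: ifP => c.
    have Ak : alive s1 x k by apply/Ax.
    pose s2 := iset s1 31 0 0%N.
    apply: (@htk_seq _ _ _ _ _ _ _ (fun s' => s' = s2)).
      apply: htk_guarantee => [s3 s4 sm3|]; first exact: step_same sm3 _.
      exact: htk_wp.
    move=> _ -> _.
    have rc2 : reached s2 by apply: reached_same (same_iset _ _ _ _) _ _ rc1.
    have p1 : imem s2 35 0 = (if o then m2 else 1%N) by rewrite /= sm.1.
    have p2 : imem s2 36 0 = (if o then 1%N else m2) by rewrite /= sm.1.
    apply: (@htk_seq _ _ _ _ _ _ _ (fun s' => imem s' 31 0 = `[< supp k >] :> nat)).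
      apply: htk_guarantee => [s3 s4 sm3|]; first exact: step_same sm3 _.
      apply: htk_post (@support_loopP s2 o e k rc2 h01 se1 sy1 p1 p2 sk km erefl) _ => s3 -> _.
      congr nat_of_bool; apply: asbool_equiv_eq.
      by split=> -[l Al cl]; exists l => //; apply/Ay.
    move=> s3 s31 f3.
    have sx3 : imem s3 33 0 = x by rewrite f3.1.
    have sk3 : imem s3 23 0 = k by rewrite f3.1.
    have m2E3 : imem s3 0 3 = m2 by rewrite f3.1.
    have E6 : imem s3 6 =1 imem s1 6 by move=> j; rewrite f3.1.
    have bW : (imem s3 31 0 < W)%N by rewrite s31; case: asboolP.
    apply: htk_if => //.
    rewrite [bev _ _]/(_ <= 0)%N /= s31; case: asboolP => [sk1|nsk] /=; last first.
      (* The only store that changes the set of remaining placements. *)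
      apply: (htk_mono m0); apply: ht_htk; apply: ht_istore.
      - by rewrite /= sx3 sk3 m2E3.
      - by [].
      - rewrite /= sx3 sk3 m2E3; apply: step_delete.
          by rewrite /alive E6; exact: Ak.
        move=> l; rewrite /alive E6 -/(alive s1 _ l) => /Ay Al cl; apply: nsk; by exists l.
      - rewrite /= sx3 sk3 m2E3; split.
          move=> v i ic; rewrite /=; case: ifP => // _; rewrite E6; exact: h01.
        move=> v i; rewrite /alive /= E6.
        have [ic|ic] := ltnP i (cnt v); last first.
          by split=> [[]|[[]]].
        have im : (i < m2)%N by have := cntm v; lia.
        rewrite cell_inj // val_eqE; case: ifP => [/andP[/eqP -> /eqP ->]|ne].
          by split=> [[]//|[_ /(_ erefl (ltnSn k))]].
        split=> [[_ h]|[h1 h2]].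
          have [[_ h1] h2] := iffLR (hA v i) (conj ic h); split=> // vx.
          rewrite ltnS leq_eqVlt => /predU1P[ik|]; last exact: h2.
          by rewrite vx ik !eqxx in ne.
        have [_ h1'] := h1; suff [] : alive s1 v i by [].
        by apply/hA; split=> // vx ik; apply: h2 => //; exact: ltnW.
    apply: htk_guarantee => [s4 s5 sm4|]; first exact: step_same sm4 _.
    by apply: htk_wp => //; apply: keep.
  apply: htk_guarantee => [s4 s5 sm4|]; first exact: step_same sm4 _.
  by apply: htk_wp => //; apply: keep => // /Axs/Ax c'; move: c; rewrite subn_eq0 c'.
- move=> s1 [h01 hA] sm; split=> //.
    have [i1 i2 i3] := rc0; split.
    - by apply: inputs_same sm _ _ i1.
    - by apply: labels_same sm _ _ i2.
    - by move=> f i l im lm; rewrite sm.1 // i3.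
  move=> v k; rewrite hA; split=> -[h1 h2]; split=> // vx; last by move=> _; exact: h2.
  by apply: h2 => //; case: h1 => + _; rewrite vx.
Qed.

(** * The rooted tree *)

Record bfs (u : nat -> 'I_n1) s : Prop := {
  bf_queue : forall k, (k < n1)%N -> imem s 12 k = u k;
  bf_grown : grown u n1;
  bf_parent : forall k, (0 < k < n1)%N -> exists k' o (e : 'I_(ne G1)),
    [/\ (k' < k)%N, u k = end_of o e /\ u k' = end_of (~~ o) e, (imem s 15 (u k) < 2 * ne G1)%N,
        imem s 1 (imem s 15 (u k)) = u k' & imem s 11 (imem s 15 (u k)) = e] }.

Lemma root_searchP s : inputs s ->
  htk W any root_search s (4 * n1) (fun s' => exists u, bfs u s').
Proof.
move=> inp.
have n0 := b_n1_gt0 bd; have mn := b_m1n1 bd; have bn1 := b_n1 bd; have bm1 := b_m1 bd.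
have X0 : (0 < 4 * n1)%N by lia.
have M1 : (0 < n1 <= 4 * n1)%N by lia.
have M2 : (0 < ne G1 <= 4 * n1)%N by lia.
set own := imem s 1.
apply: (htk_seq (build_adjP (b_const bd) (b_n1 bd) (b_m1 bd) (erefl own) (or_introl erefl)
   (in_g1 inp) (in_n1 inp) (in_m1 inp) W_gt0 W_gt1 M1 M2)) => s1 ll1 f1.
have inp1 : inputs s1 by apply: inputs_same f1 _ _ inp.
pose I k s := forall w, (w < k)%N -> [/\ imem s 13 w = 0%N, imem s 14 w = 0%N, rmem s 8 w = 0 & rmem s 9 w = 0].
apply: (@htk_seq _ _ _ _ _ _ _ (I n1)).
  apply: (@htk_for _ _ _ I _ _ _ _ n1 n1 1) => //.
  - exact: (n1_safe inp1).
  - exact: in_n1 inp1.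
  - by rewrite muln1 leq_pmull.
  - move=> k s2 kn Ik sk sm; apply: htk_wp => //.
    have kW : (k < W)%N by lia.
    rewrite /= sk; do 4!split=> //; move=> w; rewrite ltnS leq_eqVlt => /predU1P[->|wk] /=.
      by rewrite eqxx.
    by rewrite ltn_eqF //; exact: Ik.
move=> s2 I2 f2.
have inp2 : inputs s2 by apply: inputs_same f2 _ _ inp1.
pose s3 := rset (iset (iset (iset (iset s2 21 0 0%N) 27 0 0%N) 28 0 0%N) 29 0 0%N) 11 0 0.
apply: (@htk_seq _ _ _ _ _ _ _ (fun s' => s' = s3)); first by apply: htk_wp.
move=> _ -> _; apply: (@htk_seq _ _ _ _ _ _ _ (fun s' => s' = iset s3 14 0 1%N)); first by apply: htk_wp.
move=> _ -> _; pose s4 := iset (iset (rset (iset (iset s3 14 0 1%N) 13 0 1%N) 10 0 0) 12 0 0%N) 29 0 1%N.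
apply: (@htk_seq _ _ _ _ _ _ _ (fun s' => s' = s4)); first by apply: htk_wp.
move=> _ -> _; pose s5 := iset s4 21 0 n1.
have n1W : (n1 < W)%N by lia.
have en : imem s2 0 0 = n1 by exact: in_n1 inp2.
apply: (@htk_seq _ _ _ _ _ _ _ (fun s' => s' = s5)); first by apply: htk_wp => //=; rewrite en.
move=> _ -> _.
have f5 : same [:: 21; 27; 28; 29; 14; 13; 12] [:: 11; 10] s2 s5.
  split=> a; rewrite !inE !negb_or; first move=> /and5P[a1 a2 a3 a4 /and3P[a5 a6 a7]] j.
    by rewrite /= (negbTE a1) (negbTE a2) (negbTE a3) (negbTE a4) (negbTE a5) (negbTE a6) (negbTE a7).
  by move=> /andP[a1 a2] j; rewrite /= (negbTE a1) (negbTE a2).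
have inp5 : inputs s5 by apply: inputs_same f5 _ _ inp2.
have ll5 : linked_lists G1 own (2 * ne G1) s5.
  by apply: linked_lists_same f5 _ _ => //; apply: linked_lists_same f2 _ ll1.
have own5 : imem s5 1 = own.
  by apply: funext => j; rewrite f5.1 // f2.1 // f1.1.
pose Lf := half_list own (2 * ne G1).
have oE h : (h < 2 * ne G1)%N -> (own h < n1)%N by move=> hm; exact: (enc_own (in_g1 inp) hm).
have tg5 y h : (y < n1)%N -> h \in Lf y -> (imem s5 10 h < n1)%N.
  move=> _; rewrite mem_half_list => /andP[hm _]; rewrite (ll_tgt ll5) //; apply: oE.
  by have := odd_double_half h; rewrite -mul2n; case: ifP => o1; lia.
have hW y h : (y < n1)%N -> h \in Lf y -> (h.+1 < W)%N.
  by move=> _; rewrite mem_half_list => /andP[hm _]; lia.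
have I0 : search_inv n1 Lf (rmem s5 8) (rmem s5 9) (fun z => z = 0%N) (imem s5 16) True (imem s5 9) (imem s5 10) s5 [::].
  refine (@sinv_root R n1 Lf (imem s5 9) (imem s5 10) (rmem s5 8) (rmem s5 9) (imem s5 16)
    (imem s5 12) (imem s5 13) (imem s5 14) (imem s5 15) (rmem s5 10) n0 _ _ _ _ _) => //.
  - by move=> y yn; rewrite !f5.2 //; have [] := I2 y yn.
  - by move=> y yn; rewrite /=; case: (y == 0%N) => //; have [] := I2 y yn.
  - by move=> y yn; rewrite /=; case: (y == 0%N) => //; have [] := I2 y yn.
(* No window openings are left; the vertices and half-edges together count at most 3 n1. *)
have muX : (smu n1 Lf (imem s5 28 0) (imem s5 21 0) (imem s5 12) [::] < 4 * n1)%N.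
  have := half_list_sum G1 own; rewrite /smu /= addn0 subnn -/Lf => H.
  by apply: leq_ltn_trans (_ : n1 + 2 * ne G1 < _)%N => //; lia.
have nW : (n1 + 1 < W)%N by lia.
have kn1 : imem s5 0 0 = n1 by exact: in_n1 inp5.
have hd5 y : (y < n1)%N -> llist (imem s5 9) (imem s5 8 y) (Lf y) by exact: ll_list ll5 y.
apply: htk_post (searchP (b_const bd) nW kn1 W_gt0 hd5 tg5 hW I0 muX) _ => s6 [[Lc S6] q4 q5 q6] f6.
have inp6 : inputs s6 by apply: inputs_same f6 _ _ inp5.
have ll6 : linked_lists G1 own (2 * ne G1) s6 by apply: linked_lists_same f6 _ ll5.
have own6 : imem s6 1 = own by rewrite -own5; apply: funext; apply: f6.1.
have tg6 : imem s6 10 = imem s5 10 by apply: funext; apply: f6.1.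
(* As every window is {0}, connectedness brings the search to every vertex at time 0. *)
have all z : (z < n1)%N -> z \in mkseq (imem s6 12) (imem s6 29 0).
  move=> zn; have win (y : nat) : (y < n1)%N -> rmem s5 8 y <= 0 <= rmem s5 9 y.
    by move=> yn; rewrite !f5.2 //; have [_ _ -> ->] := I2 y yn; rewrite lexx.
  pose P (y : 'I_n1) := `[< VR n1 Lf (imem s5 10) (rmem s5 8) (rmem s5 9) (fun z => z = 0%N) y 0 >].
  suff /asboolP V : P (Ordinal zn) by have [] := sinv_final tg5 S6 q4 q5 q6 V.
  apply: (connect_invariant (S := P) _ (tree.1 (Ordinal n0) (Ordinal zn))); last first.
    by apply/asboolP; apply: VR_src => //; exact: win.
  move=> x y /asboolP Vx xy; apply/asboolP; have [j jxy] := adjP _ _ xy.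
  have jx : inc j x by rewrite /inc; case: jxy => ->; rewrite eqxx ?orbT.
  have jy : inc j y by rewrite /inc; case: jxy => ->; rewrite eqxx ?orbT.
  have nxy : x != y by apply: contraTneq xy => ->; exact: adj_irr.
  have [h hL E] := half_list_adj2 own6 (in_g1 inp6) jx jy nxy.
  apply: (VR_step Vx hL) => //; last by exact: win.
  by rewrite (ll_tgt ll5) //; move: hL; rewrite mem_half_list => /andP[].
have qn : imem s6 29 0 = n1.
  have := sinv_qe_le S6; have := uniq_leq_size (iota_uniq 0 n1) (s2 := mkseq (imem s6 12) (imem s6 29 0)).
  rewrite size_mkseq size_iota => /(_ _) H; have : (n1 <= imem s6 29 0)%N.
    by apply: H => z; rewrite mem_iota; exact: all.
  lia.
pose u k := insubd (Ordinal n0) (imem s6 12 k).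
have uE k : (k < n1)%N -> imem s6 12 k = u k.
  by move=> kn; rewrite val_insubd (s_lt S6) //; apply: mkseq_mem; rewrite qn.
have [_ _ uq] := s_q S6; have [_ parents] := s_tree S6 Logic.I.
have par k : (0 < k < n1)%N -> exists k' o (e : 'I_(ne G1)),
    [/\ (k' < k)%N, u k = end_of o e /\ u k' = end_of (~~ o) e, (imem s6 15 (u k) < 2 * ne G1)%N,
        imem s6 1 (imem s6 15 (u k)) = u k' & imem s6 11 (imem s6 15 (u k)) = e].
  move=> kn; have kn' : (k < n1)%N by lia.
  have [|k' [k'k]] := parents k; first by rewrite qn.
  have k'n : (k' < n1)%N by lia.
  rewrite !uE //; set h := imem s6 15 (u k); rewrite mem_half_list => /andP[hm /eqP oh].
  rewrite -tg6 (ll_tgt ll6) // => th.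
  have h2 : (h./2 < ne G1)%N by lia.
  have E1 := enc_end1 (in_g1 inp6) (Ordinal h2); have E2 := enc_end2 (in_g1 inp6) (Ordinal h2); rewrite own6 /= in E1 E2.
  have hE := odd_double_half h; rewrite -mul2n in hE.
  (* Half-edge [h] leaves the parent. If it is odd, the parent is the second end and the child the
     first. *)
  exists k', (odd h), (Ordinal h2); rewrite own6 (ll_edge ll6) //; split=> //; split; apply: val_inj.
    rewrite /= -th /end_of; case: ifP hE => _ hE; rewrite -?E1 -?E2; congr own; lia.
  rewrite /= -oh /end_of; case: (odd h) hE => /= hE; rewrite -?E1 -?E2; congr own; lia.
exists u; split=> //; split.
  move=> i j iN jN E; apply/eqP; rewrite -(nth_uniq 0%N _ _ uq) ?size_mkseq ?qn //.
  by rewrite !nth_mkseq ?qn // !uE // E.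
move=> k kn; have [k' [b [e [k'k [uk uk'] _ _ _]]]] := par k kn.
exists k' => //; apply/adjP; exists e; rewrite uk uk' /end_of; case: b {uk uk'}; [right|left]; exact: surjective_pairing.
Qed.

(** Completeness of pruning: the placements of a feasible assignment support each other, so none of
    them is ever deleted. The predecessor undoes the shift of the labels. *)
Definition keeps s := forall js : V -> 'I_m2, feasible eps js -> forall v, alive s v (lab v (js v)).-1.

Lemma feasible_lab js : feasible eps js -> forall v, (0 < lab v (js v) <= cnt v)%N.
Proof. by move=> [h _] v; rewrite (lab_le (L v)) andbT; apply/(lab_hits (L v)). Qed.

Lemma revised_keeps b f s s' : revised b f s s' -> keeps s -> keeps s'.
Proof.
move=> rv kp js fj v; apply/rv; split; first exact: kp.
move=> vx; exists (lab (end_of (~~ b) f) (js (end_of (~~ b) f))).-1; first exact: kp.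
have pk w : lab w (js w) = (lab w (js w)).-1.+1 by rewrite prednK //; have /andP[] := feasible_lab fj w.
by rewrite vx; case: b {rv vx} => /=; exists (js (ends f).1), (js (ends f).2); split=> //; exact: fj.2.
Qed.

(** [p k] is the position of the parent, [e k] the edge to it, and [o k] tells which end of [e k] is
    the child. *)
Definition tree_order (u : nat -> V) (p : nat -> nat) (o : nat -> bool) (e : nat -> E) :=
  grown u n1 /\ forall k, (0 < k < n1)%N -> [/\ (p k < k)%N, u k = end_of (o k) (e k) & u (p k) = end_of (~~ o k) (e k)].

Record rooted (u : nat -> V) (p : nat -> nat) (e : nat -> E) s : Prop := {
  rt_queue : forall k, (k < n1)%N -> imem s 12 k = u k;
  rt_parent : forall k, (0 < k < n1)%N -> [/\ (imem s 15 (u k) < 2 * ne G1)%N,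
    imem s 1 (imem s 15 (u k)) = u (p k) & imem s 11 (imem s 15 (u k)) = e k] }.

Lemma rooted_same im rm u p e s s' : same im rm s s' -> all (fun a => a \notin im) [:: 1; 11; 12; 15] ->
  rooted u p e s -> rooted u p e s'.
Proof.
move=> [h _] /= /and5P[i1 i11 i12 i15 _] [h1 h2]; split=> k kn; first by rewrite h // h1.
by rewrite !h //; exact: h2.
Qed.

Lemma rooted_of_bfs u s : bfs u s -> exists p o e, tree_order u p o e /\ rooted u p e s.
Proof.
move=> [h1 h2 h3]; have /choice[f fP] : forall k, exists x : nat * bool * E, (0 < k < n1)%N ->
    [/\ (x.1.1 < k)%N, u k = end_of x.1.2 x.2 /\ u x.1.1 = end_of (~~ x.1.2) x.2, (imem s 15 (u k) < 2 * ne G1)%N,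
        imem s 1 (imem s 15 (u k)) = u x.1.1 & imem s 11 (imem s 15 (u k)) = x.2].
  move=> k; have [kn|kn] := boolP (0 < k < n1)%N; last by exists (0%N, true, Ordinal m1_gt0).
  by have [k' [b [f H]]] := h3 k kn; exists (k', b, f).
exists (fun k => (f k).1.1), (fun k => (f k).1.2), (fun k => (f k).2).
by split; split=> // k kn; have [? [? ?] ? ? ?] := fP k kn.
Qed.

(** * The two passes along the tree *)

Section Order.
Context (u : nat -> V) (p : nat -> nat) (o : nat -> bool) (e : nat -> E) (ord : tree_order u p o e).

Definition up_ok k s := forall i, alive s (u (p k)) i -> exists2 l, alive s (u k) l & compatible (~~ o k) (e k) i l.
Definition down_ok k s := forall l, alive s (u k) l -> exists2 i, alive s (u (p k)) i & compatible (o k) (e k) l i.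

Lemma order_neq i j : (i < n1)%N -> (j < n1)%N -> i <> j -> u i <> u j.
Proof. by move=> iN jN ij /(ord.1.1 _ _ iN jN). Qed.

(** Only the parent at position [p k < k] loses placements. For later edges it is not the supporting
    child, and losing placements at a supported vertex does no harm. *)
Lemma revised_up k s s' : (0 < k < n1)%N -> revised (~~ o k) (e k) s s' ->
  up_ok k s' /\ forall j, (k < j < n1)%N -> up_ok j s -> up_ok j s'.
Proof.
move=> kn rv; have [pk uk upk] := ord.2 k kn; rewrite /revised negbK -upk -uk in rv.
have keep j l : (k <= j < n1)%N -> alive s (u j) l -> alive s' (u j) l.
  by move=> jn al; apply/rv; split=> // E; exfalso; apply: order_neq E; lia.
split.
  move=> i /rv[_ /(_ erefl)[l al cl]]; exists l => //; apply: keep => //; lia.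
move=> j kj H i /rv[/H[l al cl] _]; exists l => //; apply: keep => //; lia.
Qed.

(** Upward support survives at [k]: the child placement that supports a parent placement [i] is
    itself supported by [i], hence not deleted. Downward support at earlier positions relies on
    vertices that are left alone. *)
Lemma revised_down k s s' : (0 < k < n1)%N -> revised (o k) (e k) s s' ->
  (forall j, (0 < j < n1)%N -> up_ok j s) ->
  [/\ down_ok k s', forall j, (0 < j < k)%N -> down_ok j s -> down_ok j s' &
     forall j, (0 < j < n1)%N -> up_ok j s'].
Proof.
move=> kn rv up; have [pk uk upk] := ord.2 k kn; rewrite /revised -upk -uk in rv.
have keep j l : (j < n1)%N -> j <> k -> alive s (u j) l -> alive s' (u j) l.
  by move=> jn jk al; apply/rv; split=> // E; exfalso; apply: order_neq E => //; lia.
split.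
- move=> l /rv[_ /(_ erefl)[i al cl]]; exists i => //; apply: keep => //; lia.
- move=> j jk H l /rv[/H[i al cl] _]; exists i => //.
  have [|pj _ _] := ord.2 j; first by lia.
  by apply: keep => //; lia.
- move=> j jn i /rv[ai _]; have [l al cl] := up j jn i ai; exists l => //.
  have [jk|jk] := eqVneq j k; last by apply: keep => //; lia.
  rewrite jk in ai al cl *; apply/rv; split=> // _; exists i => //.
  by apply/compatible_sym.
Qed.

Lemma at_edgeP s q k (down : bool) : reached s -> alive01 s -> rooted u p e s -> (0 < k < n1)%N ->
  isafe W s q -> iev s q = k ->
  htk W step_ok (at_edge q (if down then 33 else 34)%N (if down then 34 else 33)%N) s (m2 * m2) (fun s' =>
    [/\ reached s', alive01 s' & revised (if down then o k else ~~ o k) (e k) s s']).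
Proof.
move=> rc a01 rt kn sq qk; have bn1 := b_n1 bd; have bm1 := b_m1 bd.
have X0 : (0 < m2 * m2)%N by rewrite muln_gt0 (b_m2_gt0 bd).
have [pk uk upk] := ord.2 k kn; have [h15 h1 h11] := rt_parent rt kn.
have uW : (u k < W)%N by have := ltn_ord (u k); lia.
have upW : (u (p k) < W)%N by have := ltn_ord (u (p k)); lia.
have eW : (e k < W)%N by have := ltn_ord (e k); lia.
have hW : (imem s 15 (u k) < W)%N by lia.
have q12 : imem s 12 k = u k by apply: rt_queue rt _ _; lia.
set a := (if down then 33 else 34)%N; set b := (if down then 34 else 33)%N.
have [a6 b6] : a != 6%N /\ b != 6%N by rewrite /a /b; case: (down).
have [a15 a1 a11] : [/\ (15 == a)%N = false, (1 == a)%N = false & (11 == a)%N = false] by rewrite /a; case: (down).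
have [b11 b37] : (11 == b)%N = false /\ (37 == b)%N = false by rewrite /a /b; case: (down).
apply: (htk_assign (n := val (u k))) => //; [by rewrite /= qk q12|by rewrite /= qk|exact: step_assign|].
apply: (htk_assign (n := imem s 15 (u k))) => //=; rewrite ?eqxx ?a15 //=; first exact: step_assign.
apply: (htk_assign (n := val (u (p k)))) => //=; rewrite ?eqxx ?a1 /= ?h1 //=; first exact: step_assign.
apply: (htk_assign (n := val (e k))) => //=; rewrite ?b11 ?b37 ?a11 /= ?h11 //=; first exact: step_assign.
set s6 := iset _ 32 0 _.
have f6 : same [:: a; 37; b; 32] [::] s s6.
  by split=> // x; rewrite !inE !negb_or => /and4P[x1 x2 x3 x4] j;
    rewrite /= (negbTE x1) (negbTE x2) (negbTE x3) (negbTE x4).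
have rc6 : reached s6 by apply: reached_same f6 _ _ rc; rewrite /a /b; case: (down).
have a016 : alive01 s6.
  by move=> v i ic; rewrite f6.1 ?a01 // /a /b; case: (down).
have sxy : imem s6 33 0 = end_of (if down then o k else ~~ o k) (e k) /\
    imem s6 34 0 = end_of (~~ (if down then o k else ~~ o k)) (e k).
  by rewrite /s6 /a /b; case: (down); rewrite /= ?negbK -uk -upk.
apply: htk_post (reviseP rc6 a016 erefl sxy.1 sxy.2) _ => s7 [rc7 a7 rv] _; split=> // v i.
have E w j : alive s6 w j <-> alive s w j by rewrite /alive f6.1 // /a /b; case: (down).
by rewrite rv E; split=> -[h2 h3]; split=> // vx; have [l /E al cl] := h3 vx; exists l.
Qed.

Lemma up_loopP s : reached s -> alive01 s -> keeps s -> rooted u p e s ->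
  htk W step_ok up_loop s (n1 * (m2 * m2)) (fun s' => [/\ alive01 s', keeps s' &
    forall k, (0 < k < n1)%N -> up_ok k s']).
Proof.
move=> rc a01 kp rt.
have n0 := b_n1_gt0 bd; have bn1 := b_n1 bd; have bm1 := b_m1 bd; have m0 := b_m2_gt0 bd.
have X0 : (0 < m2 * m2)%N by rewrite muln_gt0 m0.
pose I i s := [/\ alive01 s, keeps s & forall k, (0 < k < n1)%N -> (n1 - i <= k)%N -> up_ok k s].
apply: (@htk_for _ _ _ I _ _ _ _ n1 n1 (m2 * m2)) => //.
- exact: (n1_safe (rc_inputs rc)).
- exact: in_n1 (rc_inputs rc).
- by move=> s1 k; exact: step_same (same_iset 21 0 k s1) _.
- by split=> // k kn; lia.
- move=> i s1 iN [b01 kp1 up1] si sm.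
  have rc1 : reached s1 by apply: reached_same sm _ _ rc.
  have rt1 : rooted u p e s1 by apply: rooted_same sm _ rt.
  have en : imem s1 0 0 = n1 by exact: in_n1 (rc_inputs rc1).
  have nW : (n1 < W)%N by lia.
  have iW : (i < W)%N by lia.
  have nW' : (n1 - 1 < W)%N by lia.
  have nW'' : (n1 - 1 - i < W)%N by lia.
  set k := (n1 - 1 - i)%N in nW''.
  apply: (htk_assign (n := k)) => //; [by rewrite /= en si|by rewrite /= en si|exact: step_assign|].
  apply: htk_if => //; rewrite [bev _ _]/(0 < k)%N; case: ifP => k0; last first.
    apply: htk_guarantee => [s3 s4 sm3|]; first exact: step_same sm3 _.
    by apply: htk_wp => //; split=> // j jn ij; apply: up1 => //; lia.
  have kn : (0 < k < n1)%N by lia.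
  have f2 := same_iset 25 0 k s1; set s2 := iset s1 25 0 k in f2 *.
  have rc2 : reached s2 by apply: reached_same f2 _ _ rc1.
  have rt2 : rooted u p e s2 by apply: rooted_same f2 _ rt1.
  apply: htk_post (@at_edgeP s2 (ivar 25) k false rc2 b01 rt2 kn _ erefl) _ => //.
  move=> s7 [rc7 a7 rv] _; have [up7 up7'] := revised_up kn rv; split=> //.
    exact: revised_keeps rv kp1.
  move=> j jn ij; have [->//|jk] := eqVneq j k.
  by apply: up7'; [lia | apply: up1 => //; lia].
- by move=> s1 [h1 h2 h3] _; split=> // k kn; apply: h3 => //; lia.
Qed.

Lemma down_loopP s : reached s -> alive01 s -> keeps s -> rooted u p e s ->
  (forall k, (0 < k < n1)%N -> up_ok k s) ->
  htk W step_ok down_loop s (n1 * (m2 * m2)) (fun s' => [/\ alive01 s', keeps s' &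
    forall k, (0 < k < n1)%N -> up_ok k s' /\ down_ok k s']).
Proof.
move=> rc a01 kp rt up.
have n0 := b_n1_gt0 bd; have bn1 := b_n1 bd; have bm1 := b_m1 bd; have m0 := b_m2_gt0 bd.
have X0 : (0 < m2 * m2)%N by rewrite muln_gt0 m0.
pose I i s := [/\ alive01 s, keeps s, forall k, (0 < k < n1)%N -> up_ok k s &
  forall k, (0 < k < i)%N -> down_ok k s].
apply: (@htk_for _ _ _ I _ _ _ _ n1 n1 (m2 * m2)) => //.
- exact: (n1_safe (rc_inputs rc)).
- exact: in_n1 (rc_inputs rc).
- by move=> s1 k; exact: step_same (same_iset 21 0 k s1) _.
- by split=> // k; lia.
- move=> k s1 kN [b01 kp1 up1 dn1] sk sm.
  have rc1 : reached s1 by apply: reached_same sm _ _ rc.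
  have rt1 : rooted u p e s1 by apply: rooted_same sm _ rt.
  have kW : (k < W)%N by lia.
  apply: htk_if => //; first by rewrite /= sk.
  rewrite [bev _ _]/(0 < imem s1 21 0)%N sk; case: ifP => k0; last first.
    apply: htk_guarantee => [s3 s4 sm3|]; first exact: step_same sm3 _.
    by apply: htk_wp => //; split=> // j jn; apply: dn1 => //; lia.
  have kn : (0 < k < n1)%N by lia.
  apply: htk_post (@at_edgeP s1 (ivar 21) k true rc1 b01 rt1 kn _ sk) _; first by rewrite /= sk.
  move=> s7 [rc7 a7 rv] _; have [dn7 dn7' up7] := revised_down kn rv up1; split=> //.
    exact: revised_keeps rv kp1.
  move=> j jn; have [->//|jk] := eqVneq j k.
  by apply: dn7'; [lia | apply: dn1; lia].
- by move=> s1 [h1 h2 h3 h4] _; split=> // k kn; split; [exact: h3 | exact: h4].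
Qed.

(** The earlier end of an edge is an earlier neighbour of its later end, and by acyclicity the
    parent is the only one. Support along parent edges is therefore support along all edges. *)
Lemma tree_order_edge f : exists2 k, (0 < k < n1)%N & f = e k.
Proof.
have [i iN ui] := grown_onto ord.1 (ends f).1; have [j jN uj] := grown_onto ord.1 (ends f).2.
suff H a b : (a < b < n1)%N -> ends f = (u a, u b) \/ ends f = (u b, u a) ->
    exists2 k, (0 < k < n1)%N & f = e k.
  have Ef : ends f = (u i, u j) by rewrite ui uj -surjective_pairing.
  have [ij|ji|ij] := ltngtP i j.
  - by apply: (H i j); [rewrite ij | left].
  - by apply: (H j i); [rewrite ji | right].
  - by have := ends_loopless f; rewrite -ui -uj ij eqxx.
move=> ab Ef; exists b; first by lia.
have [|pb ub upb] := ord.2 b; first by lia.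
have Aab : adj G1 (u a) (u b) by apply/adjP; exists f.
have Eb : ends (e b) = (u (p b), u b) \/ ends (e b) = (u b, u (p b)).
  by rewrite ub upb /end_of; case: (o b); [right | left]; exact: surjective_pairing.
have Apb : adj G1 (u (p b)) (u b) by apply/adjP; exists (e b).
have pa := grown_parent tree.2 ord.1 ab pb Aab Apb.
rewrite pa in Eb; apply: ends_simple; case: Ef => ->; case: Eb => ->; tauto.
Qed.

Definition consistent s := forall f b k, alive s (end_of b f) k ->
  exists2 l, alive s (end_of (~~ b) f) l & compatible b f k l.

Lemma consistentP s : (forall k, (0 < k < n1)%N -> up_ok k s /\ down_ok k s) -> consistent s.
Proof.
move=> H f b i; have [k kn ->] := tree_order_edge f; have [up dn] := H k kn.
have [_ uk upk] := ord.2 k kn; have [->|nb] := eqVneq b (o k).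
  by rewrite -uk -upk; exact: dn.
have -> : b = ~~ o k by move: nb; case: b; case: (o k).
by rewrite negbK -uk -upk; exact: up.
Qed.

(** In the order [u] each new vertex is constrained by its parent alone, and consistency extends the
    choice made there. *)
Lemma feasible_of_consistent s : consistent s -> (forall v, exists k, alive s v k) ->
  exists js : V -> 'I_m2, feasible eps js.
Proof.
move=> cs ne; have [a0 a0P] := ne (u 0%N).
have [f [fa fc]] : exists f : V -> nat, (forall v, alive s v (f v)) /\
    forall k, (0 < k < n1)%N -> compatible (o k) (e k) (f (u k)) (f (u (p k))).
  suff H m : (m <= n1)%N -> exists f : V -> nat, forall k, (k < m)%N -> alive s (u k) (f (u k)) /\
      ((0 < k)%N -> compatible (o k) (e k) (f (u k)) (f (u (p k)))).
    have [f fP] := H n1 (leqnn _); exists f; split=> [v|k /andP[k0 kn]]; last exact: (fP k kn).2.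
    by have [k kn <-] := grown_onto ord.1 v; have [] := fP k kn.
  elim: m => [_|m IH mn]; first by exists (fun=> 0%N).
  have [f fP] := IH (ltnW mn).
  have [i [ai ci]] : exists i, alive s (u m) i /\ ((0 < m)%N -> compatible (o m) (e m) i (f (u (p m)))).
    case: (posnP m) => [->|m0]; first by exists a0.
    have [|pm um upm] := ord.2 m; first by rewrite m0.
    have [ap _] := fP (p m) pm; rewrite upm in ap; have [i] := cs _ _ _ ap.
    by rewrite negbK -um => ai /compatible_sym; rewrite negbK => ci; exists i; rewrite upm.
  have other k : (k < m)%N -> (u k == u m) = false.
    by move=> km; apply/eqP; apply: order_neq; lia.
  exists (fun v => if v == u m then i else f v) => k; rewrite ltnS leq_eqVlt => /predU1P[->|km].
    rewrite eqxx; split=> // m0; have [|pm _ _] := ord.2 m; first by rewrite m0.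
    by rewrite other //; exact: ci.
  rewrite other //; have [h1 h2] := fP k km; split=> // k0.
  have [|pk _ _] := ord.2 k; first by lia.
  by rewrite other //; [exact: h2 | lia].
have /choice[js jsP] : forall v, exists j, lab v j = (f v).+1.
  by move=> v; have [fc' _] := fa v; exact: lab_onto (L v) _ fc'.
have hit v : hits (pos v) eps (js v) by apply/(lab_hits (L v)); rewrite jsP.
exists js; split=> // g; have [k kn ->] := tree_order_edge g.
have [_ uk upk] := ord.2 k kn; have := fc k kn; rewrite uk upk.
have same_class v i : lab v i = (f v).+1 -> connect (linked (pos v) eps) (js v) i.
  by move=> li; apply/(lab_linked (L v)) => //; [apply/(lab_hits (L v)); rewrite li | rewrite jsP].
(* The certificate may join other edges of the two classes; moving inside the placements leads from
   the chosen edges to these. *)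
have J : joined (e k) (f (ends (e k)).1) (f (ends (e k)).2) -> 
    cert (pos (ends (e k)).1) (pos (ends (e k)).2) eps (js (ends (e k)).1) (js (ends (e k)).2).
  move=> [i [j [li lj ce]]]; apply: (cert_linked_l (ltW eps0) (same_class _ _ li)).
  apply: cert_linked_r (ltW eps0) _ ce.
  by rewrite (sym_connect_sym (linked_sym _ _)); exact: same_class.
by rewrite /compatible /end_of; case: (o k) => /=; exact: J.
Qed.

End Order.

Lemma consistent_valid s v D : consistent s -> remaining cnt class s v D ->
  valid eps (remaining cnt class s) v D.
Proof.
move=> cs [k ak <-] w /adjP[f Ef].
have [b vb wb] : exists2 b, v = end_of b f & w = end_of (~~ b) f.
  by case: Ef => E; [exists false | exists true]; rewrite /end_of E.
rewrite vb in ak *; have [l al cl] := cs f b k ak.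
rewrite wb; exists (class (end_of (~~ b) f) l); first by exists l.
by have := (reachable_compatible (~~ b) f l k).2; rewrite negbK; apply; apply/compatible_sym; rewrite negbK.
Qed.

Lemma prune_progP s : reached s -> (forall v k, (k < cnt v)%N -> imem s 6 (v * m2 + k)%N = 1%N) ->
  htk W step_ok prune_prog s (n1 * (4 * m2 * m2)) (fun s' => [/\ reached s', alive01 s', keeps s', consistent s' &
    (forall v, exists k, alive s' v k) -> exists js : V -> 'I_m2, feasible eps js]).
Proof.
move=> rc a1; have m0 := b_m2_gt0 bd; have n0 := b_n1_gt0 bd.
have X1 : (4 * n1 <= n1 * (4 * m2 * m2))%N by rewrite mulnC leq_mul2l -mulnA leq_pmulr ?orbT // muln_gt0 m0.
have X2 : (n1 * (m2 * m2) <= n1 * (4 * m2 * m2))%N.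
  by rewrite leq_mul2l -[(4 * m2 * m2)%N]mulnA leq_pmull ?orbT.
have a01 : alive01 s by move=> v k kc; rewrite a1.
have kp : keeps s.
  by move=> js fj v; have /andP[h1 h2] := feasible_lab fj v; split; rewrite ?a1 // prednK.
apply: (htk_seq (Q1 := fun s' => exists u, bfs u s')).
  apply: htk_guarantee => [sa sb sm3|]; first exact: step_same sm3 _.
  exact: htk_mono X1 (root_searchP (rc_inputs rc)).
move=> s1 [u /rooted_of_bfs[p [b [e [ord rt]]]]] f1.
have rc1 : reached s1 by apply: reached_same f1 _ _ rc.
have al1 v k : alive s1 v k <-> alive s v k by rewrite /alive f1.1.
have a011 : alive01 s1 by move=> v k kc; rewrite f1.1 // a01.
have kp1 : keeps s1 by move=> js fj v; apply/al1; exact: kp.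
apply: (htk_seq (htk_mono X2 (up_loopP ord rc1 a011 kp1 rt))) => s2 [a012 kp2 up2] f2.
have rc2 : reached s2 by apply: reached_same f2 _ _ rc1.
have rt2 : rooted u p e s2 by apply: rooted_same f2 _ rt.
apply: htk_post (htk_mono X2 (down_loopP ord rc2 a012 kp2 rt2 up2)) _ => s3 [a013 kp3 H] f3.
have cs := consistentP ord H.
split=> //; first by apply: reached_same f3 _ _ rc2.
exact: feasible_of_consistent ord _ cs.
Qed.

Lemma labels_stored s : labels s ->
  stores_placements eps cnt class s.
Proof.
move=> lb v; have [c l] := lb v; have bij := class_bij (L v).
have meets := fun k j => class_meets k j (L v).
split=> // [|j k kc|j]; rewrite /label_array ?l.
- by rewrite /placements in_ballE.
- exact: meets.
- split=> [l0 k kc|H].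
    apply/seteqP; split=> // x hx; have : lab v j = k.+1 by apply/meets; exists x.
    by rewrite l0.
  case E: (lab v j) => [//|k]; have kc : (k < cnt v)%N by rewrite -E (lab_le (L v)).
  by have /meets[x] := E; rewrite H.
Qed.

Lemma reached_stored s : reached s -> stores_reachability eps cnt class s.
Proof.
move=> rc e k l kc lc; have h1 := cntm (ends e).1; have h2 := cntm (ends e).2.
rewrite (rc_reach rc); try lia; congr nat_of_bool; apply: asbool_equiv_eq.
exact: iff_sym (reachable_compatible true e k l).
Qed.

Lemma remaining_all s v : (forall k, (k < cnt v)%N -> imem s 6 (v * m2 + k)%N = 1%N) ->
  remaining cnt class s v = placements G2 eps v.
Proof.
move=> a1; have [sub _ onto] := class_bij (L v); rewrite /placements in_ballE //.
apply/seteqP; split=> D; first by move=> [k [kc _] <-]; exact: sub.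
by move=> /onto[k kc <-]; exists k => //; split=> //; exact: a1.
Qed.

Lemma answer_progP s : inputs s -> labels s -> alive01 s ->
  htk W any answer_prog s (n1 * m2) (fun s' =>
    imem s' 7 0 = `[< forall v, exists k, alive s v k >] :> nat).
Proof.
move=> inp lb a01.
have n0 := b_n1_gt0 bd; have bn1 := b_n1 bd; have bm2 := b_m2 bd; have m0 := b_m2_gt0 bd.
have X0 : (0 < n1 * m2)%N by rewrite muln_gt0 n0.
apply: (@htk_seq _ _ _ _ _ _ _ (fun s' => s' = iset s 7 0 1%N)); first exact: htk_wp.
move=> _ -> _; set s0 := iset s 7 0 1%N.
have inp0 : inputs s0 by exact: inputs_iset.
pose I n s1 := imem s1 7 0 = `[< forall v : 'I_n1, (v < n)%N -> exists k, alive s v k >] :> nat.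
apply: (@htk_for _ _ _ I _ _ _ _ n1 n1 m2) => //.
- exact: (n1_safe inp0).
- exact: in_n1 inp0.
- by rewrite /I asboolT.
- move=> n s1 nn In sn sm; set v := Ordinal nn; have sv : imem s1 34 0 = v by [].
  have inp1 : inputs s1 by apply: inputs_same sm _ _ inp0.
  have lb1 : labels s1 by move=> w; have [h1 h2] := lb w; split=> [|j]; rewrite sm.1 //= ?h1 ?h2.
  have al1 k : imem s1 6 k = imem s 6 k by rewrite sm.1.
  apply: (@htk_seq _ _ _ _ _ _ _ (fun s' => s' = iset s1 31 0 0%N)); first exact: htk_wp.
  move=> _ -> _; set s2 := iset s1 31 0 0%N.
  have lb2 : labels s2 by apply: labels_same (same_iset _ _ _ _) _ _ lb1.
  have inp2 : inputs s2 by exact: inputs_iset.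
  have [cs ce] := cnt_safe lb2 (sv : imem s2 34 0 = v) isT; have cm := cntm v.
  pose J k s3 := imem s3 31 0 = `[< exists2 i, (i < k)%N & alive s v i >] :> nat.
  apply: (@htk_seq _ _ _ _ _ _ _ (J (cnt v))).
    apply: (@htk_for _ _ _ J _ _ _ _ (cnt v) m2 1) => //.
    + by rewrite muln1.
    + by rewrite /J asboolF // => -[].
    + move=> k s3 kc Jk sk sm3; have km : (k < m2)%N by lia.
      have inp3 : inputs s3 by apply: inputs_same sm3 _ _ inp2.
      have m3 := in_m2 inp3.
      have sv3 : imem s3 34 0 = v by rewrite sm3.1.
      have al3 : imem s3 6 (v * m2 + k)%N = imem s 6 (v * m2 + k)%N by rewrite sm3.1 //= al1.
      have [cW cW'] := lt_cell nn km; have a0 := a01 v k kc.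
      have kW : (k < W)%N by lia.
      have vW : (v < W)%N by rewrite /=; lia.
      have mW : (m2 < W)%N by lia.
      have aW : (imem s 6 (v * m2 + k) < W)%N by lia.
      have step : `[< exists2 i, (i < k.+1)%N & alive s v i >] =
         (0 < imem s3 31 0)%N || (0 < imem s 6 (v * m2 + k))%N.
        rewrite Jk lt0b; apply/asboolP/orP.
          move=> [i]; rewrite ltnS leq_eqVlt => /predU1P[->|ik] ai; last by left; apply/asboolP; exists i.
          by right; case: ai => _ ->.
        move=> [/asboolP[i ik ai]|a1]; first by exists i => //; exact: ltnW.
        by exists k => //; split=> //; lia.
      apply: htk_wp => //; rewrite /= sv3 sk m3 al3; split=> //.
      case: ifP => c; first by split=> //; rewrite /J step c orbT.
      by rewrite /J step c orbF Jk lt0b.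
  move=> s3 J3 sm3.
  have J3' : imem s3 31 0 = `[< exists k, alive s v k >] :> nat.
    rewrite J3; congr nat_of_bool; apply: asbool_equiv_eq; split=> -[k]; first by exists k.
    by move=> ak; exists k => //; case: ak.
  have bW : (imem s3 31 0 < W)%N by rewrite J3'; case: asboolP.
  have step : `[< forall w : 'I_n1, (w < n.+1)%N -> exists k, alive s w k >] =
     (0 < imem s3 31 0)%N && (0 < imem s1 7 0)%N.
    rewrite J3' In !lt0b; apply/asboolP/andP.
      move=> H; split; apply/asboolP; first by apply: H => /=.
      by move=> w wn; apply: H; exact: ltnW.
    move=> [/asboolP a /asboolP b] w; rewrite ltnS leq_eqVlt => /predU1P[E|]; last exact: b.
    by have -> : w = v by exact: val_inj.
  have s7 : imem s3 7 0 = imem s1 7 0 by rewrite sm3.1.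
  have s71 : imem s1 7 0 = (0 < imem s1 7 0)%N by rewrite In lt0b.
  apply: htk_wp => //=; split=> //.
  case: ifP => c; first by split=> //; rewrite /I step ltnNge c.
  by rewrite /I step ltnNge c /= s7 -s71.
- move=> s1 H _; rewrite H; congr nat_of_bool; apply: asbool_equiv_eq; split=> h v //; exact: h.
Qed.

End Labelled.

Lemma gda_correct (T : nat) :
  (kcost (place_prog d) * (n1 * (m2 * (2 * m2))) + kcost (reach_prog d) * (n1 * (8 * m2 * m2)) +
   kcost prune_prog * (n1 * (4 * m2 * m2)) + kcost answer_prog * (n1 * m2) <= T)%N ->
  exists t s, [/\ gda_run W (gda d) G1 G2 eps t s, (t <= T)%N &
    answers_yes s <-> (graph_dist G1 G2 <= eps%:E)%E].
Proof.
move=> leT.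
have framed c s X Q : htk W any c s X Q -> htk W any c s X (fun s' => Q s' /\ same (imods c) (rmods c) s s').
  by move=> H; apply: htk_post H _.
have [tr1 [t1 [s1 [E1 l1 [P1 f1] _]]]] := framed _ _ _ _ (place_progP (inputs_initial G1 G2 eps)).
pose lab (v : 'I_n1) (j : 'I_m2) := imem s1 4 (v * m2 + j)%N; pose cnt (v : 'I_n1) := imem s1 3 v.
have L v : labelling (pos v) eps (lab v) (cnt v) by exact: P1.
have inp1 : inputs s1 by apply: inputs_same f1 _ _ (inputs_initial G1 G2 eps).
have lb1 : labels lab cnt s1 by [].
have z5 c : imem s1 5 c = 0%N by rewrite f1.1.
have [tr2 [t2 [s2 [E2 l2 [rc2 a2] _]]]] := reach_progP L inp1 lb1 z5.
have [tr3 [t3 [s3 [E3 l3 [rc3 a3 k3 c3 fs3] ch3]]]] := prune_progP L rc2 a2.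
have [tr4 [t4 [s4 [E4 l4 A4 _]]]] := answer_progP L (rc_inputs rc3) (rc_labels rc3) a3.
exists (t1 + t2 + t3 + t4)%N, s4; split.
- apply: (@GdaRun _ _ _ _ _ _ _ cnt (class lab) tr1 t1 s1 tr2 t2 s2 tr3 t3 s3 tr4 t4 s4) => //.
  + exact: labels_stored.
  + by apply: labels_stored => //; exact: rc_labels rc2.
  + exact: reached_stored.
  + by move=> v; apply: remaining_all => // k; exact: a2.
  + by move=> v D; exact: (consistent_valid L c3).
  + rewrite /answer_array A4; congr nat_of_bool; apply: asbool_equiv_eq.
    split=> H v; first by have [k ak] := H v; exists (class lab v k); exists k.
    by have [D [k ak _]] := H v; exists k.
- by apply: leq_trans leT; rewrite !leq_add.
- rewrite /answers_yes /answer_array A4; split.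
    case: asboolP => // H _; have [js fj] := fs3 H.
    exact: (dist_of_feasible eps0 fj).
  move=> /(feasible_of_dist eps0 m1_gt0 tree.1)[js fj]; rewrite asboolT // => v.
  by exists (lab v (js v)).-1; exact: k3.
Qed.

End Correctness.

Lemma cost_bound a b c e n m D : (0 < m)%N ->
  (a * (n * (m * (2 * m))) + b * (n * (8 * m * m)) + c * (n * (4 * m * m)) + e * (n * m) <=
   (D + 2 * a + 8 * b + 4 * c + e) * (n * m ^ 2))%N.
Proof.
move=> m0; have H : (e * (n * m) <= e * (n * m ^ 2))%N.
  by rewrite !leq_mul2l expnS expn1 leq_pmulr ?orbT.
have -> : (a * (n * (m * (2 * m))) = 2 * a * (n * m ^ 2))%N by rewrite expnS expn1; ring.
have -> : (b * (n * (8 * m * m)) = 8 * b * (n * m ^ 2))%N by rewrite expnS expn1; ring.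
have -> : (c * (n * (4 * m * m)) = 4 * c * (n * m ^ 2))%N by rewrite expnS expn1; ring.
by rewrite !mulnDl; lia.
Qed.

Theorem theorem4 (R : realType) (d : nat) :
  exists (p : gda_program) (K : nat),
  forall (G1 G2 : embgraph R d) (eps : R),
    0 < eps ->
    graph_connected G1 -> graph_connected G2 ->
    (0 < ne G1)%N -> (0 < ne G2)%N ->
    is_tree G1 ->
    exists (t : nat) (s : state R),
      [/\ gda_run (K * (nv G1 * ne G2 ^ 2)) p G1 G2 eps t s,
          (t <= K * (nv G1 * ne G2 ^ 2))%N &
          answers_yes s <-> (graph_dist G1 G2 <= eps%:E)%E].
Proof.
(* The terms [2 * d + 110] make the space bound exceed all indices and counters; the factors 2, 8, 4
   and 1 come from the cost bounds of the four steps. *)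
exists (gda d), (2 * d + 110 + 2 * kcost (place_prog d) + 8 * kcost (reach_prog d) +
  4 * kcost prune_prog + kcost answer_prog)%N => G1 G2 eps e0 conn1 conn2 m1 m2 tree.
set K := (2 * d + 110 + 2 * kcost (place_prog d) + 8 * kcost (reach_prog d) + 4 * kcost prune_prog + kcost answer_prog)%N.
have n1 : (0 < nv G1)%N by have := ltn_ord (ends (Ordinal m1)).1; lia.
have n2m2 := connected_nv conn2 m2; have m1n1 := tree_edges tree n1.
have P0 : (0 < nv G1 * ne G2 ^ 2)%N by rewrite muln_gt0 n1 expn_gt0 m2.
have mP : (ne G2 <= nv G1 * ne G2 ^ 2)%N.
  by rewrite expnS expn1 mulnCA leq_pmulr // muln_gt0 n1.
have nP : (nv G1 <= nv G1 * ne G2 ^ 2)%N by rewrite leq_pmulr // expn_gt0 m2.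
have KP k : (k <= K)%N -> (k * (nv G1 * ne G2 ^ 2) <= K * (nv G1 * ne G2 ^ 2))%N by move=> h; rewrite leq_mul2r h orbT.
have K1 := KP (2 * d + 110)%N ltac:(rewrite /K; lia).
have dP : (d <= d * (nv G1 * ne G2 ^ 2))%N by rewrite leq_pmulr.
have b : bounds G1 G2 (K * (nv G1 * ne G2 ^ 2)).
  have P2 : (nv G1 * ne G2 * ne G2 = nv G1 * ne G2 ^ 2)%N by rewrite -mulnA mulnn.
  have dn1 : (nv G1 * d <= d * (nv G1 * ne G2 ^ 2))%N by rewrite mulnC leq_mul2l nP orbT.
  have dn2 : (nv G2 * d <= 2 * (d * (nv G1 * ne G2 ^ 2)))%N.
    by rewrite mulnC mulnCA leq_mul2l; apply/orP; right; lia.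
  rewrite mulnDl in K1; split; rewrite ?mulnS ?P2 //; try lia.
  exact: connected_inc.
apply: (gda_correct b e0 tree m1).
exact: cost_bound.
Qed.
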